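(* There is an algorithm which, given a complete bipartite framework $(K(n,m),{\bf p},{\bf q})$ in $\mathbb R^d$ whose coordinates are rational numbers of total bit length $L$, decides whether the framework is dimensionally rigid and whether it is universally rigid, in time bounded by a polynomial in $n+m$ and $L$ (weakly polynomial time).
   Context: $(K(n,m),{\bf p},{\bf q})$ is the framework with points ${\bf p}_1,\dots,{\bf p}_n,{\bf q}_1,\dots,{\bf q}_m\in\mathbb R^d$ and bars joining ${\bf p}_i$ to ${\bf q}_j$ for all $i,j$. A framework is universally rigid if every configuration in any $\mathbb R^D$ with the same bar lengths has all pairwise distances equal to those of the original; a framework with $d'$-dimensional affine span is dimensionally rigid if every configuration in any $\mathbb R^D$ with the same bar lengths has affine span of dimension at most $d'$. *)

(* Defs.v *)
From Stdlib Require Import BinNat BinPos Rdefinitions.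
From HB Require Import structures.
From mathcomp Require Import all_boot all_order all_algebra.
From mathcomp Require Import Rstruct.
Set Implicit Arguments. Unset Strict Implicit. Unset Printing Implicit Defensive.
Import Order.TTheory GRing.Theory Num.Theory.
Local Open Scope ring_scope.

Section Frameworks.
Variable F : realFieldType.

Definition sqdist (D : nat) (x y : 'rV[F]_D) : F :=
  \sum_(k < D) (x 0 k - y 0 k) ^+ 2.

Definition allpts (n m D : nat) (p : 'I_n -> 'rV[F]_D) (q : 'I_m -> 'rV[F]_D)
  (k : 'I_(n + m)) : 'rV[F]_D :=
  match split k with inl i => p i | inr j => q j end.

(* dimension of the affine span of a finite point family: the dimension
   of the linear span of all differences x_k - x_l
   (0 for the empty family). *)
Definition affdim (N D : nat) (x : 'I_N -> 'rV[F]_D) : nat :=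
  \rank ((\sum_(k < N) \sum_(l < N) <<x k - x l>>)%MS : 'M[F]_D).

End Frameworks.

Definition same_bars (n m d D : nat)
  (p : 'I_n -> 'rV[Rdefinitions.R]_d) (q : 'I_m -> 'rV[Rdefinitions.R]_d)
  (p' : 'I_n -> 'rV[Rdefinitions.R]_D) (q' : 'I_m -> 'rV[Rdefinitions.R]_D) : Prop :=
  forall i j, sqdist (p' i) (q' j) = sqdist (p i) (q j).

Definition universally_rigid (n m d : nat)
  (p : 'I_n -> 'rV[Rdefinitions.R]_d) (q : 'I_m -> 'rV[Rdefinitions.R]_d) : Prop :=
  forall (D : nat) (p' : 'I_n -> 'rV[Rdefinitions.R]_D) (q' : 'I_m -> 'rV[Rdefinitions.R]_D),
    same_bars p q p' q' ->
    forall k l : 'I_(n + m),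
      sqdist (allpts p' q' k) (allpts p' q' l) = sqdist (allpts p q k) (allpts p q l).

Definition dimensionally_rigid (n m d : nat)
  (p : 'I_n -> 'rV[Rdefinitions.R]_d) (q : 'I_m -> 'rV[Rdefinitions.R]_d) : Prop :=
  forall (D : nat) (p' : 'I_n -> 'rV[Rdefinitions.R]_D) (q' : 'I_m -> 'rV[Rdefinitions.R]_D),
    same_bars p q p' q' ->
    (affdim (allpts p' q') <= affdim (allpts p q))%N.

Definition realize (n d : nat) (p : 'I_n -> 'rV[rat]_d) : 'I_n -> 'rV[Rdefinitions.R]_d :=
  fun i => map_mx (fun r : rat => ratr r) (p i).

(* Input encoding (alphabet: 0 blank, 1 bit '0', 2 bit '1',           *)
(*                 3 separator '#', 4 minus sign '-')                 *)

Fixpoint pos_bits (x : positive) : seq nat :=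
  match x with
  | xH => [:: 2%N]
  | xO y => 1%N :: pos_bits y
  | xI y => 2%N :: pos_bits y
  end.

(* binary, little endian; 0 is written as a single '0' *)
Definition enc_nat (k : nat) : seq nat :=
  match N.of_nat k with N0 => [:: 1%N] | Npos x => pos_bits x end.

Definition enc_int (z : int) : seq nat :=
  match z with
  | Posz k => enc_nat k
  | Negz k => 4%N :: enc_nat k.+1
  end.

Definition enc_rat (r : rat) : seq nat :=
  enc_int (numq r) ++ 3%N :: enc_nat (absz (denq r)).

Definition enc_framework (n m d : nat)
  (p : 'I_n -> 'rV[rat]_d) (q : 'I_m -> 'rV[rat]_d) : seq nat :=
  enc_nat n ++ 3%N :: enc_nat m ++ 3%N :: enc_nat d ++
  flatten [seq flatten [seq 3%N :: enc_rat (p i 0 k) | k <- enum 'I_d] | i <- enum 'I_n] ++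
  flatten [seq flatten [seq 3%N :: enc_rat (q j 0 k) | k <- enum 'I_d] | j <- enum 'I_m].

(*   states 'I_(ns+5): 0 = start, 1..4 = halting states;              *)
(*   halting state 1 + b1 + 2*b2 outputs the pair of booleans (b1,b2) *)
(*   tape alphabet 'I_(na+5) containing the 5 input symbols, 0 blank; *)
(*   moves 'I_3: 0 = left, 1 = stay, 2 = right.                       *)

Record TM := MkTM {
  tm_ns : nat;
  tm_na : nat;
  tm_delta : 'I_(tm_ns.+4.+1) -> 'I_(tm_na.+4.+1) ->
             'I_(tm_ns.+4.+1) * 'I_(tm_na.+4.+1) * 'I_3 }.

Record config (M : TM) := MkConfig {
  c_state : 'I_((tm_ns M).+4.+1);
  c_head : int;
  c_tape : int -> 'I_((tm_na M).+4.+1) }.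

Definition halting (M : TM) (s : 'I_((tm_ns M).+4.+1)) : bool :=
  (1 <= nat_of_ord s <= 4)%N.

Definition tm_step (M : TM) (c : config M) : config M :=
  if halting (c_state c) then c else
  let: (s', w, mv) := tm_delta (c_state c) (c_tape c (c_head c)) in
  MkConfig s' (c_head c + ((nat_of_ord mv)%:Z - 1))
           (fun z => if z == c_head c then w else c_tape c z).

Definition tm_init (M : TM) (w : seq nat) : config M :=
  MkConfig ord0 0
    (fun z => match z with
              | Posz k => if (k < size w)%N then inord (nth 0%N w k) else ord0
              | Negz _ => ord0
              end).

Definition tm_run (M : TM) (t : nat) (w : seq nat) : config M :=
  iter t (@tm_step M) (tm_init M w).

Definition halt_out (M : TM) (b1 b2 : bool) : 'I_((tm_ns M).+4.+1) :=
  inord (1 + b1 + 2 * b2)%N.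

(* Main.v *)
(* Write h_k = (1, x_k) and let the sign of a vertex be its side of K(n,m).
   Start from S = {} and, as long as possible, enlarge S: project the h_k
   orthogonally to span(h_s, s in S), obtaining g_k, and add to S the support of a
   nonnegative lambda, of largest support, with
   sum sign_k lambda_k g_k^T g_k = 0.  Along the way both sides of S keep the same
   affine span, and every framework with the same bar lengths is on S an affine
   image of the original one: comparing with a congruent copy that agrees on S, the
   displacements satisfy an energy identity, a vanishing sum of squares weighted by
   lambda.  When S is maximal, Gordan's theorem yields a quadratic form A that
   vanishes on S and has the sign of the vertex on every h_k with k outside S;
   bending the two sides along -A and +A, one may attach to each such vertex its own
   new coordinate without changing bar lengths.  Hence the framework is
   dimensionally rigid iff dim span(all h) = dim span(h_S) + #(complement of S), and
   universally rigid iff each side has at most one vertex outside S.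

   The largest support of a linear system is found by a perceptron on its
   orthogonally projected columns, with columns rescaled when progress stalls; a
   column rescaled more often than Cramer's rule allows cannot be in the support.
   Projections are computed with exact integer divisions, so all numbers stay of
   polynomial length.  Polynomial-time functions are built from combinators
   compiled to machines with three stacks, which one tape simulates. *)
From Stdlib Require Import ZArith Lia FunctionalExtensionality.
Require Import Defs.
From HB Require Import structures.
From mathcomp Require Import all_boot all_order all_algebra.
From mathcomp Require Import perm Rstruct zify ring lra.
Set Implicit Arguments. Unset Strict Implicit. Unset Printing Implicit Defensive.
Import Order.TTheory GRing.Theory Num.Theory.

Local Open Scope nat_scope.

(** * Stack machines *)

(** For a general graph such questions lead to semidefinite feasibility, for which no exact
    polynomial-time method is known. Here the weights lambda alone govern a stress, because every
    vertex of one side is joined to every vertex of the other, so each enlargement of S is a linear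
    feasibility problem. One maximal lambda is not enough: after projection the remaining vectors
    may admit a new one, hence the iteration. The bending is exact for finite parameters, not just
    to first order. The two sides are mapped by [(I - B, B)] and [(I + B, B)] with B symmetric, and
    [(I - B)(I + B) + B B = I], so products along bars do not change. Each vertex outside S loses
    some squared length, positive when B is a small multiple of A, and its own new coordinate
    restores exactly that loss. For the running time, loop counts are unary, coefficients are
    binary, and every loop carries an a priori bound on its intermediate states. The numbers n, m, d
    are written in binary and may be exponentially large when no coordinate follows, which forces a
    separate treatment of that case. *)

Definition sym := (bool * bool)%type.

Inductive ix := SA | SB | SC.

Definition tri (X : Type) := (X * X * X)%type.

Definition tget X (i : ix) (s : tri X) : X :=
  match i with SA => s.1.1 | SB => s.1.2 | SC => s.2 end.

Definition tset X (i : ix) (x : X) (s : tri X) : tri X :=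
  match i with
  | SA => (x, s.1.2, s.2) | SB => (s.1.1, x, s.2) | SC => (s.1.1, s.1.2, x)
  end.

Definition store := tri (seq sym).

(** Popping an empty stack is legal and reports [None]; programs detect the bottom of a stack in
    this way. *)
Inductive instr (Q : Type) :=
  | Push of ix & sym & Q
  | Pop of ix & (option sym -> Q).

Definition instr_map (Q R : Type) (h : Q -> R) (c : instr Q) : instr R :=
  match c with Push i a q => Push i a (h q) | Pop i f => Pop i (h \o f) end.

Definition exec1 (Q : Type) (c : instr Q) (st : store) : Q * store :=
  match c with
  | Push i a q => (q, tset i (a :: tget i st) st)
  | Pop i f => (f (ohead (tget i st)), tset i (behead (tget i st)) st)
  end.

(* A program fragment: a finite control whose exits are labelled by [X]. *)
Record frag (X : Type) := Frag {
  fQ : finType; f0 : fQ; fd : fQ -> instr (fQ + X) }.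

Definition fstep X (fr : frag X) (c : (fQ fr + X) * store) :=
  match c.1 with inl q => exec1 (fd q) c.2 | inr _ => c end.

(** Exits are absorbing for [fstep], so this means within [t] steps, and time bounds may be rounded
    up freely. *)
Definition reach X (fr : frag X) st t x st' :=
  iter t (fstep (fr := fr)) (inl (f0 fr), st) = (inr x, st').

Lemma fstep_exit X (fr : frag X) t x st :
  iter t (fstep (fr := fr)) (inr x, st) = (inr x, st).
Proof. by elim: t => //= t ->. Qed.

Lemma reach_mono X (fr : frag X) st t t' x st' :
  reach fr st t x st' -> t <= t' -> reach fr st t' x st'.
Proof.
by rewrite /reach => H /subnK <-; rewrite iterD H fstep_exit.
Qed.

Lemma exec1_map (Q R : Type) (h : Q -> R) c st :
  exec1 (instr_map h c) st = (h (exec1 c st).1, (exec1 c st).2).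
Proof. by case: c. Qed.

(** [phi] may send an exit of [f] to a live state of [g]. Once [f] has exited it idles while [g]
    would move on, so the count is cut at the instant of exit; this is why [t'] may be smaller than
    [t]. *)
Lemma run_emb X Y (f : frag X) (g : frag Y) (phi : fQ f + X -> fQ g + Y) :
  (forall q st, fstep (phi (inl q), st)
     = (phi (fstep (inl q, st)).1, (fstep (fr := f) (inl q, st)).2)) ->
  forall t q st x st', iter t (fstep (fr := f)) (q, st) = (inr x, st') ->
  exists2 t', t' <= t & iter t' (fstep (fr := g)) (phi q, st) = (phi (inr x), st').
Proof.
move=> H; elim=> [|t IH] q st x st'; first by move=> [-> ->]; exists 0.
rewrite iterSr; case: q => [q|y]; last first.
  by rewrite {2}/fstep /= fstep_exit => -[-> ->]; exists 0.
case E: (fstep (inl q, st)) => [q1 st1] /IH[t' lt' Ht'].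
by exists t'.+1 => //; rewrite iterSr H E.
Qed.

Definition fpush i a : frag unit := @Frag unit unit tt (fun _ => Push i a (inr tt)).
Definition fpop i : frag (option sym) :=
  @Frag _ unit tt (fun _ => Pop i (fun o => inr o)).
(** Every state must execute an instruction, so leaving with an unchanged store costs a push and a
    pop of the same stack. *)
Definition fret X (x : X) : frag X :=
  @Frag X bool false (fun b => if b then Pop SC (fun _ => inr x)
                               else Push SC (false, false) (inl true)).

(** The control contains one copy of each continuation [k x]; finiteness of [X] keeps the dependent
    sum a [finType]. *)
Definition fbind (X : finType) Y (f : frag X) (k : X -> frag Y) : frag Y :=
  @Frag Y (fQ f + {x : X & fQ (k x)})%type (inl (f0 f))
    (fun q => match q with
      | inl q => instr_map (fun r => match r with
          | inl q' => inl (inl q')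
          | inr x => inl (inr (existT _ x (f0 (k x)))) end) (fd q)
      | inr (existT x q) => instr_map (fun r => match r with
          | inl q' => inl (inr (existT _ x q'))
          | inr y => inr y end) (fd q)
      end).

Definition floop X (f : frag (unit + X)) : frag X :=
  @Frag X (fQ f) (f0 f)
    (fun q => instr_map (fun r => match r with
        | inl q' => inl q'
        | inr (inl _) => inl (f0 f)
        | inr (inr x) => inr x end) (fd q)).

Lemma reach_push i a st : reach (fpush i a) st 1 tt (tset i (a :: tget i st) st).
Proof. by []. Qed.

Lemma reach_pop i st :
  reach (fpop i) st 1 (ohead (tget i st)) (tset i (behead (tget i st)) st).
Proof. by []. Qed.

Lemma reach_ret X (x : X) st : reach (fret x) st 2 x st.
Proof. by case: st => [[? ?] ?]. Qed.

Lemma reach_bind (X : finType) Y (f : frag X) (k : X -> frag Y) st t1 x st1 t2 y st2 :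
  reach f st t1 x st1 -> reach (k x) st1 t2 y st2 ->
  reach (fbind f k) st (t1 + t2) y st2.
Proof.
rewrite /reach => H1 H2.
pose phi (r : fQ f + X) : fQ (fbind f k) + Y := match r with
          | inl q' => inl (inl q')
          | inr x => inl (inr (existT _ x (f0 (k x)))) end.
have [|t1' l1 E1] := run_emb (phi := phi) _ H1.
  by move=> q s; rewrite /fstep /= exec1_map.
pose psi (r : fQ (k x) + Y) : fQ (fbind f k) + Y := match r with
          | inl q' => inl (inr (existT _ x q'))
          | inr y => inr y end.
have [|t2' l2 E2] := run_emb (phi := psi) _ H2.
  by move=> q s; rewrite /fstep /= exec1_map.
have E : reach (fbind f k) st (t1' + t2') y st2.
  by rewrite /reach addnC iterD E1 E2.
by apply: reach_mono E _; rewrite leq_add.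
Qed.

Lemma reach_loop_cont X (f : frag (unit + X)) st t1 st1 t2 x st2 :
  reach f st t1 (inl tt) st1 -> reach (floop f) st1 t2 x st2 ->
  reach (floop f) st (t1 + t2) x st2.
Proof.
move=> H1 H2.
pose phi (r : fQ f + (unit + X)) : fQ (floop f) + X := match r with
        | inl q' => inl q'
        | inr (inl _) => inl (f0 f)
        | inr (inr x) => inr x end.
have [|t1' l1 E1] := run_emb (phi := phi) _ H1.
  by move=> q s; rewrite /fstep /= exec1_map.
have E : reach (floop f) st (t1' + t2) x st2.
  by rewrite /reach addnC iterD E1 H2.
by apply: reach_mono E _; rewrite leq_add2r.
Qed.

Lemma reach_loop_exit X (f : frag (unit + X)) st t1 x st1 :
  reach f st t1 (inr x) st1 -> reach (floop f) st t1 x st1.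
Proof.
move=> H1.
pose phi (r : fQ f + (unit + X)) : fQ (floop f) + X := match r with
        | inl q' => inl q'
        | inr (inl _) => inl (f0 f)
        | inr (inr x) => inr x end.
have [|t1' l1 E1] := run_emb (phi := phi) _ H1.
  by move=> q s; rewrite /fstep /= exec1_map.
exact: (reach_mono (t := t1') E1).
Qed.

(** * Simulating a stack machine on one tape *)

(** One track per stack. Bottoms lie at position 0 and stacks grow to the right; position -1 stays
    blank and marks the left end. *)
Definition cell : finType := (option sym * option sym * option sym)%type.
Definition blank : cell := (None, None, None).

Definition rawsym (k : nat) : sym :=
  match k with 1 => (false, false) | 2 => (true, false) | 3 => (false, true)
             | _ => (true, true) end.

Definition rawcell (k : nat) : cell :=
  if k == 0 then blank else (None, None, Some (rawsym k)).

(** Symbols below 5 belong to the input alphabet. Reading them as entries of the third track makes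
    the untouched input word a legal stack, without a conversion pass. *)
Definition decA (a : 'I_(#|{: cell}|.+4.+1)) : cell :=
  if a < 5 then rawcell a else
  if insub (a - 5) : option 'I_#|{: cell}| is Some j then enum_val j else blank.

Definition encA (c : cell) : 'I_(#|{: cell}|.+4.+1) := inord (5 + enum_rank c).

Lemma encAK c : decA (encA c) = c.
Proof.
have lt : 5 + enum_rank c < #|{: cell}|.+4.+1.
  by rewrite !addSn add0n !ltnS.
rewrite /decA /encA inordK //= addKn; case: insubP => [j _ Hj|]; last by rewrite ltn_ord.
by rewrite (_ : j = enum_rank c) ?enum_rankK //; apply: val_inj.
Qed.

(** Each instruction is a round trip from position -1: [Go] walks right to the first cell where the
    track is empty, [Rd] stands on the entry to be popped, [Ret] walks back left to the blank
    cell. *)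
Inductive phase := Go | Rd | Ret.

Section Sim.
Variable fr : frag (bool * bool).
Notation Q := (fQ fr).
Notation S3 := (Q + Q + Q)%type.

Definition mst (ph : phase) (q : Q) : S3 :=
  match ph with Go => inl (inl q) | Rd => inl (inr q) | Ret => inr q end.
Definition unmst (s : S3) : phase * Q :=
  match s with inl (inl q) => (Go, q) | inl (inr q) => (Rd, q) | inr q => (Ret, q) end.

Definition decS (a : 'I_(#|{: S3}|.+4.+1)) : option (phase * Q) :=
  if a < 5 then None else
  omap (unmst \o enum_val) (insub (a - 5) : option 'I_#|{: S3}|).
Definition encS (ph : phase) (q : Q) : 'I_(#|{: S3}|.+4.+1) :=
  inord (5 + enum_rank (mst ph q)).

Lemma encS_val ph q : encS ph q = 5 + enum_rank (mst ph q) :> nat.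
Proof. by rewrite inordK // !addSn add0n !ltnS. Qed.

Lemma encSK ph q : decS (encS ph q) = Some (ph, q).
Proof.
rewrite /decS encS_val /= addKn; case: insubP => [j _ Hj|]; last by rewrite ltn_ord.
have -> : j = enum_rank (mst ph q) by apply: val_inj.
by rewrite /= enum_rankK; case: ph {Hj}.
Qed.

Definition mvL : 'I_3 := @Ordinal 3 0 isT.
Definition mvS : 'I_3 := @Ordinal 3 1 isT.
Definition mvR : 'I_3 := @Ordinal 3 2 isT.

Definition tgt (r : Q + bool * bool) : 'I_(#|{: S3}|.+4.+1) :=
  match r with inl q => encS Ret q | inr b => inord (1 + b.1 + 2 * b.2) end.

Definition sim_delta (s : 'I_(#|{: S3}|.+4.+1)) (a : 'I_(#|{: cell}|.+4.+1)) :
    'I_(#|{: S3}|.+4.+1) * 'I_(#|{: cell}|.+4.+1) * 'I_3 :=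
  let c := decA a in
  match decS s with
  (* Of the states below 5 only the start state ever steps; it moves to position -1, where all round
     trips begin. *)
  | None => (encS Ret (f0 fr), a, mvL)
  | Some (Ret, q) => if c == blank then (encS Go q, a, mvR) else (s, a, mvL)
  | Some (Go, q) =>
      match fd q with
      | Push i x r => if tget i c is None then (tgt r, encA (tset i (Some x) c), mvL)
                      else (s, a, mvR)
      | Pop i g => if tget i c is None then (encS Rd q, a, mvL) else (s, a, mvR)
      end
  | Some (Rd, q) =>
      match fd q with
      | Push _ _ r => (tgt r, a, mvS)
      | Pop i g => let y := tget i c in
          (* If the stack is empty the head already stands at -1 and must not move further left. *)
          (tgt (g y), encA (tset i None c), if y is None then mvS else mvL)
      end
  end.

Definition simTM : TM := @MkTM #|{: S3}| #|{: cell}| sim_delta.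

Definition oat (s : seq sym) (k : nat) : option sym := onth (rev s) k.

Definition cellof (st : store) (z : int) : cell :=
  match z with
  | Posz k => (oat st.1.1 k, oat st.1.2 k, oat st.2 k)
  | Negz _ => blank
  end.

Definition repr (c : config simTM) (s : 'I_(#|{: S3}|.+4.+1)) (h : int) (st : store) :=
  [/\ c_state c = s, c_head c = h & forall z, decA (c_tape c z) = cellof st z].

Lemma oat_cons a s k : oat (a :: s) k =
  if k == size s then Some a else oat s k.
Proof.
rewrite /oat rev_cons -size_rev; move: (rev s) => l {s}.
by elim: l k => [|x l IH] [|k] //=; case: k.
Qed.

Lemma oat_size s k : (oat s k == None) = (size s <= k).
Proof.
rewrite /oat -size_rev; move: (rev s) => l {s}.
by elim: l k => [|x l IH] [|k] //=; rewrite IH.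
Qed.

Lemma halting_encS ph q : halting (M := simTM) (encS ph q) = false.
Proof. by rewrite /halting encS_val. Qed.

Lemma halting_exit (b : bool * bool) : halting (M := simTM) (inord (1 + b.1 + 2 * b.2)).
Proof. by rewrite /halting inordK; case: b => [[] []]. Qed.

Lemma PS n : (Posz n.+1 - 1)%R = Posz n.
Proof. lia. Qed.

Lemma cellof_get st i k : tget i (cellof st (Posz k)) = oat (tget i st) k.
Proof. by case: i. Qed.

Lemma step_move c s h st s' a' mv : repr c s h st ->
  halting (M := simTM) s = false ->
  sim_delta s (c_tape c h) = (s', a', mv) ->
  decA a' = cellof st h ->
  repr (tm_step c) s' (h + ((nat_of_ord mv)%:Z - 1))%R st.
Proof.
case=> [Es Eh Et] hs E Ea; rewrite /tm_step Es hs /= Eh E.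
by split=> //= z; case: eqP => [->|].
Qed.

Lemma run_right c q st i j :
  (exists a r, fd q = Push i a r) \/ (exists g, fd q = Pop i g) ->
  j <= size (tget i st) -> repr c (encS Go q) (Posz j) st ->
  repr (iter (size (tget i st) - j) (@tm_step simTM) c) (encS Go q)
    (Posz (size (tget i st))) st.
Proof.
move=> Hq; move Ek: (size (tget i st) - j) => k.
elim: k j c Ek => [|k IH] j c Ek lej Hc.
  by have -> : size (tget i st) = j by lia.
rewrite iterSr; apply: (IH j.+1); [lia|lia|].
have nb : tget i (decA (c_tape c (Posz j))) != None.
  by case: Hc => _ _ ->; rewrite cellof_get oat_size; lia.
have E : sim_delta (encS Go q) (c_tape c (Posz j)) = (encS Go q, c_tape c (Posz j), mvR).
  rewrite /sim_delta encSK.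
  by case: Hq => [[a [r ->]]|[g ->]]; case: (tget i _) nb.
have := step_move Hc (halting_encS Go q) E; case: Hc => _ _ -> /(_ erefl).
by rewrite (_ : (_ + _)%R = Posz j.+1) //=; lia.
Qed.

(** No blank is met too early, because each of the cells 0 to [j - 1] carries an entry of stack
    [i]. *)
Lemma run_left c q st i j :
  j <= size (tget i st) -> repr c (encS Ret q) (Posz j - 1)%R st ->
  repr (iter j (@tm_step simTM) c) (encS Ret q) (Negz 0) st.
Proof.
elim: j c => [|j IH] c lej Hc //.
have Ej : (Posz j.+1 - 1)%R = Posz j by lia.
rewrite Ej in Hc.
rewrite iterSr; apply: IH; first lia.
have nb : decA (c_tape c (Posz j)) != blank.
  case: (Hc) => _ _ ->; apply/eqP => /(congr1 (tget i)) E.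
  by move: lej; rewrite ltnNge -oat_size -cellof_get E; case: i {E}.
have E : sim_delta (encS Ret q) (c_tape c (Posz j)) = (encS Ret q, c_tape c (Posz j), mvL).
  by rewrite /sim_delta encSK (negPf nb).
have := step_move Hc (halting_encS Ret q) E; case: Hc => _ _ -> /(_ erefl).
by rewrite (_ : (_ + _)%R = (Posz j - 1)%R) //=; lia.
Qed.

Definition rep1 (c : config simTM) (r : Q + bool * bool) (st : store) :=
  match r with
  | inl q => repr c (encS Ret q) (Negz 0) st
  | inr b => c_state c = inord (1 + b.1 + 2 * b.2)
  end.

Lemma run_tgt c r st i j :
  j <= size (tget i st) -> repr c (tgt r) (Posz j - 1)%R st ->
  rep1 (iter j (@tm_step simTM) c) r st.
Proof.
case: r => [q|b] lej Hc /=; first exact: run_left lej Hc.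
case: Hc => E _ _; elim: j {lej} => //= j IH.
by rewrite /tm_step IH halting_exit.
Qed.

Lemma sim_step c q st : rep1 c (inl q) st ->
  exists2 t, t <= 2 * maxn (size st.1.1) (maxn (size st.1.2) (size st.2)) + 4 &
  let r := exec1 (fd q) st in rep1 (iter t (@tm_step simTM) c) r.1 r.2.
Proof.
move=> /= H0.
have szi i : size (tget i st) <= maxn (size st.1.1) (maxn (size st.1.2) (size st.2)).
  by case: i => /=; lia.
set mx := maxn _ _ in szi *.
have H1 : repr (tm_step c) (encS Go q) (Posz 0) st.
  have E : sim_delta (encS Ret q) (c_tape c (Negz 0)) = (encS Go q, c_tape c (Negz 0), mvR).
    by rewrite /sim_delta encSK; case: (H0) => _ _ ->; rewrite eqxx.
  have := step_move H0 (halting_encS Ret q) E; case: H0 => _ _ -> /(_ erefl).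
  by rewrite (_ : (_ + _)%R = Posz 0).
have H2 i : (exists a r, fd q = Push i a r) \/ (exists g, fd q = Pop i g) ->
   repr (iter (size (tget i st)) (@tm_step simTM) (tm_step c)) (encS Go q)
    (Posz (size (tget i st))) st.
  by move=> Hq; have := run_right Hq (leq0n _) H1; rewrite subn0.
have nh := halting_encS Go q.
case Eq: (fd q) => [i a r|i g].
- have [|Es Eh Et] := H2 i; first by left; exists a; exists r.
  move: (szi i) Es Eh Et; set n := size _ => szn; set c2 := iter n _ _ => Es Eh Et.
  have gb : tget i (cellof st (Posz n)) = None.
    by apply/eqP; rewrite cellof_get oat_size.
  have H3 : repr (tm_step c2) (tgt r) (Posz n - 1)%R (exec1 (Push i a r) st).2.
    rewrite /tm_step Es nh /= Eh /sim_delta encSK Eq Et gb.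
    split=> //= z; case: eqP => [->|nz]; last first.
      rewrite Et; case: z nz => // k nk.
      have ek : (k == n) = false by apply/eqP=> ek; apply: nk; rewrite ek.
      by case: (i) @n ek {szn gb c2 Es Eh Et nk} => /= ek; rewrite /cellof /= oat_cons ek.
    rewrite encAK; case: (i) @n gb {szn c2 Es Eh Et} => /= _; rewrite /cellof /= oat_cons eqxx //.
  have ln : n <= size (tget i (exec1 (Push i a r) st).2).
    by case: (i) @n {szn c2 Es Eh Et gb H3} => /=.
  exists (n + n.+2); first lia.
  by rewrite iterD iterS iterSr; apply: run_tgt ln H3.
- have [|Es Eh Et] := H2 i; first by right; exists g.
  move: (szi i) Es Eh Et; set n := size _ => szn; set c2 := iter n _ _ => Es Eh Et.
  have gb : tget i (cellof st (Posz n)) = None.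
    by apply/eqP; rewrite cellof_get oat_size.
  have H3 : repr (tm_step c2) (encS Rd q) (Posz n - 1)%R st.
    rewrite /tm_step Es nh /= Eh /sim_delta encSK Eq Et gb.
    by split=> //= z; case: eqP => [->|].
  have [Es3 Eh3 Et3] := H3.
  have H4 : repr (tm_step (tm_step c2)) (tgt (g (ohead (tget i st)))) (Posz n.-1 - 1)%R
     (exec1 (Pop i g) st).2.
    have Eg : tget i (cellof st (Posz n - 1)%R) = ohead (tget i st).
      rewrite /n; case: (tget i st) (cellof_get st i) => [|x l] H; first by case: (i).
      rewrite [size _]/=.
      by rewrite PS H oat_cons eqxx.
    rewrite {1}/tm_step Es3 (halting_encS Rd q) /= Eh3 /sim_delta encSK Eq Et3 Eg.
    split=> //=.
      rewrite /n; case: (tget i st) => [|x l] //=; lia.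
    move=> z; case: eqP => [->|nz].
      rewrite encAK /n; case: (i) => /=; [move: st.1.1|move: st.1.2|move: st.2];
      case=> [|x l] //; rewrite [size _]/= PS /=;
      by congr (_, _, _); apply/esym/eqP; rewrite oat_size.
    rewrite Et3; case: z nz => // k nk; rewrite /n in nk.
    case: (st) nk => [[s1 s2] s3]; case: (i) => /=; [move: s1|move: s2|move: s3]; case=> [|x l] nk //=;
      rewrite /= oat_cons; case: eqP => // ek; case: nk; rewrite ek [size _]/= PS //.
  have ln : n.-1 <= size (tget i (exec1 (Pop i g) st).2).
    by rewrite /n; case: (i) => /=; rewrite size_behead.
  exists (n.-1 + n.+3); first lia.
  by rewrite iterD 2!iterS iterSr; apply: run_tgt ln H4.
Qed.

Lemma rep1_halt c b st t : rep1 c (inr b) st -> rep1 (iter t (@tm_step simTM) c) (inr b) st.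
Proof.
move=> /= H; elim: t => //= t IH.
by rewrite /tm_step IH halting_exit.
Qed.

Lemma exec1_size (R : Type) (c : instr R) st B :
  maxn (size st.1.1) (maxn (size st.1.2) (size st.2)) <= B ->
  let st' := (exec1 c st).2 in
  maxn (size st'.1.1) (maxn (size st'.1.2) (size st'.2)) <= B.+1.
Proof. by case: c => [[]|[]] *; rewrite /= ?size_behead; lia. Qed.

(** An instruction lengthens a stack by at most one symbol, so [B + t] bounds all stacks during [t]
    instructions and prices every round trip. *)
Lemma sim_run T t c r st B : rep1 c r st ->
  maxn (size st.1.1) (maxn (size st.1.2) (size st.2)) <= B ->
  t * (2 * (B + t) + 4) <= T ->
  let: (r', st') := iter t (fstep (fr := fr)) (r, st) in
  if r' is inr b then rep1 (iter T (@tm_step simTM) c) (inr b) st' else True.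
Proof.
elim: t T c r st B => [|t IH] T c r st B Hc HB HT.
  by case: r Hc => // b Hc; apply: (rep1_halt (st := st)).
rewrite iterSr; case: r Hc => [q|b] Hc; last first.
  have -> : fstep (fr := fr) (inr b, st) = (inr b, st) by [].
  by rewrite fstep_exit; apply: (rep1_halt (st := st)).
have [t1 lt1 /=] := sim_step Hc.
have E1 : fstep (fr := fr) (inl q, st) = exec1 (fd q) st by [].
rewrite {}E1.
have := exec1_size (fd q) HB; case: (exec1 (fd q) st) => r1 st1 /= HB1 Hc1.
have le1 : t1 <= T by nia.
have := IH (T - t1) _ r1 st1 B.+1 Hc1 HB1.
rewrite -iterD subnK // => H; apply: H; nia.
Qed.

(* The input word is read off the third stack, last symbol on top. *)
Lemma sim_init (w : seq nat) : all (fun x => 0 < x < 5) w ->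
  rep1 (tm_run simTM 1 w) (inl (f0 fr)) ([::], [::], rev [seq rawsym k | k <- w]).
Proof.
move=> Hw; split=> // z.
have Htape : forall z, decA (c_tape (tm_init simTM w) z) =
   cellof ([::], [::], rev [seq rawsym k | k <- w]) z.
  case=> k //=; rewrite /oat /= revK.
  case: ltnP => lt.
    have := allP Hw _ (mem_nth 0 lt) => /andP[g0 g5].
    have lt' : nth 0 w k < #|{: cell}|.+4.+1 by rewrite (leq_trans g5).
    rewrite /decA inordK // g5 /rawcell eqn0Ngt g0 /=.
    by rewrite onth_map (onthE w) (nth_map 0) //= onth0n.
  by rewrite onth_map (onth_default lt) /= onth0n.
by rewrite -Htape /=; case: eqP => [->|_].
Qed.

Theorem sim_correct (w : seq nat) t b st' : all (fun x => 0 < x < 5) w ->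
  reach fr ([::], [::], rev [seq rawsym k | k <- w]) t b st' ->
  forall T, 1 + t * (2 * (size w + t) + 4) <= T ->
  c_state (tm_run simTM T w) = halt_out simTM b.1 b.2.
Proof.
move=> Hw Hr [|T] // HT.
have := sim_run (T := T) (t := t) (sim_init Hw) (B := size w).
rewrite /= size_rev size_map !max0n => /(_ (leqnn _)) H.
have {H} := H HT; rewrite Hr; apply: etrans.
by rewrite /tm_run -iterS -iterSr.
Qed.
End Sim.

(** * Trees on a stack *)

Inductive tree := Leaf | Node of tree & tree.

Definition lf : sym := (false, false).
Definition nd : sym := (true, false).
Definition hs : sym := (false, true).

(** Prefix notation delimits itself, so several trees can lie on one stack without separators. *)
Fixpoint ser (t : tree) : seq sym :=
  match t with Leaf => [:: lf] | Node l r => nd :: ser l ++ ser r end.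

Notation "f ;; g" := (fbind f (fun _ => g)) (at level 60, right associativity).

(** [SC] counts in unary the subtrees still to be read: every symbol consumes one, every node adds
    two, and an empty counter ends the tree. The tree lands reversed on [SB], above a marker [hs]
    whose second bit tells it from tree symbols. *)
Definition fmove : frag unit :=
  fpush SB hs ;; fpush SC lf ;; floop (fbind (fpop SC) (fun o =>
    if o is None then fret (inr tt) else
    fbind (fpop SA) (fun a => if a is Some (true, false)
      then fpush SB nd ;; fpush SC lf ;; fpush SC lf ;; fret (inl tt)
      else fpush SB lf ;; fret (inl tt)))).

Definition fdrop : frag unit :=
  fpush SC lf ;; floop (fbind (fpop SC) (fun o =>
    if o is None then fret (inr tt) else
    fbind (fpop SA) (fun a => if a is Some (true, false)
      then fpush SC lf ;; fpush SC lf ;; fret (inl tt)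
      else fret (inl tt)))).

Definition funwind (c : sym -> frag unit) : frag unit :=
  floop (fbind (fpop SB) (fun o => match o with
    | None | Some (_, true) => fret (inr tt)
    | Some a => c a ;; fret (inl tt) end)).

Definition fback := funwind (fpush SA).
Definition fdupback := funwind (fun a => fpush SA a ;; fpush SC a).
Definition fB2C := funwind (fpush SC).
Definition fC2B : frag unit :=
  floop (fbind (fpop SC) (fun o =>
    if o is Some a then fpush SB a ;; fret (inl tt) else fret (inr tt))).

(** [fdupback] leaves one copy on [SA] and one on [SC]. The latter goes through [SB] because each
    transfer reverses the word. *)
Definition fdup := fmove ;; fdupback ;; fpush SB hs ;; fC2B ;; fback.
Definition fswap := fmove ;; fmove ;; fB2C ;; fback ;; fpush SB hs ;; fC2B ;; fback.

Lemma reach_seq Y (f : frag unit) (g : frag Y) st t1 st1 t2 y st2 :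
  reach f st t1 tt st1 -> reach g st1 t2 y st2 -> reach (f ;; g) st (t1 + t2) y st2.
Proof. exact: reach_bind. Qed.

Lemma ser_nohash t : all (fun a : sym => ~~ a.2) (ser t).
Proof. by elim: t => //= l IHl r IHr; rewrite all_cat IHl IHr. Qed.

Lemma reach_fmove t A B :
  reach fmove (ser t ++ A, B, [::]) (20 * size (ser t) + 20) tt
    (A, rev (ser t) ++ hs :: B, [::]).
Proof.
rewrite /fmove; set lp := floop _.
(* Continuation form: the run that follows the tree is a hypothesis, so the induction passes through
   the left subtree into the right one with any number [c] of pending subtrees. *)
have H : forall c A B t2 st2, reach lp (A, rev (ser t) ++ B, nseq c lf) t2 tt st2 ->
   reach lp (ser t ++ A, B, nseq c.+1 lf) (20 * size (ser t) + t2) tt st2.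
  elim: t {A B} => [|l IHl r IHr] c A B t2 st2 Hr.
    by apply: (reach_loop_cont (t1 := 20)) Hr.
  have -> : 20 * size (ser (Node l r)) + t2 =
     20 + (20 * size (ser l) + (20 * size (ser r) + t2)).
    by rewrite /= size_cat; lia.
  apply: (reach_loop_cont (t1 := 20) (st1 := (ser l ++ ser r ++ A, nd :: B, nseq c.+2 lf))).
    by rewrite /= -catA.
  by apply/IHl/IHr; rewrite catA -rev_cat -cat_rcons -rev_cons.
apply: (reach_mono (t := 1 + (1 + (20 * size (ser t) + 5)))); last by lia.
apply: reach_seq; first exact: reach_push.
apply: reach_seq; first exact: reach_push.
by apply: (H 0); apply: reach_loop_exit.
Qed.

Lemma reach_fdrop t A B :
  reach fdrop (ser t ++ A, B, [::]) (20 * size (ser t) + 20) tt (A, B, [::]).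
Proof.
rewrite /fdrop; set lp := floop _.
have H : forall c A t2 st2, reach lp (A, B, nseq c lf) t2 tt st2 ->
   reach lp (ser t ++ A, B, nseq c.+1 lf) (20 * size (ser t) + t2) tt st2.
  elim: t {A} => [|l IHl r IHr] c A t2 st2 Hr.
    by apply: (reach_loop_cont (t1 := 20)) Hr.
  have -> : 20 * size (ser (Node l r)) + t2 =
     20 + (20 * size (ser l) + (20 * size (ser r) + t2)).
    by rewrite /= size_cat; lia.
  apply: (reach_loop_cont (t1 := 20) (st1 := (ser l ++ ser r ++ A, B, nseq c.+2 lf))).
    by rewrite /= -catA.
  by apply/IHl/IHr.
apply: (reach_mono (t := 1 + (20 * size (ser t) + 5))); last by lia.
apply: reach_seq; first exact: reach_push.
by apply: (H 0); apply: reach_loop_exit.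
Qed.

Lemma reach_unwind c (bA bC : bool) :
  (forall a A B C, reach (c a) (A, B, C) 5 tt
     (if bA then a :: A else A, B, if bC then a :: C else C)) ->
  forall s A B C, all (fun a : sym => ~~ a.2) s ->
  reach (funwind c) (A, s ++ hs :: B, C) (20 * size s + 20) tt
    (if bA then catrev s A else A, B, if bC then catrev s C else C).
Proof.
move=> Hc; elim=> [|[a1 a2] s IH] A B C /=.
  by move=> _; apply: (reach_mono (t := 20)); [apply: reach_loop_exit; case: bA bC {Hc} => [] []|lia].
case/andP=> /negPf na /IH {}IH.
have -> : 20 * (size s).+1 + 20 = (1 + (5 + 2)) + (12 + (20 * size s + 20)) by lia.
apply: reach_loop_cont.
  apply: reach_bind; first exact: reach_pop.
  rewrite /= na /=; apply: reach_seq; first exact: Hc.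
  exact: reach_ret.
apply: (reach_mono (t := 20 * size s + 20)); last by lia.
by have := IH (if bA then (a1, a2) :: A else A) B (if bC then (a1, a2) :: C else C); rewrite na; case: bA bC {IH Hc} => [] [].
Qed.

Lemma reach_fback s A B : all (fun a : sym => ~~ a.2) s -> forall C,
  reach fback (A, rev s ++ hs :: B, C) (20 * size s + 20) tt (s ++ A, B, C).
Proof.
move=> Hs C; have := @reach_unwind (fpush SA) true false _ (rev s) A B C.
rewrite all_rev size_rev Hs catrevE revK; exact.
Qed.

Lemma reach_fdupback s A B : all (fun a : sym => ~~ a.2) s ->
  reach fdupback (A, rev s ++ hs :: B, [::]) (20 * size s + 20) tt (s ++ A, B, s).
Proof.
move=> Hs; have := @reach_unwind _ true true _ (rev s) A B [::].
rewrite all_rev size_rev Hs !catrevE revK cats0; exact.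
Qed.

Lemma reach_fB2C s A B : all (fun a : sym => ~~ a.2) s ->
  reach fB2C (A, rev s ++ hs :: B, [::]) (20 * size s + 20) tt (A, B, s).
Proof.
move=> Hs; have := @reach_unwind (fpush SC) false true _ (rev s) A B [::].
rewrite all_rev size_rev Hs !catrevE revK cats0; exact.
Qed.

Lemma reach_fC2B s A B :
  reach fC2B (A, B, s) (20 * size s + 20) tt (A, rev s ++ B, [::]).
Proof.
elim: s B => [|a s IH] B.
  by apply: (reach_mono (t := 20)); [apply: reach_loop_exit|lia].
have -> : 20 * (size (a :: s)) + 20 = 20 + (20 * size s + 20) by rewrite /=; lia.
by rewrite rev_cons cat_rcons; apply: reach_loop_cont (IH _).
Qed.

Lemma reach_fdup t A B : reach fdup (ser t ++ A, B, [::]) (100 * size (ser t) + 100) tt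
  (ser t ++ ser t ++ A, B, [::]).
Proof.
have nh := ser_nohash t; set s := ser t in nh *; set n := 20 * size s + 20.
apply: (reach_mono (t := n + (n + (1 + (n + n))))); last by lia.
apply: reach_seq; first exact: reach_fmove.
apply: reach_seq; first exact: reach_fdupback.
apply: reach_seq; first exact: reach_push.
apply: reach_seq; first exact: reach_fC2B.
exact: reach_fback.
Qed.

Lemma reach_fswap t u A B : reach fswap (ser t ++ ser u ++ A, B, [::])
  (100 * (size (ser t) + size (ser u)) + 200) tt (ser u ++ ser t ++ A, B, [::]).
Proof.
have nt := ser_nohash t; have nu := ser_nohash u.
have Ht := @reach_fmove t; have Hu := @reach_fmove u.
set s := ser t in nt Ht *; set r := ser u in nu Hu *.
set n := 20 * size s + 20; set m := 20 * size r + 20.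
apply: (reach_mono (t := n + (m + (m + (n + (1 + (m + m))))))); last by lia.
apply: reach_seq; first exact: Ht.
apply: reach_seq; first exact: Hu.
apply: reach_seq; first exact: reach_fB2C.
apply: reach_seq; first exact: reach_fback.
apply: reach_seq; first exact: reach_push.
apply: reach_seq; first exact: reach_fC2B.
exact: reach_fback.
Qed.

Fixpoint fpushs (s : seq sym) : frag unit :=
  if s is a :: s' then fpushs s' ;; fpush SA a else fret tt.

Lemma reach_fpushs s A B : reach (fpushs s) (A, B, [::]) (size s + 2) tt (s ++ A, B, [::]).
Proof.
elim: s => [|a s IH]; first exact: reach_ret.
have -> : size (a :: s) + 2 = (size s + 2) + 1 by rewrite /=; lia.
by apply: reach_seq IH _; apply: reach_push.
Qed.

(** * Polynomial-time functions *)

Class Enc (T : Type) := MkEnc { enc : T -> tree }.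

Definition esz T {ET : Enc T} (x : T) := size (ser (enc x)).

#[global] Instance Enc_unit : Enc unit := MkEnc (fun _ => Leaf).
#[global] Instance Enc_bool : Enc bool := MkEnc (fun b : bool => if b then Node Leaf Leaf else Leaf).
#[global] Instance Enc_prod A B {EA : Enc A} {EB : Enc B} : Enc (A * B) :=
  MkEnc (fun p => Node (enc p.1) (enc p.2)).
#[global] Instance Enc_seq A {EA : Enc A} : Enc (seq A) :=
  MkEnc (fix go (l : seq A) := if l is x :: l' then Node (enc x) (go l') else Leaf).
(** Unary, with the same trees as [seq unit]: a [nat] serves as loop count or index, so its size may
    bound running time. Large numbers are kept in [N] and [int], in binary. *)
#[global] Instance Enc_nat : Enc nat := MkEnc (fun n => iter n (Node Leaf) Leaf).

Lemma esz_pair A B {EA : Enc A} {EB : Enc B} (a : A) (b : B) :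
  esz (a, b) = (esz a + esz b).+1.
Proof. by rewrite /esz /= size_cat. Qed.

Lemma esz_nil A {EA : Enc A} : esz ([::] : seq A) = 1.
Proof. by []. Qed.

Lemma esz_cons A {EA : Enc A} (a : A) l : esz (a :: l) = (esz a + esz l).+1.
Proof. by rewrite /esz /= size_cat. Qed.

Lemma esz_nat (n : nat) : esz n = n.*2.+1.
Proof. by elim: n => // n; rewrite /esz /= => ->. Qed.

Lemma esz_bool (b : bool) : esz b <= 3.
Proof. by case: b. Qed.

Lemma esz_gt0 A {EA : Enc A} (a : A) : 0 < esz a.
Proof. by rewrite /esz; case: (enc a). Qed.

(** The base is at least 2, so constants, sums and products are absorbed by raising the single
    exponent [k]. *)
Definition pbd A {EA : Enc A} (D : A -> Prop) (t : A -> nat) :=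
  exists k, forall a, D a -> t a <= (esz a + 2) ^ k.

Lemma pbd_le A {EA : Enc A} (D : A -> Prop) (t u : A -> nat) :
  pbd D u -> (forall a, D a -> t a <= u a) -> pbd D t.
Proof. by move=> [k H] le; exists k => a Da; apply: leq_trans (le a Da) (H a Da). Qed.

Lemma pbd_const A {EA : Enc A} (D : A -> Prop) c : pbd D (fun _ : A => c).
Proof.
exists c => a _; apply: leq_trans (_ : 2 ^ c <= _); first exact/ltnW/ltn_expl.
by case: c => // c; rewrite leq_exp2r // leq_addl.
Qed.

Lemma pbd_esz A {EA : Enc A} (D : A -> Prop) : pbd D (fun a : A => esz a).
Proof. by exists 1 => a _; rewrite expn1 leq_addr. Qed.

Lemma pow_mono (s j k : nat) : j <= k -> (s + 2) ^ j <= (s + 2) ^ k.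
Proof. by move=> le; rewrite leq_pexp2l // addn2. Qed.

Lemma pbd_add A {EA : Enc A} (D : A -> Prop) (t u : A -> nat) :
  pbd D t -> pbd D u -> pbd D (fun a => t a + u a).
Proof.
move=> [j Hj] [k Hk]; exists (maxn j k).+1 => a Da.
have h1 := leq_trans (Hj a Da) (pow_mono (esz a) (leq_maxl j k)).
have h2 := leq_trans (Hk a Da) (pow_mono (esz a) (leq_maxr j k)).
by rewrite expnS; nia.
Qed.

Lemma pbd_mul A {EA : Enc A} (D : A -> Prop) (t u : A -> nat) :
  pbd D t -> pbd D u -> pbd D (fun a => t a * u a).
Proof.
by move=> [j Hj] [k Hk]; exists (j + k) => a Da; rewrite expnD leq_mul ?Hj ?Hk.
Qed.

Lemma pbd_exp A {EA : Enc A} (D : A -> Prop) (t : A -> nat) k :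
  pbd D t -> pbd D (fun a => t a ^ k).
Proof.
move=> Ht; elim: k => [|k IH]; first exact: pbd_const 1.
by apply: pbd_le (pbd_mul Ht IH) _ => a _; rewrite expnS.
Qed.

(** The domain [D] allows branches and loop bodies to be analysed only on the inputs that reach
    them. The stack contents [sa] and [sb] below the argument are arbitrary, which makes programs
    composable. *)
Definition PTon A B {EA : Enc A} {EB : Enc B} (D : A -> Prop) (f : A -> B) :=
  exists (fr : frag unit) (k : nat), forall a, D a ->
    esz (f a) <= (esz a + 2) ^ k /\
    forall sa sb, reach fr (ser (enc a) ++ sa, sb, [::]) ((esz a + 2) ^ k) tt
                           (ser (enc (f a)) ++ sa, sb, [::]).

Definition PT A B {EA : Enc A} {EB : Enc B} (f : A -> B) := PTon (fun _ => True) f.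

Section PTcore.
Context {A B : Type} {EA : Enc A} {EB : Enc B}.

Lemma PT_on (D : A -> Prop) (f : A -> B) : PT f -> PTon D f.
Proof. by move=> [fr [k H]]; exists fr, k => a _; apply: H. Qed.

Lemma PTon_intro (D : A -> Prop) (f : A -> B) fr (t : A -> nat) :
  pbd D t -> pbd D (fun a => esz (f a)) ->
  (forall a, D a -> forall sa sb, reach fr (ser (enc a) ++ sa, sb, [::]) (t a) tt
                           (ser (enc (f a)) ++ sa, sb, [::])) ->
  PTon D f.
Proof.
move=> Ht Hs Hr; have [k Hk] := pbd_add Ht Hs.
exists fr, k => a Da; have := Hk a Da => le; split; first by lia.
by move=> sa sb; apply: reach_mono (Hr a Da sa sb) _; lia.
Qed.

Lemma PTon_elim (D : A -> Prop) (f : A -> B) : PTon D f -> exists fr (t : A -> nat),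
  [/\ pbd D t, pbd D (fun a => esz (f a)) &
   forall a, D a -> forall sa sb, reach fr (ser (enc a) ++ sa, sb, [::]) (t a) tt
                           (ser (enc (f a)) ++ sa, sb, [::])].
Proof.
move=> [fr [k H]]; exists fr, (fun a => (esz a + 2) ^ k); split.
- by exists k.
- by exists k => a /H[].
- by move=> a /H[].
Qed.

End PTcore.

Section PTbasic.
Context {A B C : Type} {EA : Enc A} {EB : Enc B} {EC : Enc C}.

Lemma PTon_size (D : A -> Prop) (f : A -> B) : PTon D f -> pbd D (fun a => esz (f a)).
Proof. by case/PTon_elim=> fr [t []]. Qed.

Lemma pbd_comp (D : A -> Prop) (D' : B -> Prop) (f : A -> B) (t : B -> nat) :
  pbd D (fun a => esz (f a)) -> (forall a, D a -> D' (f a)) ->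
  pbd D' t -> pbd D (fun a => t (f a)).
Proof.
move=> Hf HD [k Hk].
apply: pbd_le (pbd_exp k (pbd_add Hf (pbd_const D 2))) _ => a Da.
exact/Hk/HD.
Qed.

Lemma PTon_eq (D : A -> Prop) (f g : A -> B) :
  PTon D f -> (forall a, D a -> f a = g a) -> PTon D g.
Proof.
by move=> [fr [k H]] E; exists fr, k => a Da; rewrite -E //; apply: H.
Qed.

(** Conversions between types that share an encoding are free; many operations on numbers are
    reduced to lists in this way. *)
Lemma PTon_cast (D : A -> Prop) (f : A -> B) :
  (forall a, D a -> enc (f a) = enc a) -> PTon D f.
Proof.
move=> E; apply: (@PTon_intro A B _ _ _ _ (fret tt) (fun _ => 2)).
- exact: pbd_const.
- by apply: pbd_le (pbd_esz D) _ => a Da; rewrite /esz E.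
by move=> a Da sa sb; rewrite E //; apply: reach_ret.
Qed.

Lemma PT_const (c : B) : PT (fun _ : A => c).
Proof.
apply: (@PTon_intro A B _ _ _ _ (fdrop ;; fpushs (ser (enc c)))
          (fun a => (20 * esz a + 20) + (esz c + 2))).
- apply: pbd_add; last exact: pbd_const.
  apply: pbd_add; last exact: pbd_const.
  by apply: pbd_mul; [exact: pbd_const|exact: pbd_esz].
- exact: pbd_const.
move=> a _ sa sb; apply: reach_seq; first exact: reach_fdrop.
exact: reach_fpushs.
Qed.

(** The data stack, top first, is successively [a, a], then [g a, a], then [a, g a], then
    [f a, g a]; a final [nd] turns this into the tree of the pair. *)
Lemma PTon_pair (D : A -> Prop) (f : A -> B) (g : A -> C) :
  PTon D f -> PTon D g -> PTon D (fun a => (f a, g a)).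
Proof.
move=> /PTon_elim[ff [tf [Htf Hsf Hf]]] /PTon_elim[fg [tg [Htg Hsg Hg]]].
pose (t := fun a : A => (100 * esz a + 100) + (tg a + ((100 * (esz (g a) + esz a) + 200) + (tf a + 1)))).
have c c0 := @pbd_const A EA D c0; have e := @pbd_esz A EA D.
refine (@PTon_intro A (B * C)%type _ _ D _ (fdup ;; fg ;; fswap ;; ff ;; fpush SA nd) t _ _ _).
- by rewrite /t; repeat (apply: pbd_add || apply: pbd_mul).
- apply: pbd_le (pbd_add (pbd_add Hsf Hsg) (c 1)) _ => a _.
  by rewrite esz_pair addn1.
move=> a Da sa sb; rewrite /t.
apply: reach_seq; first exact: reach_fdup.
apply: reach_seq; first exact: Hg.
apply: reach_seq; first exact: reach_fswap.
apply: reach_seq; first exact: Hf.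
by rewrite /= -catA; apply: reach_push.
Qed.

Lemma PT_fst : PT (@fst A B).
Proof.
apply: (@PTon_intro (A * B)%type A _ _ _ _ (fbind (fpop SA) (fun _ => fswap ;; fdrop))
  (fun p => 1 + ((100 * (esz p + esz p) + 200) + (20 * esz p + 20)))).
- have c c0 := @pbd_const (A * B) _ (fun _ => True) c0.
  have e := @pbd_esz (A * B) _ (fun _ => True).
  by repeat (apply: pbd_add || apply: pbd_mul).
- by apply: pbd_le (pbd_esz _) _ => -[a b] _; rewrite esz_pair /=; lia.
move=> [a b] _ sa sb; rewrite esz_pair /= -catA.
apply: reach_bind; first exact: reach_pop.
apply: reach_seq.
  by apply: reach_mono (reach_fswap _ _ _ _) _; rewrite /esz; lia.
by apply: reach_mono (reach_fdrop _ _ _) _; rewrite /esz; lia.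
Qed.

Lemma PT_snd : PT (@snd A B).
Proof.
apply: (@PTon_intro (A * B)%type B _ _ _ _ (fbind (fpop SA) (fun _ => fdrop))
  (fun p => 1 + (20 * esz p + 20))).
- have c c0 := @pbd_const (A * B) _ (fun _ => True) c0.
  have e := @pbd_esz (A * B) _ (fun _ => True).
  by repeat (apply: pbd_add || apply: pbd_mul).
- by apply: pbd_le (pbd_esz _) _ => -[a b] _; rewrite esz_pair /=; lia.
move=> [a b] _ sa sb; rewrite esz_pair /= -catA.
apply: reach_bind; first exact: reach_pop.
by apply: reach_mono (reach_fdrop _ _ _) _; rewrite /esz; lia.
Qed.

Definition ftest (fc : frag unit) : frag bool :=
  fdup ;; fc ;; fbind (fpop SA) (fun o =>
    if o is Some (true, false) then fbind (fpop SA) (fun _ => fbind (fpop SA) (fun _ => fret true))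
    else fret false).

Lemma reach_ftest fc (a : A) (b : bool) t sa sb :
  (forall sa, reach fc (ser (enc a) ++ sa, sb, [::]) t tt (ser (enc b) ++ sa, sb, [::])) ->
  reach (ftest fc) (ser (enc a) ++ sa, sb, [::]) ((100 * esz a + 100) + (t + 5)) b
    (ser (enc a) ++ sa, sb, [::]).
Proof.
move=> H; apply: reach_seq; first exact: reach_fdup.
apply: reach_seq; first exact: H.
by case: b {H}.
Qed.

Lemma PTon_if (D : A -> Prop) (c : A -> bool) (f g : A -> B) :
  PTon D c -> PTon (fun a => D a /\ c a) f -> PTon (fun a => D a /\ ~~ c a) g ->
  PTon D (fun a => if c a then f a else g a).
Proof.
move=> /PTon_elim[fc [tc [Htc Hsc Hc]]] /PTon_elim[ff [tf [Htf Hsf Hf]]].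
move=> /PTon_elim[fg [tg [Htg Hsg Hg]]].
have aux (h1 h2 : A -> nat) : pbd (fun a => D a /\ c a) h1 ->
    pbd (fun a => D a /\ ~~ c a) h2 -> pbd D (fun a => if c a then h1 a else h2 a).
  move=> [j Hj] [k Hk]; exists (maxn j k) => a Da; case: ifP => ca.
    by apply: leq_trans (Hj a _) (pow_mono _ (leq_maxl _ _)).
  by apply: leq_trans (Hk a _) (pow_mono _ (leq_maxr _ _)); rewrite ca.
apply: (@PTon_intro A B _ _ _ _ (fbind (ftest fc) (fun b => if b then ff else fg))
   (fun a => (100 * esz a + 100 + (tc a + 5)) + (if c a then tf a else tg a))).
- have k c0 := @pbd_const A EA D c0; have e := @pbd_esz A EA D.
  apply: pbd_add; last exact: aux.
  by repeat (apply: pbd_add || apply: pbd_mul).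
- by apply: pbd_le (aux _ _ Hsf Hsg) _ => a Da; case: ifP.
move=> a Da sa sb; apply: reach_bind.
  by apply: reach_ftest => s; apply: Hc.
by case: ifP => ca; [apply: Hf|apply: Hg]; rewrite ca.
Qed.

Lemma PTon_comp (D : A -> Prop) (D' : B -> Prop) (g : B -> C) (f : A -> B) :
  PTon D f -> (forall a, D a -> D' (f a)) -> PTon D' g -> PTon D (fun a => g (f a)).
Proof.
move=> /PTon_elim[ff [tf [Htf Hsf Hf]]] HD [fg [k Hg]].
have Hp : pbd D (fun a => (esz (f a) + 2) ^ k).
  by apply: pbd_exp; apply: pbd_add Hsf _; apply: pbd_const.
apply: (@PTon_intro A C _ _ _ _ (ff ;; fg) (fun a => tf a + (esz (f a) + 2) ^ k)).
- exact: pbd_add.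
- by apply: pbd_le Hp _ => a /HD/Hg[].
move=> a Da sa sb; apply: reach_seq; first exact: Hf.
by case: (Hg _ (HD _ Da)) => _; apply.
Qed.

(* [n] is the number of iterations and [S] bounds every intermediate state. *)
Lemma PTon_while (D D' : A -> Prop) (c : A -> bool) (f : A -> A) (n S : A -> nat) :
  (forall a, D a -> D' a) ->
  PTon D' c -> PTon (fun a => D' a /\ c a) f ->
  (forall a, D' a -> c a -> D' (f a)) ->
  pbd D n -> pbd D S ->
  (forall a, D a -> forall i, i < n a -> c (iter i f a)) ->
  (forall a, D a -> ~~ c (iter (n a) f a)) ->
  (forall a, D a -> forall i, i <= n a -> esz (iter i f a) <= S a) ->
  PTon D (fun a => iter (n a) f a).
Proof.
move=> DD' [fc [kc Hc]] [ff [kf Hf]] HD Hn HS c1 c0 HB.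
(* Cost of one round, test and body, priced at the uniform size bound [S a]; composing polynomial
   bounds once per round would not stay polynomial. *)
pose (t := fun a : A => 100 * S a + 100 + ((S a + 2) ^ kc + 5) + ((S a + 2) ^ kf + 2)).
pose lp := floop (fbind (ftest fc) (fun b => if b then ff ;; fret (inl tt) else fret (inr tt))).
have k c2 := @pbd_const A EA D c2.
have Ht : pbd D t.
  rewrite /t; repeat (apply: pbd_add || apply: pbd_mul || apply: pbd_exp) => //.
apply: (@PTon_intro A A _ _ _ _ lp (fun a => (n a + 1) * t a)).
- by apply: pbd_mul Ht; apply: pbd_add.
- by apply: pbd_le HS _ => a Da; apply: HB.
move=> a Da sa sb.
have D'i i : i <= n a -> D' (iter i f a).
  elim: i => [|i IH] lei /=; first exact: DD'.
  by apply: HD; [apply: IH; lia|apply: c1].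
have test i : i <= n a -> reach (ftest fc) (ser (enc (iter i f a)) ++ sa, sb, [::])
   (100 * S a + 100 + ((S a + 2) ^ kc + 5)) (c (iter i f a)) (ser (enc (iter i f a)) ++ sa, sb, [::]).
  move=> lei; have le := HB a Da i lei.
  apply: (@reach_mono _ _ _ (100 * esz (iter i f a) + 100 + ((S a + 2) ^ kc + 5))); last lia.
  apply: (@reach_ftest fc (iter i f a) (c (iter i f a))) => s; have [_ H] := Hc _ (D'i i lei).
  apply: reach_mono (H s sb) _.
  by case: (kc) => // k'; rewrite leq_exp2r // leq_add2r.
have H : forall j i, i + j = n a -> reach lp (ser (enc (iter i f a)) ++ sa, sb, [::])
     ((j + 1) * t a) tt (ser (enc (iter (n a) f a)) ++ sa, sb, [::]); last exact: (H (n a) 0).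
elim=> [|j IH] i Ei.
  have -> : i = n a by lia.
  apply: (@reach_mono _ _ _ (100 * S a + 100 + ((S a + 2) ^ kc + 5) + 2)); last by rewrite /t; lia.
  apply: reach_loop_exit; apply: reach_bind; first exact: test.
  by rewrite (negPf (c0 a Da)); apply: reach_ret.
have lti : i < n a by lia.
have -> : (j.+1 + 1) * t a = t a + (j + 1) * t a by lia.
apply: reach_loop_cont (IH i.+1 _); last by lia.
rewrite /t; apply: reach_bind; first by apply: test; lia.
rewrite (c1 a Da i lti); apply: reach_seq; last exact: reach_ret.
have [|_ H] := Hf (iter i f a); first by split; [apply: D'i; lia|apply: c1].
apply: reach_mono (H sa sb) _.
have le := HB a Da i (ltnW lti).
by case: (kf) => // k'; rewrite leq_exp2r // leq_add2r.
Qed.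

End PTbasic.

(** * Closure properties of polynomial-time functions *)

Section PTopen.
Context {E A B C : Type} {EE : Enc E} {EA : Enc A} {EB : Enc B} {EC : Enc C}.

Lemma PT_id : PT (fun e : E => e).
Proof. exact: PTon_cast. Qed.

Lemma PT_comp (g : B -> C) (f : A -> B) : PT f -> PT g -> PT (fun a => g (f a)).
Proof. by move=> Hf Hg; apply: PTon_comp Hf _ Hg. Qed.

Lemma PT_pair (f : E -> A) (g : E -> B) : PT f -> PT g -> PT (fun e => (f e, g e)).
Proof. exact: PTon_pair. Qed.

Lemma PT_if (c : E -> bool) (f g : E -> A) : PT c -> PT f -> PT g ->
  PT (fun e => if c e then f e else g e).
Proof. by move=> Hc Hf Hg; apply: PTon_if Hc (PT_on _ Hf) (PT_on _ Hg). Qed.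

Lemma PT_ext (f g : E -> A) : f =1 g -> PT f -> PT g.
Proof. by move=> Efg Hf; apply: PTon_eq Hf _ => a _. Qed.

Lemma PT_cast (f : E -> A) (g : A -> B) : (forall a, enc (g a) = enc a) -> PT f ->
  PT (fun e => g (f e)).
Proof. by move=> Eg Hf; apply: (PTon_comp (D' := fun _ => True) Hf) => //; apply: PTon_cast. Qed.

End PTopen.

Section PTopen2.
Context {E A B C : Type} {EE : Enc E} {EA : Enc A} {EB : Enc B} {EC : Enc C}.

Lemma PT_ofst (f : E -> A * B) : PT f -> PT (fun e => (f e).1).
Proof. by move=> Hf; apply: PT_comp Hf PT_fst. Qed.

Lemma PT_osnd (f : E -> A * B) : PT f -> PT (fun e => (f e).2).
Proof. by move=> Hf; apply: PT_comp Hf PT_snd. Qed.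

Lemma PT_cons (f : E -> A) (l : E -> seq A) : PT f -> PT l -> PT (fun e => f e :: l e).
Proof.
move=> Hf Hl; have := PT_pair Hf Hl.
by apply: (PT_cast (g := fun p => p.1 :: p.2)).
Qed.

Lemma PT_negb (f : E -> bool) : PT f -> PT (fun e => ~~ f e).
Proof. by move=> Hf; apply: (PT_if Hf); apply: PT_const. Qed.

Lemma PT_andb (f g : E -> bool) : PT f -> PT g -> PT (fun e => f e && g e).
Proof. by move=> Hf Hg; apply: (PT_if Hf Hg); apply: PT_const. Qed.

Lemma PT_orb (f g : E -> bool) : PT f -> PT g -> PT (fun e => f e || g e).
Proof. by move=> Hf Hg; apply: (PT_if Hf _ Hg); apply: PT_const. Qed.

Lemma PT_eqb (f g : E -> bool) : PT f -> PT g -> PT (fun e => f e == g e).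
Proof.
move=> Hf Hg; apply: (PT_ext (f := fun e => if f e then g e else ~~ g e)).
  by move=> e; case: (f e) (g e) => [] [].
exact: (PT_if Hf Hg (PT_negb Hg)).
Qed.

Lemma PT_nilp0 : PT (fun l : seq A => nilp l).
Proof.
pose (fr := fbind (fpop SA) (fun o => if o is Some (true, false)
   then fdrop ;; fdrop ;; fpushs (ser (enc false)) else fpushs (ser (enc true)))).
pose (t := fun l : seq A => 1 + ((20 * esz l + 20) + ((20 * esz l + 20) + 10))).
refine (@PTon_intro _ _ _ _ _ _ fr t _ _ _).
- have c c0 := @pbd_const (seq A) _ (fun _ => True) c0.
  have e := @pbd_esz (seq A) _ (fun _ => True).
  by rewrite /t; repeat (apply: pbd_add || apply: pbd_mul).
- by apply: pbd_le (pbd_const _ 3) _ => l _; apply: esz_bool.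
move=> l _ sa sb; apply: reach_bind; first exact: reach_pop.
case: l => [|x l]; first by refine (reach_mono (reach_fpushs (ser (enc true)) sa sb) _).
rewrite [ohead _]/= [behead _]/= -catA esz_cons.
apply: reach_seq; first by apply: reach_mono (reach_fdrop _ _ _) _; rewrite /esz; lia.
apply: reach_seq; first by apply: reach_mono (reach_fdrop _ _ _) _; rewrite /esz /=; lia.
by refine (reach_mono (reach_fpushs (ser (enc false)) sa sb) _).
Qed.

Lemma PT_nilp (l : E -> seq A) : PT l -> PT (fun e => nilp (l e)).
Proof. by move=> Hl; apply: PT_comp Hl PT_nilp0. Qed.

Lemma PT_head (x0 : A) (l : E -> seq A) : PT l -> PT (fun e => head x0 (l e)).
Proof.
move=> Hl; apply: (PT_comp Hl).
apply: (PT_ext (f := fun l => if nilp l then x0 else (head x0 l, behead l).1)).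
  by case.
apply: PTon_if; [exact: PT_nilp0|exact/PT_on/PT_const|].
apply: (PTon_comp (D' := fun _ => True)) => //; last exact: PT_fst.
by apply: PTon_cast => -[|x s] [].
Qed.

Lemma PT_behead (l : E -> seq A) : PT l -> PT (fun e => behead (l e)).
Proof.
move=> Hl; apply: (PT_comp Hl).
pose fr := fbind (fpop SA) (fun o => if o is Some (true, false)
   then fdrop else fpushs (ser Leaf)).
pose (t := fun l : seq A => 1 + (20 * esz l + 20)).
refine (@PTon_intro _ _ _ _ _ _ fr t _ _ _).
- have c c0 := @pbd_const (seq A) _ (fun _ => True) c0.
  have e := @pbd_esz (seq A) _ (fun _ => True).
  by rewrite /t; repeat (apply: pbd_add || apply: pbd_mul).
- by apply: pbd_le (pbd_esz _) _ => -[|x s] _ //=; rewrite esz_cons; lia.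
move=> s _ sa sb; apply: reach_bind; first exact: reach_pop.
case: s => [|x s]; first by refine (reach_mono (reach_fpushs (ser Leaf) sa sb) _).
rewrite /= -catA esz_cons.
by apply: reach_mono (reach_fdrop _ _ _) _; rewrite /esz; lia.
Qed.

Lemma PT_pbd (f : E -> nat) : PT f -> pbd (fun _ => True) f.
Proof. by move=> /PTon_size H; apply: pbd_le H _ => a _; rewrite esz_nat; lia. Qed.

Lemma PT_size_pbd (f : E -> A) : PT f -> pbd (fun _ => True) (fun e => esz (f e)).
Proof. exact: PTon_size. Qed.

End PTopen2.

(** * Folds, maps and iteration *)

Lemma esz_seqE A {EA : Enc A} (l : seq A) :
  esz l = (sumn [seq (esz x).+1 | x <- l]).+1.
Proof. by elim: l => //= x l IH; rewrite esz_cons IH; lia. Qed.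

Lemma esz_mem (A : eqType) {EA : Enc A} (l : seq A) x : x \in l -> esz x < esz l.
Proof.
elim: l => //= y l IH; rewrite inE esz_cons => /predU1P[->|/IH]; lia.
Qed.

Lemma size_esz A {EA : Enc A} (l : seq A) : size l < esz l.
Proof. elim: l => //= y l IH; rewrite esz_cons; lia. Qed.

Lemma esz_cat A {EA : Enc A} (l1 l2 : seq A) : esz (l1 ++ l2) + 1 = esz l1 + esz l2.
Proof. by rewrite !esz_seqE map_cat sumn_cat; lia. Qed.

Lemma esz_rev A {EA : Enc A} (l : seq A) : esz (rev l) = esz l.
Proof. by rewrite !esz_seqE map_rev sumn_rev. Qed.

Lemma esz_take A {EA : Enc A} (l : seq A) i : esz (take i l) <= esz l.
Proof. by pose proof (esz_cat (take i l) (drop i l)) as H; rewrite cat_take_drop in H; pose proof (esz_gt0 (drop i l)); lia. Qed.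

Lemma esz_drop A {EA : Enc A} (l : seq A) i : esz (drop i l) <= esz l.
Proof. by pose proof (esz_cat (take i l) (drop i l)) as H; rewrite cat_take_drop in H; pose proof (esz_gt0 (take i l)); lia. Qed.

Lemma esz_le_size A {EA : Enc A} (l : seq A) M :
  (forall i, i < size l -> forall x0, esz (nth x0 l i) <= M) -> esz l <= size l * M.+1 + 1.
Proof.
elim: l => //= x l IH H; rewrite esz_cons.
have := H 0 isT x; have := IH (fun i => H i.+1); rewrite /=; lia.
Qed.

(** A polynomial-time [step] can still double the accumulator at each element, so a bound [B] on all
    partial results, in terms of the original input, has to be supplied. *)
Lemma PT_foldl E S X {EE : Enc E} {ES : Enc S} {EX : Enc X} (x0 : X)
    (step : E -> S -> X -> S) (init : E -> S) (l : E -> seq X) (B : E -> nat) :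
  PT (fun p : E * S * X => step p.1.1 p.1.2 p.2) -> PT init -> PT l ->
  pbd (fun _ => True) B ->
  (forall e i, i <= size (l e) -> esz (foldl (step e) (init e) (take i (l e))) <= B e) ->
  PT (fun e => foldl (step e) (init e) (l e)).
Proof.
move=> Hs Hi Hl HB Hb.
(* Initial loop states only: [B] bounds the accumulators that arise from [init e], not arbitrary
   ones. *)
pose D (a : E * S * seq X) := exists e, a = (e, init e, l e).
pose f (a : E * S * seq X) := (a.1.1, step a.1.1 a.1.2 (head x0 a.2), behead a.2).
have iterE i e s r : i <= size r -> iter i f (e, s, r) = (e, foldl (step e) s (take i r), drop i r).
  elim: i => [|i IH] lei; first by rewrite take0 drop0.
  rewrite iterS IH ?(ltnW lei) //= {1}/f /= (take_nth x0 lei) foldl_rcons.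
  by rewrite -nth0 nth_drop addn0 (drop_nth x0 lei).
pose (Sz := fun a : E * S * seq X => esz a.1.1 + B a.1.1 + esz a.2 + 2).
have p11 : PT (fun a : E * S * seq X => a.1.1) by apply/PT_ofst/PT_fst.
have p12 : PT (fun a : E * S * seq X => a.1.2) by apply/PT_osnd/PT_fst.
have W : PTon D (fun a => iter (size a.2) f a).
  apply: (@PTon_while _ _ D (fun _ => True) (fun a => ~~ nilp a.2) f (fun a => size a.2) Sz) => //.
  - by apply: PT_negb; apply: PT_nilp; apply: PT_snd.
  - apply: PT_on; apply: PT_pair; last by apply: PT_behead; apply: PT_snd.
    apply: PT_pair => //.
    have H3 : PT (fun a : E * S * seq X => (a.1, head x0 a.2)).
      by apply: PT_pair; [exact: PT_fst|apply: PT_head; exact: PT_snd].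
    exact: (PT_comp H3 Hs).
  - by apply: pbd_le (PTon_size (PT_on D PT_snd)) _ => a _; apply/ltnW/size_esz.
  - have s11 := PTon_size (PT_on D p11); have s2 := PTon_size (PT_on D (PT_snd (A := E * S) (B := seq X))).
    rewrite /Sz; repeat apply: pbd_add => //; last exact: pbd_const.
    by apply: (pbd_comp s11 _ HB).
  - by move=> [[e s] r] _ i /= lti; rewrite iterE ?(ltnW lti) //= /nilp size_drop; lia.
  - by move=> [[e s] r] _ /=; rewrite iterE //= /nilp size_drop; lia.
  - move=> _ [e ->] i /= lei; rewrite iterE //= !esz_pair /Sz /=.
    by have := Hb e i lei; pose proof (esz_drop (l e) i); lia.
have H0 : PT (fun e => (e, init e, l e)) by apply: PT_pair => //; apply: PT_pair => //; apply: PT_id.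
have := PTon_comp H0 _ W => /(_ (fun e _ => ex_intro _ e erefl)) H1.
have := PT_comp H1 p12; apply: PT_ext => e /=.
by rewrite iterE //= take_size.
Qed.

Section PTfold.
Context {E X Y : Type} {EE : Enc E} {EX : Enc X} {EY : Enc Y}.

Lemma PT_rev (x0 : X) (l : E -> seq X) : PT l -> PT (fun e => rev (l e)).
Proof.
move=> Hl; have catE (r s : seq X) : foldl (fun s x => x :: s) s r = catrev r s.
  by elim: r s => //= x r IH s; rewrite IH.
apply: (PT_ext (f := fun e => foldl (fun s x => x :: s) [::] (l e))) => [e|].
  by rewrite catE /rev.
refine (PT_foldl x0 (step := fun _ s x => x :: s) (B := fun e => esz (l e)) _ _ _ _ _) => //.
- by apply: PT_cons; [exact: PT_snd|apply: PT_osnd; exact: PT_fst].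
- exact: PT_const.
- exact: PT_size_pbd.
by move=> e i _; rewrite catE catrevE cats0 esz_rev esz_take.
Qed.

Lemma PT_foldr (x0 : X) (step : E -> X -> Y -> Y) (init : E -> Y) (l : E -> seq X) (B : E -> nat) :
  PT (fun p : E * Y * X => step p.1.1 p.2 p.1.2) -> PT init -> PT l ->
  pbd (fun _ => True) B ->
  (forall e i, i <= size (l e) -> esz (foldr (step e) (init e) (drop i (l e))) <= B e) ->
  PT (fun e => foldr (step e) (init e) (l e)).
Proof.
move=> Hs Hi Hl HB Hb.
apply: (PT_ext (f := fun e => foldl (fun y x => step e x y) (init e) (rev (l e)))) => [e|].
  by rewrite foldl_rev.
apply: (PT_foldl x0 (step := fun e y x => step e x y) _ Hi (PT_rev x0 Hl) HB) => // e i.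
by rewrite size_rev => lei; rewrite take_rev foldl_rev; apply: Hb; apply: leq_subr.
Qed.

End PTfold.

Section PTlists.
Context {E X Y : Type} {EE : Enc E} {EX : Enc X} {EY : Enc Y}.

Lemma PT_map (x0 : X) (F : E -> X -> Y) (l : E -> seq X) :
  PT (fun p : E * X => F p.1 p.2) -> PT l -> PT (fun e => [seq F e x | x <- l e]).
Proof.
move=> HF Hl; have [k Hk] := PTon_size HF.
apply: (PT_ext (f := fun e => foldr (fun x s => F e x :: s) [::] (l e))) => //.
refine (PT_foldr x0 (step := fun e x s => F e x :: s)
   (B := fun e => esz (l e) * ((esz e + esz (l e) + 2) ^ k + 1) + 1) _ _ _ _ _) => //.
- apply: PT_cons; last by apply: PT_osnd; exact: PT_fst.
  refine (PT_comp (f := fun a : E * seq Y * X => (a.1.1, a.2)) _ HF).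
  by apply: PT_pair; [apply: PT_ofst; exact: PT_fst|exact: PT_snd].
- exact: PT_const.
- have sl := PT_size_pbd Hl; have c c0 := @pbd_const E _ (fun _ => True) c0.
  have se := @pbd_esz E _ (fun _ => True).
  by repeat (apply: pbd_add || apply: pbd_mul || apply: pbd_exp).
move=> e i _; have -> r : foldr (fun x s => F e x :: s) [::] r = map (F e) r by elim: r => //= x r ->.
rewrite map_drop.
set M := _ ^ k.
have le : forall x, List.In x (l e) -> esz (F e x) <= M.
  move=> x Hx; have := Hk (e, x) I; rewrite esz_pair => h; apply: leq_trans h _.
  have lx : esz x < esz (l e).
    elim: (l e) Hx => //= y s IH []; rewrite esz_cons; first by move=> ->; lia.
    by move/IH; lia.
  rewrite /M; case: (k) => // k'; rewrite leq_exp2r //; lia.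
apply: leq_trans (esz_drop _ _) _; apply: leq_trans (_ : size (l e) * M.+1 + 1 <= _); last first.
  by rewrite leq_add2r addn1 leq_mul2r; pose proof (size_esz (l e)); lia.
move: M le => M; elim: (l e) => //= x s IH le; rewrite esz_cons.
by have := le x (or_introl erefl); have := IH (fun y hy => le y (or_intror hy)); lia.
Qed.

Lemma PT_cat (x0 : X) (l r : E -> seq X) : PT l -> PT r -> PT (fun e => l e ++ r e).
Proof.
move=> Hl Hr; apply: (PT_ext (f := fun e => foldr cons (r e) (l e))) => [e|].
  by elim: (l e) => //= x s ->.
refine (PT_foldr x0 (step := fun e => cons) (B := fun e => esz (l e) + esz (r e)) _ _ _ _ _) => //.
- by apply: PT_cons; [exact: PT_snd|apply: PT_osnd; exact: PT_fst].
- by apply: pbd_add; apply: PT_size_pbd.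
move=> e i _; have -> : foldr cons (r e) (drop i (l e)) = drop i (l e) ++ r e.
  by elim: (drop i _) => //= x s ->.
by pose proof (esz_cat (drop i (l e)) (r e)); pose proof (esz_drop (l e) i); lia.
Qed.

Lemma esz_flatten (ss : seq (seq X)) : esz (flatten ss) <= esz ss.
Proof. by elim: ss => //= s ss IH; pose proof (esz_cat s (flatten ss)); rewrite esz_cons; lia. Qed.

End PTlists.

Section PTnat.
Context {E X Y : Type} {EE : Enc E} {EX : Enc X} {EY : Enc Y}.

Lemma PT_flatten (x0 : X) (l : E -> seq (seq X)) : PT l -> PT (fun e => flatten (l e)).
Proof.
move=> Hl; refine (PT_foldr [::] (step := fun e => cat) (B := fun e => esz (l e)) _ _ _ _ _) => //.
- by apply: (PT_cat x0); [exact: PT_snd|apply: PT_osnd; exact: PT_fst].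
- exact: PT_const.
- exact: PT_size_pbd.
by move=> e i _; apply: leq_trans (esz_flatten _) (esz_drop _ _).
Qed.

Lemma PT_units (n : E -> nat) : PT n -> PT (fun e => nseq (n e) tt).
Proof. by apply: PT_cast; elim=> //= k <-. Qed.

Lemma PT_size0 (l : E -> seq unit) : PT l -> PT (fun e => size (l e)).
Proof. by apply: PT_cast; elim=> //= [[]] k ->. Qed.

Lemma PT_size (x0 : X) (l : E -> seq X) : PT l -> PT (fun e => size (l e)).
Proof.
move=> Hl; apply: (PT_ext (f := fun e => size [seq tt | x <- l e])) => [e|].
  by rewrite size_map.
apply: PT_size0; apply: (PT_map x0 (F := fun _ _ => tt)) Hl; exact: PT_const.
Qed.

Lemma PT_S (n : E -> nat) : PT n -> PT (fun e => (n e).+1).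
Proof.
move=> Hn; apply: (PT_ext (f := fun e => size (tt :: nseq (n e) tt))) => [e|].
  by rewrite /= size_nseq.
by apply: PT_size0; apply: PT_cons; [exact: PT_const|exact: PT_units].
Qed.

Lemma PT_pred (n : E -> nat) : PT n -> PT (fun e => (n e).-1).
Proof.
move=> Hn; apply: (PT_ext (f := fun e => size (behead (nseq (n e) tt)))) => [e|].
  by rewrite size_behead size_nseq.
by apply: PT_size0; apply: PT_behead; apply: PT_units.
Qed.

Lemma PT_iter (f : E -> X -> X) (x : E -> X) (n : E -> nat) (B : E -> nat) :
  PT (fun p : E * X => f p.1 p.2) -> PT x -> PT n -> pbd (fun _ => True) B ->
  (forall e i, i <= n e -> esz (iter i (f e) (x e)) <= B e) ->
  PT (fun e => iter (n e) (f e) (x e)).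
Proof.
move=> Hf Hx Hn HB Hb.
have E1 e (k : nat) y : foldl (fun s (_ : unit) => f e s) y (nseq k tt) = iter k (f e) y.
  by elim: k y => //= k IH y; rewrite IH -iterSr.
apply: (PT_ext (f := fun e => foldl (fun s (_ : unit) => f e s) (x e) (nseq (n e) tt))) => [e|].
  exact: E1.
apply: (PT_foldl tt (step := fun e s _ => f e s) _ Hx (PT_units Hn) HB).
  by apply: (PT_comp _ Hf); exact: PT_fst.
move=> e i; rewrite size_nseq => lei; rewrite take_nseq //.
by rewrite E1; apply: Hb.
Qed.

End PTnat.

Section PTnat2.
Context {E X Y : Type} {EE : Enc E} {EX : Enc X} {EY : Enc Y}.

Lemma PT_addn (m n : E -> nat) : PT m -> PT n -> PT (fun e => m e + n e).
Proof.
move=> Hm Hn; apply: (PT_ext (f := fun e => iter (m e) S (n e))) => [e|].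
  by elim: (m e) => //= k ->.
apply: (PT_iter (f := fun e => S) (B := fun e => 2 * (m e + n e) + 1)) => //.
- by apply: PT_S; exact: PT_snd.
- apply: pbd_add; last exact: pbd_const.
  by apply: pbd_mul; [exact: pbd_const|apply: pbd_add; apply: PT_pbd].
move=> e i lei; have -> : iter i S (n e) = i + n e by elim: (i) => //= k ->.
rewrite esz_nat; lia.
Qed.

Lemma PT_subn (m n : E -> nat) : PT m -> PT n -> PT (fun e => m e - n e).
Proof.
have itE k j : iter k predn j = j - k by elim: k => [|k /= ->]; rewrite ?subn0 // subnS.
move=> Hm Hn; apply: (PT_ext (f := fun e => iter (n e) predn (m e))) => [e|].
  exact: itE.
apply: (PT_iter (f := fun e => predn) (B := fun e => 2 * m e + 1)) => //.
- by apply: PT_pred; exact: PT_snd.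
- apply: pbd_add; last exact: pbd_const.
  by apply: pbd_mul; [exact: pbd_const|apply: PT_pbd].
by move=> e i lei; rewrite itE esz_nat; lia.
Qed.

Lemma PT_eqn0 (n : E -> nat) : PT n -> PT (fun e => n e == 0).
Proof.
move=> Hn; apply: (PT_ext (f := fun e => nilp (nseq (n e) tt))) => [e|].
  by rewrite /nilp size_nseq.
by apply: PT_nilp; apply: PT_units.
Qed.

Lemma PT_drop (n : E -> nat) (l : E -> seq X) : PT n -> PT l -> PT (fun e => drop (n e) (l e)).
Proof.
have itE (k : nat) (s : seq X) : iter k behead s = drop k s.
  by elim: k => [|k /= ->]; rewrite ?drop0 // -drop1 drop_drop.
move=> Hn Hl; apply: (PT_ext (f := fun e => iter (n e) behead (l e))) => [e|].
  exact: itE.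
refine (PT_iter (f := fun e => behead) (B := fun e => esz (l e)) _ _ _ _ _) => //.
- by apply: PT_behead; exact: PT_snd.
- exact: PT_size_pbd.
by move=> e i lei; rewrite itE esz_drop.
Qed.

End PTnat2.

Section PTnat3.
Context {E X Y : Type} {EE : Enc E} {EX : Enc X} {EY : Enc Y}.

Lemma PT_nth (x0 : X) (l : E -> seq X) (n : E -> nat) : PT l -> PT n ->
  PT (fun e => nth x0 (l e) (n e)).
Proof.
move=> Hl Hn; apply: (PT_ext (f := fun e => head x0 (drop (n e) (l e)))) => [e|].
  by rewrite -nth0 nth_drop addn0.
exact/PT_head/PT_drop.
Qed.

Lemma PT_muln (m n : E -> nat) : PT m -> PT n -> PT (fun e => m e * n e).
Proof.
have itE a (k : nat) : iter k (addn a) 0 = k * a by elim: k => //= k ->; rewrite mulSn.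
move=> Hm Hn; apply: (PT_ext (f := fun e => iter (m e) (addn (n e)) 0)) => [e|].
  exact: itE.
apply: (PT_iter (f := fun e => addn (n e)) (B := fun e => 2 * (m e * n e) + 1)) => //.
- by apply: PT_addn; [apply: PT_comp Hn; exact: PT_fst|exact: PT_snd].
- exact: PT_const.
- apply: pbd_add; last exact: pbd_const.
  by apply: pbd_mul; [exact: pbd_const|apply: pbd_mul; apply: PT_pbd].
by move=> e i lei; rewrite itE esz_nat; nia.
Qed.

Lemma PT_leq (m n : E -> nat) : PT m -> PT n -> PT (fun e => m e <= n e).
Proof. by move=> Hm Hn; apply: PT_eqn0; apply: PT_subn. Qed.

Lemma PT_eqn (m n : E -> nat) : PT m -> PT n -> PT (fun e => m e == n e).
Proof.
move=> Hm Hn; apply: (PT_ext (f := fun e => (m e <= n e) && (n e <= m e))) => [e|].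
  by rewrite -eqn_leq.
by apply: PT_andb; apply: PT_leq.
Qed.

Lemma PT_iota (n : E -> nat) : PT n -> PT (fun e => iota 0 (n e)).
Proof.
have itE (k : nat) : iter k (fun l => size l :: l) [::] = rev (iota 0 k).
  elim: k => // k IH; rewrite iterS IH size_rev size_iota -addn1 iotaD add0n rev_cat //.
move=> Hn.
have H : PT (fun e => iter (n e) (fun l : seq nat => size l :: l) [::]).
  apply: (PT_iter (f := fun e (l : seq nat) => size l :: l)
    (B := fun e => n e * (2 * n e + 2) + 1)) => //.
  - apply: PT_cons; last exact: PT_snd.
    by apply: (PT_size 0); exact: PT_snd.
  - exact: PT_const.
  - have c c0 := @pbd_const E _ (fun _ => True) c0; have Hn' := PT_pbd Hn.
    by repeat (apply: pbd_add || apply: pbd_mul).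
  move=> e i lei; rewrite itE esz_rev.
  apply: leq_trans (@esz_le_size _ _ _ (2 * n e + 1) _) _.
    move=> j; rewrite size_iota => ltj x0; rewrite nth_iota // esz_nat; lia.
  rewrite size_iota; nia.
by have := PT_rev 0 H; apply: PT_ext => e; rewrite itE revK.
Qed.

Lemma PT_sumn (l : E -> seq nat) : PT l -> PT (fun e => sumn (l e)).
Proof.
move=> Hl; refine (PT_foldr 0 (step := fun e => addn) (B := fun e => 2 * esz (l e) + 1) _ _ _ _ _) => //.
- by apply: PT_addn; [exact: PT_snd|apply: PT_osnd; exact: PT_fst].
- exact: PT_const.
- apply: pbd_add; last exact: pbd_const.
  by apply: pbd_mul; [exact: pbd_const|apply: PT_size_pbd].
move=> e i _; rewrite -/(sumn _) esz_nat.
have le (s : seq nat) : sumn s <= esz s by elim: s => //= x s IH; rewrite esz_cons esz_nat; lia.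
by have := le (drop i (l e)); pose proof (esz_drop (l e) i); lia.
Qed.

Lemma PT_find (x0 : X) (p : E -> X -> bool) (l : E -> seq X) :
  PT (fun q : E * X => p q.1 q.2) -> PT l -> PT (fun e => find (p e) (l e)).
Proof.
move=> Hp Hl.
apply: (PT_ext (f := fun e => foldr (fun x k => if p e x then 0 else k.+1) 0 (l e))) => [e|].
  by elim: (l e) => //= x s ->.
refine (PT_foldr x0 (step := fun e x k => if p e x then 0 else k.+1)
   (B := fun e => 2 * esz (l e) + 1) _ _ _ _ _) => //.
- apply: PT_if; [|exact: PT_const|by apply: PT_S; apply: PT_osnd; exact: PT_fst].
  refine (PT_comp (f := fun a : E * nat * X => (a.1.1, a.2)) _ Hp).
  by apply: PT_pair; [apply: PT_ofst; exact: PT_fst|exact: PT_snd].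
- exact: PT_const.
- apply: pbd_add; last exact: pbd_const.
  by apply: pbd_mul; [exact: pbd_const|apply: PT_size_pbd].
move=> e i _; rewrite esz_nat.
have -> : foldr (fun x k => if p e x then 0 else k.+1) 0 (drop i (l e)) = find (p e) (drop i (l e)).
  by elim: (drop i _) => //= x s ->.
by have := find_size (p e) (drop i (l e)); pose proof (size_esz (drop i (l e))); pose proof (esz_drop (l e) i); lia.
Qed.

End PTnat3.

(** * Binary arithmetic *)

Fixpoint posbits (p : positive) : seq bool :=
  match p with
  | xH => [:: true] | xO q => false :: posbits q | xI q => true :: posbits q
  end.

(** Little endian with zero as the empty list, so the top digit is never 0 and the encoding is
    canonical. *)
Definition nbits (n : N) : seq bool := if n is Npos p then posbits p else [::].

#[global] Instance Enc_N : Enc N := MkEnc (fun n => enc (nbits n)).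

Definition bcons (b : bool) (n : N) : N := if b then N.succ_double n else N.double n.

Lemma nbits_nil n : nilp (nbits n) = N.eqb n 0.
Proof. by case: n => // -[]. Qed.

Lemma nbits_odd n : head false (nbits n) = N.odd n.
Proof. by case: n => // -[]. Qed.

Lemma nbits_div2 n : behead (nbits n) = nbits (N.div2 n).
Proof. by case: n => // -[]. Qed.

Section PTN.
Context {E : Type} {EE : Enc E}.
Implicit Types (f g : E -> N).

Lemma PT_nbits f : PT f -> PT (fun e => nbits (f e)).
Proof. exact: PT_cast. Qed.

Lemma PT_Nis0 f : PT f -> PT (fun e => N.eqb (f e) 0).
Proof.
move=> Hf; apply: (PT_ext (f := fun e => nilp (nbits (f e)))) => [e|].
  exact: nbits_nil.
by apply: PT_nilp; apply: PT_nbits.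
Qed.

Lemma PT_Nodd f : PT f -> PT (fun e => N.odd (f e)).
Proof.
move=> Hf; apply: (PT_ext (f := fun e => head false (nbits (f e)))) => [e|].
  exact: nbits_odd.
by apply: PT_head; apply: PT_nbits.
Qed.

Lemma PT_Ndiv2 f : PT f -> PT (fun e => N.div2 (f e)).
Proof.
move=> Hf; apply: (PT_comp Hf).
have H : PT (fun n : N => behead (nbits n)).
  by apply: PT_behead; exact: PTon_cast.
move: H => [fr [k H]]; exists fr, k => n _.
by have := H n I; rewrite nbits_div2.
Qed.

End PTN.

Section PTN2.
Context {E : Type} {EE : Enc E}.
Implicit Types (f g : E -> N).

Lemma PT_bcons (b : E -> bool) f : PT b -> PT f -> PT (fun e => bcons (b e) (f e)).
Proof.
move=> Hb Hf.
(* Putting a digit 0 in front of the empty list would leave the canonical encodings, so zero is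
   treated apart. *)
have H : PT (fun p : bool * N => if N.eqb p.2 0 then (if p.1 then N.succ_double 0 else 0%num) else bcons p.1 p.2).
  apply: PTon_if.
  - by apply: PT_Nis0; exact: PT_snd.
  - by apply: PT_on; apply: PT_if; [exact: PT_fst|exact: PT_const|exact: PT_const].
  by apply: PTon_cast => -[b' [|p]] [_] //=; case: b'.
have := PT_comp (PT_pair Hb Hf) H; apply: PT_ext => e /=.
by case: (b e) (f e) => [] [].
Qed.

Lemma PT_addb (b c : E -> bool) : PT b -> PT c -> PT (fun e => b e (+) c e).
Proof.
move=> Hb Hc; apply: PT_ext (PT_if Hb (PT_negb Hc) Hc) => e.
by case: (b e).
Qed.

End PTN2.

Definition maj (a b c : bool) := (a && b) || (a && c) || (b && c).

(** A full adder; complementing the digit of [x] inside the majority turns the carry into a borrow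
    and the adder into a subtracter. Digits are consed, so the most significant one comes first, the
    order that [Nval] reads. *)
Definition addstep (neg : bool) (st : bool * N * N * seq bool) : bool * N * N * seq bool :=
  let: (c, x, y, out) := st in
  (maj (N.odd x (+) neg) (N.odd y) c, N.div2 x, N.div2 y,
   (N.odd x (+) N.odd y (+) c) :: out).

(** Long enough to exhaust both operands and to hold their sum, so that no final carry is lost. *)
Definition wid (x y : N) := (size (nbits x) + size (nbits y)).+1.

Definition Nval (out : seq bool) : N := foldl (fun n b => bcons b n) 0%num out.

Definition addsub (neg : bool) (x y : N) : bool * N :=
  let st := iter (wid x y) (addstep neg) (false, x, y, [::]) in
  (st.1.1.1, Nval st.2).

Section AddSpec.
Local Open Scope Z_scope.

Fixpoint Zv (out : seq bool) : Z :=
  if out is b :: r then Z.b2z b * 2 ^ Z.of_nat (size r) + Zv r else 0.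

Lemma Zv_bound out : 0 <= Zv out < 2 ^ Z.of_nat (size out).
Proof.
elim: out => [|b r IH]; first by [].
rewrite [size _]/= Nat2Z.inj_succ Z.pow_succ_r; last exact: Nat2Z.is_nonneg.
rewrite [Zv _]/=; move: (2 ^ _) IH => P [h1 h2].
have [-> | ->] : Z.b2z b = 0 \/ Z.b2z b = 1 by case: b; [right|left].
  by rewrite Z.mul_0_l Z.add_0_l; lia.
by rewrite Z.mul_1_l; lia.
Qed.

Lemma NvalE out : Z.of_N (Nval out) = Zv out.
Proof.
have H acc : Z.of_N (foldl (fun n b => bcons b n) acc out) =
    Z.of_N acc * 2 ^ Z.of_nat (size out) + Zv out.
  elim: out acc => [|b r IH] acc; first by rewrite /= Z.mul_1_r Z.add_0_r.
  rewrite [LHS]IH [size (b :: r)]/= Nat2Z.inj_succ [Zv (b :: r)]/=.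
  have -> : Z.of_N (bcons b acc) = 2 * Z.of_N acc + Z.b2z b.
    by case: b; rewrite /bcons ?N.succ_double_spec ?N.double_spec [Z.b2z _]/=; lia.
  rewrite Z.pow_succ_r; last exact: Nat2Z.is_nonneg.
  lia.
by rewrite /Nval H.
Qed.

Lemma odd_div2 (x : N) : Z.of_N x = 2 * Z.of_N (N.div2 x) + Z.b2z (N.odd x).
Proof.
have := N.div2_odd x; case: (N.odd x); rewrite /N.b2n /Z.b2z;
by move: (N.div2 x) => y ->; rewrite N2Z.inj_add N2Z.inj_mul.
Qed.

(** Column addition keeps constant the digits produced plus [2 ^ i] times what remains, where the
    pending carry counts with the sign of [Y]. *)
Lemma addstep_inv neg X Y i :
  let s := if neg then -1 else 1 in
  let: (c, x, y, out) := iter i (addstep neg) (false, X, Y, [::]) in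
  [/\ size out = i, nbits x = drop i (nbits X), nbits y = drop i (nbits Y) &
   Zv out + 2 ^ Z.of_nat i * (Z.of_N x + s * (Z.of_N y + Z.b2z c)) = Z.of_N X + s * Z.of_N Y].
Proof.
move=> s; elim: i => [|i IH].
  split; rewrite ?drop0 // [Zv _]/= [2 ^ _]/= [Z.b2z _]/= /s.
  by case: (neg); rewrite ?Z.mul_1_l Z.add_0_r Z.add_0_l.
rewrite iterS; case: (iter i _ _) IH => [[[c x] y] out] [Es Ex Ey Ev].
rewrite /addstep; split; rewrite ?[size (_ :: _)]/= ?[Zv (_ :: _)]/= ?Es //.
- by rewrite -nbits_div2 Ex -drop1 drop_drop.
- by rewrite -nbits_div2 Ey -drop1 drop_drop.
rewrite -Ev Nat2Z.inj_succ Z.pow_succ_r; last exact: Nat2Z.is_nonneg.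
rewrite (odd_div2 x) (odd_div2 y) /s; set P := 2 ^ _.
move: (Z.of_N _) (Z.of_N _) (Zv out) => x1 y1 z.
case: neg (N.odd x) (N.odd y) c {s Ev} => [] [] [] [];
  cbn [addb negb maj andb orb Z.b2z]; move: P => P.
all: lia.
Qed.

Lemma nbits_lt n : Z.of_N n < 2 ^ Z.of_nat (size (nbits n)).
Proof.
case: n => // p; rewrite [nbits _]/= [Z.of_N _]/=.
elim: p => [p IH|p IH|] //; rewrite [size _]/= Nat2Z.inj_succ Z.pow_succ_r;
  try exact: Nat2Z.is_nonneg; move: (2 ^ _) IH => P.
  by rewrite Pos2Z.inj_xI; lia.
by rewrite Pos2Z.inj_xO; lia.
Qed.

Lemma nbits_ge n k : Z.of_N n < 2 ^ Z.of_nat k -> (size (nbits n) <= k)%nat.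
Proof.
case: n => // p; rewrite [nbits _]/= [Z.of_N _]/=.
elim: p k => [p IH|p IH|] [|k] //; try by [case: p {IH}];
  rewrite Nat2Z.inj_succ Z.pow_succ_r; try exact: Nat2Z.is_nonneg;
  move=> lt; apply: IH; move: (2 ^ _) lt => P.
  by rewrite Pos2Z.inj_xI; lia.
by rewrite Pos2Z.inj_xO; lia.
Qed.

Lemma addsub_spec neg X Y : let r := addsub neg X Y in
  exists v, [/\ Z.of_N r.2 = v, 0 <= v < 2 ^ Z.of_nat (wid X Y) &
   v + 2 ^ Z.of_nat (wid X Y) * ((if neg then -1 else 1) * Z.b2z r.1) =
   Z.of_N X + (if neg then -1 else 1) * Z.of_N Y].
Proof.
move=> r; rewrite {}/r /addsub; move: (addstep_inv neg X Y (wid X Y)).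
case: (iter _ _ _) => [[[c x] y] out] [Es Ex Ey Ev].
have nx : x = N0.
  by apply/N.eqb_eq; rewrite -nbits_nil Ex drop_oversize //; rewrite /wid; lia.
have ny : y = N0.
  by apply/N.eqb_eq; rewrite -nbits_nil Ey drop_oversize //; rewrite /wid; lia.
exists (Zv out); rewrite NvalE; split=> //; first by rewrite -Es; exact: Zv_bound.
by move: Ev; rewrite nx ny !Z.add_0_l.
Qed.

Lemma wid_lt X Y : Z.of_N X + Z.of_N Y < 2 ^ Z.of_nat (wid X Y).
Proof.
rewrite /wid Nat2Z.inj_succ Z.pow_succ_r; last exact: Nat2Z.is_nonneg.
rewrite Nat2Z.inj_add Z.pow_add_r; try exact: Nat2Z.is_nonneg.
have := nbits_lt X; have := nbits_lt Y; have := N2Z.is_nonneg X; have := N2Z.is_nonneg Y.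
move: (2 ^ _) (2 ^ _) (Z.of_N X) (Z.of_N Y) => P Q x y; nia.
Qed.

Lemma addsub_add X Y : (addsub false X Y).2 = N.add X Y.
Proof.
have [v [E1 E2 E3]] := addsub_spec false X Y; have W := wid_lt X Y.
apply: N2Z.inj; rewrite N2Z.inj_add E1.
by move: E2 E3; case: (addsub _ _ _).1; rewrite /Z.b2z; lia.
Qed.

(** [X - Y] equals a value in [[0, 2 ^ wid)] minus [2 ^ wid] times the borrow, so the borrow is set
    exactly when the difference is negative. *)
Lemma addsub_ltb X Y : (addsub true X Y).1 = N.ltb X Y.
Proof.
have [v [E1 E2 E3]] := addsub_spec true X Y; have W := wid_lt X Y.
by move: E2 E3; case: N.ltb_spec; case: (addsub _ _ _).1; rewrite /Z.b2z; lia.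
Qed.

Lemma addsub_sub X Y : ~~ N.ltb X Y -> (addsub true X Y).2 = N.sub X Y.
Proof.
rewrite -addsub_ltb.
have [v [E1 E2 E3]] := addsub_spec true X Y.
move: E2 E3; case: (addsub _ _ _).1; rewrite // /Z.b2z => E2 E3 _.
by apply: N2Z.inj; rewrite N2Z.inj_sub_max E1; lia.
Qed.

End AddSpec.

Lemma esz_bits (l : seq bool) : esz l <= 4 * size l + 1.
Proof.
apply: leq_trans (@esz_le_size _ _ _ 3 _) _; last by lia.
by move=> i _ x0; apply: esz_bool.
Qed.

Lemma size_bits_esz (n : N) : size (nbits n) < esz n.
Proof. exact: size_esz. Qed.

Section PTN3.
Context {E : Type} {EE : Enc E}.
Implicit Types (f g : E -> N).

Lemma PT_Nval (l : E -> seq bool) : PT l -> PT (fun e => Nval (l e)).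
Proof.
move=> Hl; refine (PT_foldl false (step := fun _ n b => bcons b n) (B := fun e => 4 * esz (l e) + 1) _ _ _ _ _) => //.
- by apply: PT_bcons; [exact: PT_snd|apply: PT_osnd; exact: PT_fst].
- exact: PT_const.
- apply: pbd_add; last exact: pbd_const.
  by apply: pbd_mul; [exact: pbd_const|exact: PT_size_pbd].
move=> e i lei; rewrite -/(Nval _).
apply: leq_trans (esz_bits _) _; rewrite leq_add2r leq_mul2l /=.
apply: leq_trans (_ : i <= _); last by pose proof (size_esz (l e)); lia.
apply: nbits_ge; rewrite NvalE; have [_] := Zv_bound (take i (l e)).
by rewrite size_take; case: ltnP => // h; have -> : size (l e) = i by lia.
Qed.

Lemma PT_addstep neg : PT (fun st => addstep neg st).
Proof.
apply: (PT_ext (f := fun st : bool * N * N * seq bool =>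
  (maj (N.odd st.1.1.2 (+) neg) (N.odd st.1.2) st.1.1.1, N.div2 st.1.1.2, N.div2 st.1.2,
   (N.odd st.1.1.2 (+) N.odd st.1.2 (+) st.1.1.1) :: st.2))).
  by case=> [[[c x] y] out].
have P2 : PT (fun st : bool * N * N * seq bool => st.2) by exact: PT_snd.
have P12 : PT (fun st : bool * N * N * seq bool => st.1.2) by apply: PT_osnd; exact: PT_fst.
have P112 : PT (fun st : bool * N * N * seq bool => st.1.1.2).
  by apply: PT_osnd; apply: PT_ofst; exact: PT_fst.
have P111 : PT (fun st : bool * N * N * seq bool => st.1.1.1).
  by apply: PT_ofst; apply: PT_ofst; exact: PT_fst.
have O112 := PT_Nodd P112; have O12 := PT_Nodd P12.
have On : PT (fun st : bool * N * N * seq bool => N.odd st.1.1.2 (+) neg).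
  by apply: PT_addb => //; exact: PT_const.
apply: PT_pair; last by apply: PT_cons => //; apply: PT_addb => //; apply: PT_addb.
apply: PT_pair; last exact: PT_Ndiv2.
apply: PT_pair; last exact: PT_Ndiv2.
by rewrite /maj; repeat (apply: PT_orb || apply: PT_andb).
Qed.

Lemma PT_addsub neg f g : PT f -> PT g -> PT (fun e => addsub neg (f e) (g e)).
Proof.
move=> Hf Hg.
have Hw : PT (fun e => wid (f e) (g e)).
  by apply: PT_S; apply: PT_addn; apply: (PT_size false); apply: PT_nbits.
have H : PT (fun e => iter (wid (f e) (g e)) (addstep neg) (false, f e, g e, [::])).
  refine (PT_iter (f := fun _ => addstep neg)
     (B := fun e => esz (f e) + esz (g e) + 4 * wid (f e) (g e) + 10) _ _ _ _ _) => //.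
  - exact: (PT_comp PT_snd (PT_addstep neg)).
  - by repeat apply: PT_pair => //; exact: PT_const.
  - repeat apply: pbd_add; do ?[exact: pbd_const|exact: PT_size_pbd].
    by apply: pbd_mul; [exact: pbd_const|exact: PT_pbd].
  move=> e i lei; have := addstep_inv neg (f e) (g e) i.
  case: (iter _ _ _) => [[[c x] y] out] [Es Ex Ey _].
  rewrite !esz_pair.
  have hx : esz (nbits x) <= esz (nbits (f e)) by rewrite Ex; exact: esz_drop.
  have hy : esz (nbits y) <= esz (nbits (g e)) by rewrite Ey; exact: esz_drop.
  have [-> ->] : esz x = esz (nbits x) /\ esz y = esz (nbits y) by [].
  have [-> ->] : esz (f e) = esz (nbits (f e)) /\ esz (g e) = esz (nbits (g e)) by [].
  pose proof (esz_bool c); pose proof (esz_bits out); lia.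
apply: PT_pair; first by do 2!apply: PT_ofst; apply: PT_ofst.
by apply: PT_Nval; apply: PT_osnd.
Qed.

Lemma PT_Nadd f g : PT f -> PT g -> PT (fun e => N.add (f e) (g e)).
Proof.
move=> Hf Hg; apply: (PT_ext (f := fun e => (addsub false (f e) (g e)).2)) => [e|].
  exact: addsub_add.
by apply: PT_osnd; apply: PT_addsub.
Qed.

Lemma PT_Nltb f g : PT f -> PT g -> PT (fun e => N.ltb (f e) (g e)).
Proof.
move=> Hf Hg; apply: (PT_ext (f := fun e => (addsub true (f e) (g e)).1)) => [e|].
  exact: addsub_ltb.
by apply: PT_ofst; apply: PT_addsub.
Qed.

Lemma PT_Nsub f g : PT f -> PT g -> PT (fun e => N.sub (f e) (g e)).
Proof.
move=> Hf Hg.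
apply: (PT_ext (f := fun e => if N.ltb (f e) (g e) then 0%num else (addsub true (f e) (g e)).2)) => [e|].
  case: ifP => [/N.ltb_lt h|/negbT/addsub_sub //]; lia.
by apply: PT_if; [exact: PT_Nltb|exact: PT_const|apply: PT_osnd; apply: PT_addsub].
Qed.

End PTN3.

Local Open Scope nat_scope.

(** * Multiplication and long division in binary *)

Section MulSpec.
Local Open Scope Z_scope.

Fixpoint Zl (l : seq bool) : Z := if l is b :: r then Z.b2z b + 2 * Zl r else 0.

Lemma Zl_cons b r : Zl (b :: r) = (if b then 1 else 0) + 2 * Zl r.
Proof. by []. Qed.

Lemma Zl_bound l : 0 <= Zl l < 2 ^ Z.of_nat (size l).
Proof.
elim: l => [|b r IH]; first by [].
rewrite [size _]/= Nat2Z.inj_succ Z.pow_succ_r; last exact: Nat2Z.is_nonneg.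
rewrite Zl_cons; move: (2 ^ _) (Zl r) IH => P z [h1 h2].
by case: b; lia.
Qed.

Lemma Zl_nbits n : Zl (nbits n) = Z.of_N n.
Proof.
case: n => // p; rewrite [nbits _]/= [Z.of_N _]/=; elim: p => [p IH|p IH|] //.
- by rewrite Zl_cons IH Pos2Z.inj_xI; lia.
- by rewrite Zl_cons IH Pos2Z.inj_xO; lia.
Qed.

Lemma bconsE b n : Z.of_N (bcons b n) = 2 * Z.of_N n + (if b then 1 else 0).
Proof. by case: b; rewrite /bcons ?N.succ_double_spec ?N.double_spec; lia. Qed.

Definition mulb (y : N) (l : seq bool) : N :=
  foldr (fun b acc => N.add (if b then y else 0%num) (bcons false acc)) 0%num l.

Lemma mulb_cons y b r :
  mulb y (b :: r) = N.add (if b then y else 0%num) (bcons false (mulb y r)).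
Proof. by []. Qed.

Lemma mulbE y l : Z.of_N (mulb y l) = Zl l * Z.of_N y.
Proof.
elim: l => // b r IH; rewrite mulb_cons N2Z.inj_add bconsE IH Zl_cons.
by case: b; lia.
Qed.

(** [foldr] processes a little-endian list from its top digit, so this is long division: bring down
    a digit, subtract [d] if it fits. *)
Definition divb (d : N) (l : seq bool) : N * N :=
  foldr (fun b st => let r := bcons b st.2 in
           if N.ltb r d then (bcons false st.1, r) else (bcons true st.1, N.sub r d))
    (0%num, 0%num) l.

Lemma divb_cons d b l : divb d (b :: l) = let st := divb d l in
  if N.ltb (bcons b st.2) d then (bcons false st.1, bcons b st.2)
  else (bcons true st.1, N.sub (bcons b st.2) d).
Proof. by []. Qed.

(** Holds for every [d], even 0, because the time bound must cover all inputs. *)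
Lemma divb_bound d l : let st := divb d l in
  Z.of_N st.1 < 2 ^ Z.of_nat (size l) /\ Z.of_N st.2 < 2 ^ Z.of_nat (size l).
Proof.
suff: let st := divb d l in
  Z.of_N st.1 < 2 ^ Z.of_nat (size l) /\ Z.of_N st.2 <= Zl l.
  by move=> [h1 h2]; have [_ h3] := Zl_bound l; split; lia.
elim: l => // b r [h1 h2]; rewrite [size _]/= divb_cons; cbv zeta.
rewrite Nat2Z.inj_succ Z.pow_succ_r; last exact: Nat2Z.is_nonneg.
move: (2 ^ _) h1 => P h1.
case: ifP => _; rewrite [(_, _).1]/= [(_, _).2]/= ?N2Z.inj_sub_max !bconsE Zl_cons;
  by case: b; have := Zl_bound r; have := N2Z.is_nonneg d; lia.
Qed.

Lemma divbE d l : 0 < Z.of_N d -> let st := divb d l in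
  Zl l = Z.of_N st.1 * Z.of_N d + Z.of_N st.2 /\ Z.of_N st.2 < Z.of_N d.
Proof.
move=> d0; elim: l => // b r [h1 h2]; rewrite divb_cons Zl_cons h1; cbv zeta.
case: N.ltb_spec => h; rewrite [(_, _).1]/= [(_, _).2]/= ?N2Z.inj_sub_max ?bconsE;
  have := bconsE b (divb d r).2;
  by case: b h => h; lia.
Qed.

Lemma divb_divn (a b : nat) : (0 < b)%nat ->
  (divb (N.of_nat b) (nbits (N.of_nat a))).1 = N.of_nat (a %/ b).
Proof.
move=> b0; have [|h1 h2] := @divbE (N.of_nat b) (nbits (N.of_nat a)); first by lia.
move: h1 h2; rewrite Zl_nbits; case: (divb _ _) => q r /= h1 h2.
have h : a = (N.to_nat q * b + N.to_nat r)%nat by nia.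
rewrite {h1}h divnMDl // divn_small ?addn0; last by lia.
by rewrite Nnat.N2Nat.id.
Qed.

Lemma Z_expn k : Z.of_nat (2 ^ k)%nat = 2 ^ Z.of_nat k.
Proof.
elim: k => // k IH; rewrite expnS Nat2Z.inj_succ Z.pow_succ_r; last exact: Nat2Z.is_nonneg.
by rewrite -IH; lia.
Qed.

End MulSpec.

Section PTN4.
Context {E : Type} {EE : Enc E}.
Implicit Types (f g : E -> N).

Lemma PT_Nmul f g : PT f -> PT g -> PT (fun e => N.mul (f e) (g e)).
Proof.
move=> Hf Hg; apply: (PT_ext (f := fun e => mulb (g e) (nbits (f e)))) => [e|].
  by apply: N2Z.inj; rewrite mulbE Zl_nbits N2Z.inj_mul.
have Hb := PT_nbits Hf.
refine (PT_foldr false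
  (step := fun e b acc => N.add (if b then g e else 0%num) (bcons false acc))
  (B := fun e => 4 * (esz (f e) + esz (g e)) + 1) _ _ _ _ _) => //.
- apply: PT_Nadd.
    apply: PT_if; [exact: PT_snd| |exact: PT_const].
    by apply: (PT_comp (f := fun p : E * N * bool => p.1.1)) Hg; apply: PT_ofst; exact: PT_fst.
  by apply: PT_bcons; [exact: PT_const|apply: PT_osnd; exact: PT_fst].
- exact: PT_const.
- apply: pbd_add; last exact: pbd_const.
  by apply: pbd_mul; [exact: pbd_const|apply: pbd_add; exact: PT_size_pbd].
move=> e i lei; rewrite -/(mulb _ _).
apply: leq_trans (esz_bits _) _; rewrite leq_add2r leq_mul2l /=.
apply: leq_trans (_ : size (nbits (f e)) + size (nbits (g e)) <= _); last first.
  by pose proof (size_bits_esz (f e)); pose proof (size_bits_esz (g e)); lia.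
apply: nbits_ge; rewrite mulbE Nat2Z.inj_add Z.pow_add_r; try exact: Nat2Z.is_nonneg.
apply: Z.mul_lt_mono_nonneg.
- by have [] := Zl_bound (drop i (nbits (f e))).
- have [_] := Zl_bound (drop i (nbits (f e))).
  have : Z.le (Z.pow 2 (Z.of_nat (size (drop i (nbits (f e))))))
              (Z.pow 2 (Z.of_nat (size (nbits (f e))))).
    by apply: Z.pow_le_mono_r; rewrite // size_drop; lia.
  by lia.
- exact: N2Z.is_nonneg.
exact: nbits_lt.
Qed.

Lemma PT_divb f (l : E -> seq bool) : PT f -> PT l -> PT (fun e => divb (f e) (l e)).
Proof.
move=> Hf Hl.
refine (PT_foldr false
  (step := fun e b st => let r := bcons b st.2 in
           if N.ltb r (f e) then (bcons false st.1, r) else (bcons true st.1, N.sub r (f e)))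
  (B := fun e => 8 * esz (l e) + 3) _ _ _ _ _) => //.
- have P12 : PT (fun p : E * (N * N) * bool => p.1.2) by apply: PT_osnd; exact: PT_fst.
  have Pf : PT (fun p : E * (N * N) * bool => f p.1.1).
    by apply: (PT_comp (f := fun p : E * (N * N) * bool => p.1.1)) Hf; apply: PT_ofst; exact: PT_fst.
  have Pr : PT (fun p : E * (N * N) * bool => bcons p.2 p.1.2.2).
    by apply: PT_bcons; [exact: PT_snd|apply: PT_osnd].
  have Pq b : PT (fun p : E * (N * N) * bool => bcons b p.1.2.1).
    by apply: PT_bcons; [exact: PT_const|apply: PT_ofst].
  by apply: PT_if; [apply: PT_Nltb|apply: PT_pair|apply: PT_pair => //; apply: PT_Nsub].
- exact: PT_const.
- apply: pbd_add; last exact: pbd_const.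
  by apply: pbd_mul; [exact: pbd_const|exact: PT_size_pbd].
move=> e i lei; rewrite -/(divb _ _).
have [h1 h2] := divb_bound (f e) (drop i (l e)).
case: (divb _ _) h1 h2 => q r /= /nbits_ge h1 /nbits_ge h2.
rewrite esz_pair; pose proof (esz_bits (nbits q)); pose proof (esz_bits (nbits r)).
have [-> ->] : esz q = esz (nbits q) /\ esz r = esz (nbits r) by [].
move: h1 h2; rewrite size_drop; pose proof (size_esz (l e)); lia.
Qed.

End PTN4.

(** * Signed integers *)

Definition absN (z : int) : N := N.of_nat (absz z).

#[global] Instance Enc_int : Enc int := MkEnc (fun z : int => enc ((z < 0)%R, absN z)).

Definition mkint (s : bool) (n : N) : int :=
  if s then (- Posz (N.to_nat n))%R else Posz (N.to_nat n).

(* Truncated division; only its value on exact multiples matters. *)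
Definition zquot (a b : int) : int :=
  if (a < 0)%R (+) (b < 0)%R then (- Posz (absz a %/ absz b))%R else Posz (absz a %/ absz b).

Lemma zquotK (q b : int) : (b != 0 -> zquot (q * b) b = q)%R.
Proof.
move=> b0; have b1 : 0 < absz b by lia.
rewrite /zquot abszM mulnK //.
have [->|q0] := eqVneq q 0%R; first by rewrite oppr0 if_same.
have -> : ((q * b < 0) (+) (b < 0))%R = (q < 0)%R.
  case: (ltgtP b 0%R) b0 => // hb _; last by rewrite pmulr_llt0 // addbF.
  by rewrite nmulr_llt0 // addbT -leNgt le_eqVlt (negPf q0).
by case: ltP; lia.
Qed.

Definition zbits (z : int) : nat := size (nbits (absN z)).

Lemma zbits_lt z : absz z < 2 ^ zbits z.
Proof.
move: (nbits_lt (absN z)); rewrite -Z_expn /zbits; move: (2 ^ _) => P.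
by rewrite /absN nat_N_Z; lia.
Qed.

Lemma zbits_le z k : absz z < 2 ^ k -> zbits z <= k.
Proof.
move=> h; apply: nbits_ge; rewrite -Z_expn /absN nat_N_Z.
by move: (2 ^ k) h => P; lia.
Qed.

Lemma esz_int (z : int) : esz z <= 4 * zbits z + 5.
Proof.
have -> : esz z = esz ((z < 0)%R, absN z) by [].
rewrite esz_pair; pose proof (esz_bool (z < 0)%R); pose proof (esz_bits (nbits (absN z))).
have -> : esz (absN z) = esz (nbits (absN z)) by [].
rewrite /zbits; lia.
Qed.

Lemma esz_int_le (z : int) k : absz z < 2 ^ k -> esz z <= 4 * k + 5.
Proof. by move=> /zbits_le; have := esz_int z; lia. Qed.

Lemma abs_esz (z : int) : absz z < 2 ^ esz z.
Proof.
apply: leq_trans (zbits_lt z) _; rewrite leq_exp2l //.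
have -> : esz z = esz ((z < 0)%R, absN z) by [].
by rewrite esz_pair; pose proof (size_bits_esz (absN z)); rewrite /zbits; lia.
Qed.

Section PTint.
Context {E : Type} {EE : Enc E}.
Implicit Types (f g : E -> int).

Lemma PT_sgb f : PT f -> PT (fun e => (f e < 0)%R).
Proof.
move=> Hf; apply: (PT_ofst (f := fun e => ((f e < 0)%R, absN (f e)))).
by apply: (PT_cast (g := fun z : int => ((z < 0)%R, absN z))) Hf.
Qed.

Lemma PT_absN f : PT f -> PT (fun e => absN (f e)).
Proof.
move=> Hf; apply: (PT_osnd (f := fun e => ((f e < 0)%R, absN (f e)))).
by apply: (PT_cast (g := fun z : int => ((z < 0)%R, absN z))) Hf.
Qed.

Lemma PT_mkint (s : E -> bool) (n : E -> N) : PT s -> PT n -> PT (fun e => mkint (s e) (n e)).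
Proof.
move=> Hs Hn.
(* The encoding of the integer 0 has sign bit false, so a negative zero is normalised here. *)
have H : PT (fun e => (s e && ~~ N.eqb (n e) 0, n e)).
  by apply: PT_pair => //; apply: PT_andb => //; apply: PT_negb; apply: PT_Nis0.
move: H => [fr [k H]]; exists fr, k => e _; rewrite /esz.
have -> : enc (mkint (s e) (n e)) = enc (s e && ~~ N.eqb (n e) 0, n e); last exact: H e I.
rewrite /= /mkint /absN; congr (Node (enc (_ : bool)) (enc (nbits _))).
  by case: (s e); lia.
by case: (s e); rewrite ?abszN /= Nnat.N2Nat.id.
Qed.

Lemma PT_zbits f : PT f -> PT (fun e => zbits (f e)).
Proof. by move=> Hf; apply: (PT_size false); apply: PT_nbits; apply: PT_absN. Qed.

End PTint.

Section PTint2.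
Context {E : Type} {EE : Enc E}.
Implicit Types (f g : E -> int).

Lemma PT_addz f g : PT f -> PT g -> PT (fun e => f e + g e)%R.
Proof.
move=> Hf Hg; have Sf := PT_sgb Hf; have Sg := PT_sgb Hg.
have Af := PT_absN Hf; have Ag := PT_absN Hg.
apply: (PT_ext (f := fun e => if (f e < 0)%R == (g e < 0)%R
    then mkint (f e < 0)%R (N.add (absN (f e)) (absN (g e)))
    else if N.ltb (absN (f e)) (absN (g e)) then mkint (g e < 0)%R (N.sub (absN (g e)) (absN (f e)))
    else mkint (f e < 0)%R (N.sub (absN (f e)) (absN (g e))))) => [e|].
  rewrite /absN /mkint; move: (f e) (g e) => a b.
  case: (ltP a 0%R) => ha; case: (ltP b 0%R) => hb /=; try case: N.ltb_spec; lia.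
apply: PT_if; first exact: PT_eqb.
  by apply: PT_mkint => //; apply: PT_Nadd.
apply: PT_if; first exact: PT_Nltb.
  by apply: PT_mkint => //; apply: PT_Nsub.
by apply: PT_mkint => //; apply: PT_Nsub.
Qed.

Lemma PT_oppz f : PT f -> PT (fun e => - f e)%R.
Proof.
move=> Hf; apply: (PT_ext (f := fun e => mkint (~~ (f e < 0)%R) (absN (f e)))) => [e|].
  by rewrite /absN /mkint; case: ltP => /=; lia.
by apply: PT_mkint; [apply: PT_negb; apply: PT_sgb|apply: PT_absN].
Qed.

Lemma PT_mulz f g : PT f -> PT g -> PT (fun e => f e * g e)%R.
Proof.
move=> Hf Hg; have Sf := PT_sgb Hf; have Sg := PT_sgb Hg.
have Af := PT_absN Hf; have Ag := PT_absN Hg.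
apply: (PT_ext (f := fun e => mkint ((f e < 0)%R (+) (g e < 0)%R)
   (N.mul (absN (f e)) (absN (g e))))) => [e|].
  rewrite /absN /mkint; move: (f e) (g e) => a b.
  have -> : N.to_nat (N.mul (N.of_nat (absz a)) (N.of_nat (absz b))) = absz (a * b)%R.
    by rewrite -Nnat.Nat2N.inj_mul Nnat.Nat2N.id abszM.
  have [-> | a0] := eqVneq a 0%R; first by rewrite mul0r if_same.
  have [-> | b0] := eqVneq b 0%R; first by rewrite mulr0 if_same.
  have -> : ((a < 0) (+) (b < 0))%R = (a * b < 0)%R.
    case: (ltgtP b 0%R) b0 => // hb _; last by rewrite pmulr_llt0 // addbF.
    by rewrite nmulr_llt0 // addbT -leNgt le_eqVlt eq_sym (negPf a0).
  by case: ltP; lia.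
by apply: PT_mkint; [apply: PT_addb|apply: PT_Nmul].
Qed.

Lemma PT_zquot f g : PT f -> PT g -> PT (fun e => zquot (f e) (g e)).
Proof.
move=> Hf Hg; have Sf := PT_sgb Hf; have Sg := PT_sgb Hg.
have Af := PT_absN Hf; have Ag := PT_absN Hg.
apply: (PT_ext (f := fun e => mkint ((f e < 0)%R (+) (g e < 0)%R)
   (if N.eqb (absN (g e)) 0 then 0%num else (divb (absN (g e)) (nbits (absN (f e)))).1))) => [e|].
  rewrite /absN /mkint /zquot; move: (f e) (g e) => a b.
  case: N.eqb_spec => hb.
    have -> : absz b = 0 by lia.
    by rewrite divn0.
  by rewrite divb_divn ?Nnat.Nat2N.id //; lia.
apply: PT_mkint; first exact: PT_addb.
apply: PT_if; [exact: PT_Nis0|exact: PT_const|].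
by apply: PT_ofst; apply: PT_divb => //; apply: PT_nbits.
Qed.

Lemma PT_lez0 f : PT f -> PT (fun e => f e <= 0)%R.
Proof.
move=> Hf; apply: (PT_ext (f := fun e => (f e < 0)%R || N.eqb (absN (f e)) 0)) => [e|].
  by rewrite /absN; case: N.eqb_spec; lia.
by apply: PT_orb; [exact: PT_sgb|apply: PT_Nis0; exact: PT_absN].
Qed.

Lemma PT_eqz0 f : PT f -> PT (fun e => f e == 0%R).
Proof.
move=> Hf; apply: (PT_ext (f := fun e => N.eqb (absN (f e)) 0)) => [e|].
  by rewrite /absN; case: N.eqb_spec; lia.
by apply: PT_Nis0; exact: PT_absN.
Qed.

End PTint2.

Local Open Scope ring_scope.

(** * Fraction-free orthogonal projection *)

Definition gram (R : comNzRingType) (N r : nat) (A : 'M[R]_(r, N)) := A *m A^T.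
(** For independent rows over a real field this is the Gram determinant times the orthogonal
    projector onto the complement of the row space; the adjugate keeps it integral for integral
    [A]. *)
Definition gproj (R : comNzRingType) (N r : nat) (A : 'M[R]_(r, N)) : 'M[R]_N :=
  \det (gram A) *: 1%:M - A^T *m \adj (gram A) *m A.

Section GramProj.
Variables (F : fieldType) (N : nat).

Lemma gram_sym r (A : 'M[F]_(r, N)) : (gram A)^T = gram A.
Proof. by rewrite /gram trmx_mul trmxK. Qed.

Lemma gprojE r (A : 'M[F]_(r, N)) : \det (gram A) != 0 ->
  gproj A = \det (gram A) *: (1%:M - A^T *m invmx (gram A) *m A).
Proof.
move=> d0; have uG : gram A \in unitmx by rewrite unitmxE unitfE.
have -> : invmx (gram A) = (\det (gram A))^-1 *: \adj (gram A) by rewrite /invmx uG.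
rewrite /gproj scalerBr; congr (_ - _).
by rewrite -scalemxAr -scalemxAl scalerA divff // scale1r.
Qed.

Variables (r : nat) (A : 'M[F]_(r, N)) (a : 'rV[F]_N).
Hypothesis d0 : \det (gram A) != 0.
Let d := \det (gram A).
Let P := 1%:M - A^T *m invmx (gram A) *m A.
Let e := (a *m gproj A *m a^T) 0 0.
Let s := (a *m P *m a^T) 0 0.

Lemma uG : gram A \in unitmx. Proof. by rewrite unitmxE unitfE. Qed.

Lemma P_sym : P^T = P.
Proof.
by rewrite /P linearB /= trmx1 !trmx_mul trmxK trmx_inv gram_sym mulmxA.
Qed.

Lemma AP0 : A *m P = 0.
Proof. by rewrite /P mulmxBr mulmx1 !mulmxA -/(gram A) mulmxV ?uG // mul1mx subrr. Qed.

Lemma PA0 : P *m A^T = 0.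
Proof. by rewrite -P_sym -trmx_mul AP0 trmx0. Qed.

Lemma P_idem : P *m P = P.
Proof.
rewrite {1}/P mulmxBl mul1mx -!mulmxA AP0 !mulmx0 subr0 //.
Qed.

Lemma gprojP : gproj A = d *: P.
Proof. exact: gprojE. Qed.

Lemma eE : e = d * s.
Proof. by rewrite /e gprojP -scalemxAr -scalemxAl mxE. Qed.

Lemma gram_col : gram (col_mx A a) = block_mx (gram A) (A *m a^T) (a *m A^T) (a *m a^T).
Proof. by rewrite /gram tr_col_mx mul_col_row. Qed.

(** Schur complement: elimination by the unipotent [L] leaves [gram A] and the scalar [s] on the
    diagonal. *)
Lemma det_gram_col : \det (gram (col_mx A a)) = e.
Proof.
pose L := block_mx 1%:M 0 (- (a *m A^T *m invmx (gram A))) 1%:M : 'M[F]_(r + 1).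
have detL : \det L = 1 by rewrite det_lblock !det1 mulr1.
rewrite -[LHS]mul1r -detL -det_mulmx gram_col mulmx_block !mul1mx !mul0mx !addr0.
rewrite mulNmx mulmxKV ?uG // addNr det_ublock eE -/d; congr (_ * _).
rewrite det_mx11 /s; congr (_ _ 0 0).
by rewrite /P mulmxBr mulmx1 mulmxBl addrC mulNmx !mulmxA.
Qed.

(** Adjoining a row changes the projector by the rank-one term [s^-1 v v^T]. With denominators
    cleared, [d] divides the right-hand side exactly over the integers, as in Bareiss
    elimination. *)
Lemma gproj_col : e != 0 ->
  d *: gproj (col_mx A a) = e *: gproj A - (gproj A *m a^T) *m (gproj A *m a^T)^T.
Proof.
move=> e0; have s0 : s != 0 by apply: contraNneq e0 => s0; rewrite eE s0 mulr0.
have u' : gram (col_mx A a) \in unitmx by rewrite unitmxE unitfE det_gram_col.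
set A' := col_mx A a in u' *.
pose v := P *m a^T.
have vT : v^T = a *m P by rewrite /v trmx_mul P_sym trmxK.
pose P2 := P - s^-1 *: (v *m v^T).
pose R' := 1%:M - A'^T *m invmx (gram A') *m A'.
have sM : a *m v = s%:M by rewrite /v mulmxA [LHS]mx11_scalar.
have P2A : P2 *m A'^T = 0.
  have t1 : P2 *m A^T = 0.
    by rewrite /P2 mulmxBl PA0 -scalemxAl vT -!mulmxA PA0 !mulmx0 scaler0 subrr.
  have t2 : P2 *m a^T = 0.
    rewrite /P2 mulmxBl -scalemxAl vT -!mulmxA -/v sM.
    by rewrite mul_mx_scalar -scalemxAr scalerA mulVf // -/v scale1r subrr.
  by rewrite /A' tr_col_mx mul_mx_row t1 t2 row_mx0.
have AR : A' *m R' = 0.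
  by rewrite /R' mulmxBr mulmx1 !mulmxA -/(gram A') mulmxV // mul1mx subrr.
(* The candidate [P2] annihilates the rows of [A'], hence [P2 = P2 R']; the rows annihilate the true
   projector [R'], hence [R' = P2 R']. So the two coincide. *)
have P2R : P2 = P2 *m R'.
  by rewrite /R' mulmxBr mulmx1 !mulmxA P2A !mul0mx subr0.
have R2 : R' = P2 *m R'.
  have AR1 : A *m R' = 0 by move: AR; rewrite /A' mul_col_mx -col_mx0 => /eq_col_mx[].
  have aR1 : a *m R' = 0 by move: AR; rewrite /A' mul_col_mx -col_mx0 => /eq_col_mx[].
  have PR : P *m R' = R'.
    by rewrite /P mulmxBl mul1mx -!mulmxA AR1 !mulmx0 subr0.
  by rewrite /P2 mulmxBl PR -scalemxAl vT -!mulmxA PR aR1 !mulmx0 scaler0 subr0.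
have E2 : gproj A' = e *: P2.
  by rewrite gprojE ?det_gram_col // -/R' R2 -P2R.
have Ev : gproj A *m a^T = d *: v by rewrite gprojP -scalemxAl.
have EvT : (d *: v)^T = d *: v^T by rewrite linearZ.
rewrite E2 Ev EvT gprojP -scalemxAl -scalemxAr !scalerA.
rewrite /P2 scalerBr scalerA [e * d]mulrC; congr (_ - _ *: _).
by rewrite eE; field.
Qed.

End GramProj.

Lemma map_gram (R S : comNzRingType) (f : {rmorphism R -> S}) (N r : nat) (A : 'M[R]_(r, N)) :
  map_mx f (gram A) = gram (map_mx f A).
Proof. by rewrite /gram map_mxM map_trmx. Qed.

Lemma map_gproj (R S : comNzRingType) (f : {rmorphism R -> S}) (N r : nat) (A : 'M[R]_(r, N)) :
  map_mx f (gproj A) = gproj (map_mx f A).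
Proof.
by rewrite /gproj raddfB /= map_mxZ map_mx1 !map_mxM map_mx_adj map_trmx map_gram -det_map_mx map_gram.
Qed.

Definition zsum (l : seq int) : int := foldr +%R 0 l.

Lemma zsum_mkseq f n : zsum (mkseq f n) = \sum_(j < n) f j.
Proof. by rewrite /zsum foldrE big_map -[n]/(0 + n)%N /index_iota -{1}[n]subn0 big_mkord. Qed.

Definition dotz (n : nat) (u v : seq int) : int := zsum (mkseq (fun j => u`_j * v`_j) n).

Definition mulv (n : nat) (Q : seq (seq int)) (a : seq int) : seq int :=
  mkseq (fun i => dotz n (nth [::] Q i) a) n.

Definition projstate := (seq (seq int) * int * nat)%type.

(** [e] is the current Gram determinant times the squared distance of [a] from the span: zero for a
    dependent row, which is skipped, and otherwise the next Gram determinant. *)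
Definition projstep (n : nat) (st : projstate) (a : seq int) : projstate :=
  let v := mulv n st.1.1 a in
  let e := dotz n a v in
  if e == 0 then st else
  (mkseq (fun i => mkseq (fun j =>
     zquot (e * (nth [::] st.1.1 i)`_j - v`_i * v`_j) st.1.2) n) n, e, st.2.+1).

Definition idmat (n : nat) : seq (seq int) :=
  mkseq (fun i => mkseq (fun j => if i == j then 1 else 0) n) n.

Definition proj (n : nat) (rows : seq (seq int)) : projstate :=
  foldl (projstep n) (idmat n, 1, 0%N) rows.

Definition iv (n : nat) (a : seq int) : 'rV[int]_n := \row_j a`_j.
Definition im (n : nat) (Q : seq (seq int)) : 'M[int]_n := \matrix_(i, j) (nth [::] Q i)`_j.

Lemma dotzE n u v : dotz n u v = (iv n u *m (iv n v)^T) 0 0.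
Proof. by rewrite /dotz zsum_mkseq mxE; apply: eq_bigr => j _; rewrite !mxE. Qed.

Lemma mulvE n Q a : (iv n (mulv n Q a))^T = im n Q *m (iv n a)^T.
Proof.
apply/matrixP => i j; rewrite !mxE nth_mkseq // /dotz zsum_mkseq.
by apply: eq_bigr => k _; rewrite !mxE.
Qed.

Lemma im_mkseq n f : im n (mkseq (fun i => mkseq (f i) n) n) = \matrix_(i, j) f i j.
Proof. by apply/matrixP => i j; rewrite !mxE nth_mkseq // nth_mkseq. Qed.

Lemma map_intr_inj (F : numDomainType) m n (A B : 'M[int]_(m, n)) :
  map_mx (intr : int -> F) A = map_mx intr B -> A = B.
Proof.
move=> /matrixP E; apply/matrixP => i j.
by have := E i j; rewrite !mxE => /intr_inj.
Qed.

Section ProjSpec.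
Variables (F : realFieldType) (n : nat).

Definition rv (a : seq int) : 'rV[F]_n := map_mx intr (iv n a).
Definition rowsmx (l : seq (seq int)) : 'M[F]_n := (\sum_(a <- l) <<rv a>>)%MS.

(** In the induction [A] consists of the rows that were not skipped; the program stores only its
    projector, its Gram determinant and its number of rows. *)
Definition projinv (l : seq (seq int)) (st : projstate) :=
  exists A : 'M[int]_(st.2, n),
  [/\ im n st.1.1 = gproj A, st.1.2 = \det (gram A), 0 < st.1.2 &
     (map_mx intr A :=: rowsmx l)%MS].

Lemma normsq_ge0 m (x : 'rV[F]_m) : 0 <= (x *m x^T) 0 0.
Proof. by rewrite mxE sumr_ge0 // => k _; rewrite mxE -expr2 sqr_ge0. Qed.

Lemma normsq_eq0 m (x : 'rV[F]_m) : (x *m x^T) 0 0 = 0 -> x = 0.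
Proof.
rewrite mxE => /eqP; rewrite psumr_eq0 => [/allP h|k _]; last by rewrite mxE -expr2 sqr_ge0.
apply/rowP => j; have := h j; rewrite mem_index_enum => /(_ isT) /=.
by rewrite !mxE -expr2 sqrf_eq0 => /eqP.
Qed.

Lemma rowsmx_rcons l a : rowsmx (rcons l a) = (rowsmx l + <<rv a>>)%MS.
Proof. by rewrite /rowsmx big_rcons /= addsmxC. Qed.

Lemma projinv0 : projinv [::] (idmat n, 1, 0%N).
Proof.
exists 0; split=> //=.
- rewrite /idmat im_mkseq /gproj det_mx00 scale1r !mulmx0 subr0.
  by apply/matrixP => i j; rewrite !mxE -val_eqE; case: eqP.
- by rewrite det_mx00.
- by rewrite /rowsmx big_nil map_mx0; apply/eqmxP; rewrite !sub0mx.
Qed.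

(** All three facts come from [e = d |a P|^2], where the projector [P] does not lengthen [a]. The
    upper bound is one step of Hadamard's inequality. *)
Lemma proj_step_alg (r : nat) (A : 'M[F]_(r, n)) (a : 'rV[F]_n) (d := \det (gram A))
   (e := (a *m gproj A *m a^T) 0 0) : 0 < d ->
  [/\ 0 <= e, e <= d * (a *m a^T) 0 0 & e = 0 -> (a <= A)%MS].
Proof.
move=> d0; have dn0 : \det (gram A) != 0 by rewrite gt_eqF.
pose P := 1%:M - A^T *m invmx (gram A) *m A.
have Ps : P^T = P := P_sym A.
have PP : P *m P = P := P_idem dn0.
have Ee : e = d * (a *m P *m a^T) 0 0 := eE a dn0.
have Es : a *m P *m a^T = (a *m P) *m (a *m P)^T.
  by rewrite trmx_mul Ps !mulmxA -(mulmxA a P P) PP.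
split.
- by rewrite Ee mulr_ge0 ?(ltW d0) // Es normsq_ge0.
- rewrite Ee ler_pM2l // -subr_ge0.
  have -> : (a *m a^T) 0 0 - (a *m P *m a^T) 0 0 = ((a - a *m P) *m (a - a *m P)^T) 0 0.
    have gen (b : 'rV[F]_n) : a *m b^T = b *m a^T -> b *m a^T = b *m b^T ->
        (a *m a^T) 0 0 - (b *m a^T) 0 0 = ((a - b) *m (a - b)^T) 0 0.
      move=> h1 h2; have -> : (a - b)^T = a^T - b^T by rewrite linearB.
      by rewrite mulmxBl !mulmxBr h1 -h2 subrr subr0 !mxE.
    by apply: gen => //; rewrite trmx_mul Ps mulmxA.
  exact: normsq_ge0.
- move/eqP; rewrite Ee mulf_eq0 (gt_eqF d0) /= => /eqP; rewrite Es => /normsq_eq0.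
  rewrite /P mulmxBr mulmx1 => /eqP; rewrite subr_eq0 => /eqP ->.
  by rewrite !mulmxA submxMl.
Qed.

Lemma det_gramF r (A : 'M[int]_(r, n)) :
  \det (gram (map_mx intr A)) = (\det (gram A))%:~R :> F.
Proof. by rewrite -map_gram det_map_mx. Qed.

Lemma projstep_inv l st a : projinv l st -> projinv (rcons l a) (projstep n st a) /\
  (projstep n st a).1.2 <= st.1.2 * (1 + dotz n a a).
Proof.
case: st => [[Q dd] r] [A [/= EQ Ed d0 EA]].
have d0F : 0 < \det (gram (map_mx intr A : 'M[F]_(r, n))) by rewrite det_gramF -Ed ltr0z.
have [e0 el ez] := proj_step_alg (rv a) d0F.
have Ev : (iv n (mulv n Q a))^T = gproj A *m (iv n a)^T by rewrite mulvE EQ.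
set e := dotz n a (mulv n Q a).
have Ee : e = (iv n a *m gproj A *m (iv n a)^T) 0 0 by rewrite /e dotzE Ev mulmxA.
have EeF : (rv a *m gproj (map_mx intr A) *m (rv a)^T) 0 0 = e%:~R.
  by rewrite Ee /rv -map_gproj map_trmx -!map_mxM mxE.
rewrite EeF in e0 el ez.
have aa : (rv a *m (rv a)^T) 0 0 = (dotz n a a)%:~R :> F.
  by rewrite dotzE /rv map_trmx -map_mxM mxE.
have aa0 : 0 <= dotz n a a by rewrite -(ler0z F) -aa normsq_ge0.
rewrite /projstep /= -/e; case: eqP => [ee|/eqP en0] /=.
  split; last by rewrite mulrDr mulr1 lerDl mulr_ge0 // ltW.
  exists A; split=> //=; rewrite rowsmx_rcons.
  apply: (eqmx_trans EA); apply: eqmx_sym; apply/addsmx_idPl.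
  by rewrite genmxE -EA ez // ee.
split; last first.
  move: el; rewrite aa det_gramF -Ed -rmorphM /= ler_int => /le_trans -> //.
  by rewrite ler_wpM2l ?(ltW d0) // lerDr.
have EG : \det (gram (col_mx A (iv n a))) = e.
  apply: (intr_inj (R := F)); rewrite -det_gramF map_col_mx det_gram_col ?gt_eqF //.
have Eq : dd *: gproj (col_mx A (iv n a)) =
    e *: gproj A - (gproj A *m (iv n a)^T) *m (gproj A *m (iv n a)^T)^T.
  apply: (@map_intr_inj F).
  rewrite map_mxB !map_mxZ map_mxM -map_trmx map_mxM !map_gproj -map_trmx map_col_mx /=.
  have EN : (rv a *m gproj (map_mx intr A) *m (rv a)^T) 0 0 != 0 by rewrite EeF intr_eq0.
  by rewrite Ed -det_gramF -/(rv a) (gproj_col (lt0r_neq0 d0F) EN) EeF.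
suff H : exists A' : 'M[int]_(r + 1, n),
   [/\ im n (mkseq (fun i => mkseq (fun j => zquot (e * (nth [::] Q i)`_j
       - (mulv n Q a)`_i * (mulv n Q a)`_j) dd) n) n) = gproj A', e = \det (gram A'), 0 < e
     & (map_mx intr A' :=: rowsmx (rcons l a))%MS].
  by rewrite /projinv /= -[r.+1]addn1.
exists (col_mx A (iv n a)); split=> //.
- rewrite im_mkseq; apply/matrixP => i j; rewrite mxE.
  have := congr1 (fun M : 'M[int]_n => M i j) Eq.
  rewrite mxE => h.
  have -> : e * (nth [::] Q i)`_j - (mulv n Q a)`_i * (mulv n Q a)`_j =
            gproj (col_mx A (iv n a)) i j * dd.
    rewrite [RHS]mulrC h -Ev -EQ !mxE big_ord_recl big_ord0 addr0 !mxE //.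
  by rewrite zquotK // gt_eqF.
- by rewrite lt_neqAle eq_sym en0 /= -(ler0z F).
rewrite rowsmx_rcons map_col_mx; apply: (eqmx_trans (eqmx_sym (addsmxE _ _))).
by apply: adds_eqmx => //; apply: eqmx_sym; apply: genmxE.
Qed.

Lemma proj_inv l : projinv l (proj n l).
Proof.
rewrite /proj; elim/last_ind: l => [|l a IH]; first exact: projinv0.
by rewrite foldl_rcons; case: (projstep_inv a IH).
Qed.

Definition pmx (l : seq (seq int)) : 'M[F]_n :=
  ((proj n l).1.2)%:~R^-1 *: map_mx intr (im n (proj n l).1.1).

Lemma proj_spec l : [/\ 0 < (proj n l).1.2,
  map_mx intr (im n (proj n l).1.1) = ((proj n l).1.2)%:~R *: pmx l,
  (pmx l)^T = pmx l, pmx l *m pmx l = pmx l &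
  [/\ rowsmx l *m pmx l = 0, (1%:M - pmx l <= rowsmx l)%MS & \rank (rowsmx l) = (proj n l).2]].
Proof.
have := proj_inv l; rewrite /pmx /projinv; case: (proj n l) => [[Q dd] r] [A [/= EQ Ed d0 EA]].
have dn0 : \det (gram (map_mx intr A : 'M[F]_(r, n))) != 0.
  by rewrite det_gramF -Ed intr_eq0 gt_eqF.
have ddn0 : dd%:~R != 0 :> F by rewrite intr_eq0 gt_eqF.
have EP : dd%:~R^-1 *: map_mx intr (im n Q) = 1%:M - (map_mx intr A)^T *m
     invmx (gram (map_mx intr A : 'M[F]_(r, n))) *m map_mx intr A.
  by rewrite EQ map_gproj gprojP // det_gramF -Ed scalerA mulVf // scale1r.
split=> //.
- by rewrite scalerA divff // scale1r.
- by rewrite EP P_sym.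
- by rewrite EP P_idem.
rewrite EP; split.
- have : (rowsmx l <= map_mx intr A)%MS by rewrite EA.
  by case/submxP=> X ->; rewrite -(mulmxA X) AP0 // mulmx0.
- by rewrite opprB addrC subrK -EA -!mulmxA !mulmxA submxMl.
- rewrite -EA; apply/eqP; rewrite -/(row_free _) -row_leq_rank.
  apply: leq_trans (mxrankM_maxl (map_mx intr A) (map_mx intr A)^T).
  rewrite row_leq_rank row_free_unit unitmxE unitfE //.
Qed.

(** Entries of an orthogonal projector lie in [[-1, 1]], because [P k k] is the sum of the squares
    of row [k]. *)
Lemma proj_entry_bound l i j :
  `|(im n (proj n l).1.1) i j| <= (proj n l).1.2.
Proof.
have [d0 E Ps PP _] := proj_spec l.
set P := pmx l in E Ps PP *.
have Psym (k m : 'I_n) : P k m = P m k by rewrite -{1}Ps mxE.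
have Pii (k : 'I_n) : P k k = \sum_j (P k j) ^+ 2.
  rewrite -{1}PP mxE; apply: eq_bigr => m _.
  by rewrite (Psym m k) expr2.
have Pkj (k m : 'I_n) : (P k m) ^+ 2 <= P k k.
  by rewrite Pii (bigD1 m) //= lerDl sumr_ge0 // => ? _; rewrite sqr_ge0.
have P1 (k : 'I_n) : P k k <= 1.
  rewrite leNgt; apply/negP => lt1; have := Pkj k k.
  by rewrite expr2 leNgt ltr_pMr ?lt1 // (lt_trans ltr01 lt1).
have Pn : `|P i j| <= 1.
  by rewrite -(@ler_pXn2r _ 2) ?nnegrE ?normr_ge0 // expr1n real_normK ?num_real //
     (le_trans (Pkj i j)).
rewrite -(ler_int F) intr_norm.
have := congr1 (fun M : 'M[F]_n => M i j) E; rewrite !mxE => ->.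
rewrite normrM gtr0_norm ?ltr0z //=; apply: ler_piMr => //.
  by rewrite ler0z ltW.
by move: Pn; rewrite /P /pmx !mxE.
Qed.

Lemma proj_det_bound l : (proj n l).1.2 <= \prod_(a <- l) (1 + dotz n a a).
Proof.
elim/last_ind: l => [|l a IH]; first by rewrite big_nil.
rewrite big_rcons /proj foldl_rcons -/(proj n l) [X in _ <= X]/=.
have [_ h] := projstep_inv a (proj_inv l); apply: le_trans h _.
apply: ler_wpM2r => //; rewrite addr_ge0 // dotzE -(ler0z F).
by have := normsq_ge0 (rv a); rewrite /rv map_trmx -map_mxM mxE.
Qed.

End ProjSpec.

Local Open Scope nat_scope.

(** * The decision procedure and its running time *)

Lemma esz_mkseq A {EA : Enc A} (F : nat -> A) n M :
  (forall i, i < n -> esz (F i) <= M) -> esz (mkseq F n) <= n * M.+1 + 1.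
Proof.
move=> H; apply: leq_trans (@esz_le_size _ _ _ M _) _; last by rewrite size_mkseq.
by move=> i; rewrite size_mkseq => lti x0; rewrite nth_mkseq //; apply: H.
Qed.

Lemma abszD_le (x y : int) : absz (x + y)%R <= absz x + absz y.
Proof. lia. Qed.

Section PTmore.
Context {E Y : Type} {EE : Enc E} {EY : Enc Y}.

Lemma PT_mkseq (F : E -> nat -> Y) (n : E -> nat) :
  PT (fun p : E * nat => F p.1 p.2) -> PT n -> PT (fun e => mkseq (F e) (n e)).
Proof. by move=> HF Hn; apply: (PT_map 0) HF _; apply: PT_iota. Qed.

Lemma zsum_bound (l : seq int) : absz (zsum l) < 2 ^ esz l.
Proof.
elim: l => // x l IH; rewrite esz_cons /zsum /= -/(zsum l) expnS expnD.
have hx := abs_esz x; move: (zsum l) IH => z IH.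
have : absz (x + z)%R <= absz x + absz z by lia.
by move: (2 ^ esz x) (2 ^ esz l) hx IH; nia.
Qed.

Lemma PT_zsum (l : E -> seq int) : PT l -> PT (fun e => zsum (l e)).
Proof.
move=> Hl; refine (PT_foldr 0%R (step := fun e => +%R) (B := fun e => 4 * esz (l e) + 5) _ _ _ _ _) => //.
- by apply: PT_addz; [exact: PT_snd|apply: PT_osnd; exact: PT_fst].
- exact: PT_const.
- apply: pbd_add; last exact: pbd_const.
  by apply: pbd_mul; [exact: pbd_const|exact: PT_size_pbd].
move=> e i _; rewrite -/(zsum _); apply: esz_int_le; apply: leq_trans (zsum_bound _) _.
by rewrite leq_exp2l // esz_drop.
Qed.

Definition zprod (l : seq int) : int := foldr *%R 1%R l.

Lemma zprod_bound (l : seq int) : absz (zprod l) < 2 ^ esz l.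
Proof.
elim: l => // x l IH; rewrite esz_cons /zprod /= -/(zprod l) expnS expnD abszM.
have hx := abs_esz x; move: (absz x) (absz (zprod l)) (2 ^ esz x) (2 ^ esz l) hx IH; nia.
Qed.

Lemma PT_zprod (l : E -> seq int) : PT l -> PT (fun e => zprod (l e)).
Proof.
move=> Hl; refine (PT_foldr 0%R (step := fun e => *%R) (B := fun e => 4 * esz (l e) + 5) _ _ _ _ _) => //.
- by apply: PT_mulz; [exact: PT_snd|apply: PT_osnd; exact: PT_fst].
- exact: PT_const.
- apply: pbd_add; last exact: pbd_const.
  by apply: pbd_mul; [exact: pbd_const|exact: PT_size_pbd].
move=> e i _; rewrite -/(zprod _); apply: esz_int_le; apply: leq_trans (zprod_bound _) _.
by rewrite leq_exp2l // esz_drop.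
Qed.

Definition shl (z : int) (k : nat) : int := (z * 2 ^+ k)%R.

Lemma PT_shl (z : E -> int) (k : E -> nat) : PT z -> PT k -> PT (fun e => shl (z e) (k e)).
Proof.
have itE (x : int) j : iter j (fun y => y + y)%R x = shl x j.
  by elim: j => [|j /= ->]; rewrite /shl ?mulr1 // exprSr mulrA mulr_natr mulr2n.
move=> Hz Hk; apply: (PT_ext (f := fun e => iter (k e) (fun y => y + y)%R (z e))) => [e|].
  exact: itE.
refine (PT_iter (f := fun e y => (y + y)%R) (B := fun e => 4 * (esz (z e) + k e) + 5) _ _ _ _ _) => //.
- by apply: PT_addz; exact: PT_snd.
- apply: pbd_add; last exact: pbd_const.
  by apply: pbd_mul; [exact: pbd_const|apply: pbd_add; [exact: PT_size_pbd|exact: PT_pbd]].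
move=> e i lei; rewrite itE; apply: esz_int_le; rewrite /shl abszM.
have -> : absz (2 ^+ i)%R = 2 ^ i by rewrite abszX.
apply: leq_trans (_ : 2 ^ (esz (z e) + i) <= _); last by rewrite leq_exp2l // leq_add2l.
by rewrite expnD ltn_mul2r abs_esz expn_gt0.
Qed.

Lemma PT_Posz (n : E -> nat) : PT n -> PT (fun e => Posz (n e)).
Proof.
have itE k : iter k (fun z : int => z + 1)%R 0%R = Posz k.
  by elim: k => //= k ->; rewrite -addn1.
move=> Hn; apply: (PT_ext (f := fun e => iter (n e) (fun z => z + 1)%R 0%R)) => [e|].
  exact: itE.
refine (PT_iter (f := fun e (z : int) => (z + 1)%R) (B := fun e => 4 * n e + 5) _ _ _ _ _) => //.
- by apply: PT_addz; [exact: PT_snd|exact: PT_const].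
- exact: PT_const.
- apply: pbd_add; last exact: pbd_const.
  by apply: pbd_mul; [exact: pbd_const|exact: PT_pbd].
move=> e i lei; rewrite itE; apply: esz_int_le.
exact: leq_ltn_trans lei (ltn_expl _ _).
Qed.

End PTmore.

Section PTmore2.
Context {E Y : Type} {EE : Enc E} {EY : Enc Y}.

Lemma PT_lez (f g : E -> int) : PT f -> PT g -> PT (fun e => f e <= g e)%R.
Proof.
move=> Hf Hg; apply: (PT_ext (f := fun e => (f e - g e <= 0)%R)) => [e|].
  by rewrite subr_le0.
by apply: PT_lez0; apply: PT_addz => //; apply: PT_oppz.
Qed.

End PTmore2.

(** Syntax-directed: the head symbol of the body selects the closure lemma, hypotheses [PT f] close
    subterms, and a conditional is tried last. *)
Ltac pt1 := cbv beta; lazymatch goal with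
  | H : PT ?f |- PT ?f => exact H
  | H : PT ?f |- PT (fun e => ?f e) => exact H
  | |- PT (fun e => e) => exact PT_id
  | |- PT (fun _ => ?c) => exact (PT_const c)
  | |- PT (fun e => fst e) => exact PT_fst
  | |- PT fst => exact PT_fst
  | |- PT snd => exact PT_snd
  | |- PT (fun e => snd e) => exact PT_snd
  | H : PT ?f |- PT (fun e => ?f (@?g e)) => apply (PT_comp (f := g) (g := f)); [|exact H]
  | |- PT (fun e => fst (@?f e)) => apply (PT_ofst (f := f))
  | |- PT (fun e => snd (@?f e)) => apply (PT_osnd (f := f))
  | |- PT (fun e => (@?f e, @?g e)) => apply (PT_pair (f := f) (g := g))
  | |- PT (fun e => cons (@?f e) (@?g e)) => apply (PT_cons (f := f) (l := g))
  | |- PT (fun e => andb (@?f e) (@?g e)) => apply (PT_andb (f := f) (g := g))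
  | |- PT (fun e => orb (@?f e) (@?g e)) => apply (PT_orb (f := f) (g := g))
  | |- PT (fun e => negb (@?f e)) => apply (PT_negb (f := f))
  | |- PT (fun e => nth ?x0 (@?f e) (@?g e)) => apply (PT_nth x0 (l := f) (n := g))
  | |- PT (fun e => S (@?f e)) => apply (PT_S (n := f))
  | |- PT (fun e => addn (@?f e) (@?g e)) => apply (PT_addn (m := f) (n := g))
  | |- PT (fun e => subn (@?f e) (@?g e)) => apply (PT_subn (m := f) (n := g))
  | |- PT (fun e => muln (@?f e) (@?g e)) => apply (PT_muln (m := f) (n := g))
  | |- PT (fun e => leq (@?f e) (@?g e)) => apply (PT_leq (m := f) (n := g))
  | |- PT (fun e => @eq_op _ (@?f e) (@?g e)) =>
      first [apply (PT_eqn (m := f) (n := g)) | apply (PT_eqz0 (f := f)) | apply (PT_eqb (f := f) (g := g))]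
  | |- PT (fun e => mkseq (@?F e) (@?n e)) => apply (PT_mkseq (F := F) (n := n))
  | |- PT (fun e => iota 0 (@?n e)) => apply (PT_iota (n := n))
  | |- PT (fun e => sumn (@?n e)) => apply (PT_sumn (l := n))
  | |- PT (fun e => zbits (@?n e)) => apply (PT_zbits (f := n))
  | |- PT (fun e => zsum (@?n e)) => apply (PT_zsum (l := n))
  | |- PT (fun e => zprod (@?n e)) => apply (PT_zprod (l := n))
  | |- PT (fun e => shl (@?n e) (@?k e)) => apply (PT_shl (z := n) (k := k))
  | |- PT (fun e => Posz (@?n e)) => apply (PT_Posz (n := n))
  | |- PT (fun e => zquot (@?f e) (@?g e)) => apply (PT_zquot (f := f) (g := g))
  | |- PT (fun e => (@?f e * @?g e)%R) => apply (PT_mulz (f := f) (g := g))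
  | |- PT (fun e => (@?f e + @?g e)%R) => apply (PT_addz (f := f) (g := g))
  | |- PT (fun e => (- @?f e)%R) => apply (PT_oppz (f := f))
  | |- PT (fun e => (@?f e <= @?g e)%R) => apply (PT_lez (f := f) (g := g))
  | |- PT (fun e => map (@?F e) (@?l e)) =>
      first [apply (PT_map 0 (F := F) (l := l)) | apply (PT_map [::] (F := F) (l := l))
            | apply (PT_map 0%R (F := F) (l := l))]
  | |- PT (fun e => cat (@?f e) (@?g e)) => apply (PT_cat [::] (l := f) (r := g))
  | |- PT (fun e => find (@?p e) (@?l e)) => apply (PT_find 0 (p := p) (l := l))
  | |- PT _ => simple eapply PT_if
  end.
Ltac pt := repeat pt1.

Section PTproj.
Context {E : Type} {EE : Enc E}.

Lemma PT_dotz (n : E -> nat) (u v : E -> seq int) : PT n -> PT u -> PT v ->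
  PT (fun e => dotz (n e) (u e) (v e)).
Proof. by move=> Hn Hu Hv; rewrite /dotz; pt. Qed.

End PTproj.

Section PTproj2.
Context {E : Type} {EE : Enc E}.

Lemma PT_mulv (n : E -> nat) (Q : E -> seq (seq int)) (v : E -> seq int) : PT n -> PT Q -> PT v ->
  PT (fun e => mulv (n e) (Q e) (v e)).
Proof. by move=> Hn HQ Hv; rewrite /mulv; pt; apply: PT_dotz; pt. Qed.

End PTproj2.

Lemma proj_shape n l : (proj n l).1.1 =
  mkseq (fun i => mkseq (fun j => (nth [::] (proj n l).1.1 i)`_j)%R n) n.
Proof.
have H (f : nat -> nat -> int) : let Q := mkseq (fun i => mkseq (f i) n) n in
    Q = mkseq (fun i => mkseq (fun j => (nth [::] Q i)`_j)%R n) n.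
  move=> Q; apply: (@eq_from_nth _ [::]); rewrite !size_mkseq // => i lti.
  rewrite !nth_mkseq //; apply: (@eq_from_nth _ 0%R); rewrite !size_mkseq // => j ltj.
  by rewrite !nth_mkseq // /Q !nth_mkseq.
elim/last_ind: l => [|l a IH]; first exact: H.
rewrite /proj foldl_rcons -/(proj n l) /projstep; case: eqP => _; [exact: IH|exact: H].
Qed.

Lemma dotz_bound n a : (absz (1 + dotz n a a)%R <= 2 ^ (n + 2 * esz a)).
Proof.
have h j : absz (a`_j)%R < 2 ^ esz a.
  case: (ltnP j (size a)) => lt; last by rewrite nth_default // expn_gt0.
  apply: leq_trans (abs_esz _) _; rewrite leq_exp2l //; apply/ltnW/esz_mem/mem_nth => //.
have hs : absz (dotz n a a) <= n * (2 ^ esz a) ^ 2.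
  rewrite /dotz zsum_mkseq; elim: (n) => [|k IH]; first by rewrite big_ord0.
  rewrite big_ord_recr /=.
  have : absz (a`_k * a`_k)%R <= (2 ^ esz a) ^ 2.
    by rewrite abszM expnS expn1 leq_mul // ltnW.
  move: IH; set x := (\sum_(_ < _) _)%R; set y := (a`_k * a`_k)%R => hx hy.
  apply: leq_trans (_ : absz x + absz y <= _); first exact: abszD_le.
  by rewrite mulSn addnC leq_add.
rewrite expnD [2 * esz a]mulnC expnM.
have y0 : 0 < (2 ^ esz a) ^ 2 by rewrite !expn_gt0.
apply: leq_trans (abszD_le _ _) _; apply: leq_trans (leq_add (leqnn _) hs) _.
apply: leq_trans (_ : n.+1 * (2 ^ esz a) ^ 2 <= _); first by rewrite mulSn leq_add2r.
by rewrite leq_mul2r (ltn_expl n (isT : 1 < 2)) orbT.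
Qed.

Lemma proj_bits n l : absz ((proj n l).1.2) < 2 ^ ((n + 2) * esz l).
Proof.
have [d0 _ _ _ _] := proj_spec rat n l.
have : (absz (proj n l).1.2 <= absz (\prod_(a <- l) (1 + dotz n a a))%R).
  by have := proj_det_bound rat n l; lia.
move/leq_ltn_trans; apply.
elim: (l) => [|a r IH]; first by rewrite big_nil /= esz_nil muln1 -[1]/(2 ^ 0) ltn_exp2l // addn2.
rewrite big_cons abszM esz_cons.
have -> : (n + 2) * (esz a + esz r).+1 = (n + 2 + n * esz a + 2 * esz a) + (n + 2) * esz r by lia.
rewrite expnD; apply: leq_ltn_trans (leq_mul (dotz_bound n a) (leqnn _)) _.
apply: leq_ltn_trans (leq_mul (leqnn _) (ltnW IH)) _; rewrite ltn_mul2r expn_gt0 /=.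
by rewrite ltn_exp2l //; lia.
Qed.

Section PTproj3.
Context {E : Type} {EE : Enc E}.

Lemma PT_proj (n : E -> nat) (l : E -> seq (seq int)) : PT n -> PT l ->
  PT (fun e => proj (n e) (l e)).
Proof.
move=> Hn Hl.
pose (K := fun e => (n e + 2) * esz (l e)).
refine (PT_foldl [::] (step := fun e => projstep (n e))
  (B := fun e => (n e * (n e * (4 * K e + 6) + 2) + 1) + (4 * K e + 5) + (2 * n e + 3)) _ _ _ _ _) => //.
- pose (v := fun p : E * (seq (seq int) * int * nat) * seq int => mulv (n p.1.1) p.1.2.1.1 p.2).
  have Hv : PT v by apply: PT_mulv; pt.
  pose (x := fun p : E * (seq (seq int) * int * nat) * seq int => dotz (n p.1.1) p.2 (v p)).
  have Hx : PT x by apply: PT_dotz; pt.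
  apply: (PT_ext (f := fun p : E * (seq (seq int) * int * nat) * seq int => if x p == 0%R then p.1.2 else
    (mkseq (fun i => mkseq (fun j => zquot (x p * (nth [::] p.1.2.1.1 i)`_j - (v p)`_i * (v p)`_j)
         p.1.2.1.2) (n p.1.1)) (n p.1.1), x p, p.1.2.2.+1)))%R => //.
  by rewrite /projstate; pt.
- by rewrite /idmat; pt.
- have hK : pbd (fun _ => True) K.
    by apply: pbd_mul; [apply: pbd_add; [exact: PT_pbd|exact: pbd_const]|exact: PT_size_pbd].
  have c c0 := @pbd_const E _ (fun _ => True) c0; have Hn' := PT_pbd Hn.
  have sl := PT_size_pbd Hl.
  by repeat (apply: pbd_add || apply: pbd_mul).
move=> e i _; rewrite -/(proj _ _); set r := take i (l e).
have Kr : (n e + 2) * esz r <= K e by rewrite leq_mul2l esz_take orbT.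
have hd : absz (proj (n e) r).1.2 < 2 ^ K e.
  by apply: leq_trans (proj_bits _ _) _; rewrite leq_exp2l.
have hr : (proj (n e) r).2 <= n e.
  by have [_ _ _ _ [_ _ <-]] := proj_spec rat (n e) r; apply: rank_leq_row.
have hQ : esz (proj (n e) r).1.1 <= n e * (n e * (4 * K e + 6) + 2) + 1.
  rewrite proj_shape; apply: leq_trans (@esz_mkseq _ _ _ _ (n e * (4 * K e + 6) + 1) _) _; last by lia.
  move=> a lta; apply: leq_trans (@esz_mkseq _ _ _ _ (4 * K e + 5) _) _; last by lia.
  move=> b ltb; apply: esz_int_le; apply: leq_ltn_trans hd.
  have := proj_entry_bound rat r (Ordinal lta) (Ordinal ltb); rewrite mxE /=; lia.
move: hd hr hQ; case: (proj _ _) => [[Q dd] rr] /= hd hr hQ.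
rewrite !esz_pair esz_nat; have := esz_int_le hd; lia.
Qed.

End PTproj3.

(* [s] counts how often each column was halved; a column is discarded once its
   count exceeds [cap], which a unit row then enforces. *)
Definition lprows (n cap : nat) (R : seq (seq int)) (s : seq nat) : seq (seq int) :=
  [seq mkseq (fun k => if nth 0 s k <= cap then shl (nth 0%R a k) (cap - nth 0 s k) else 0%R) n | a <- R] ++
  mkseq (fun i => mkseq (fun j => if (i == j) && (cap < nth 0 s i) then 1%R else 0%R) n) n.

(** The value [n] signals success: every column still kept is positive in [z]. *)
Definition badk (n cap : nat) (s : seq nat) (z : seq int) : nat :=
  find (fun k => (nth 0 s k <= cap) && (nth 0 z k <= 0)%R) (iota 0 n).

Definition percstep (n cap : nat) (s : seq nat) (Q : seq (seq int)) (y : seq int) : seq int :=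
  mkseq (fun j => nth 0 y j + (if j == badk n cap s (mulv n Q y) then 1 else 0))%R n.

(** Unless the perceptron stops early, [4 n^3] unit increments force some entry up to [4 n^2] by
    pigeonhole; this is the threshold of [lpstep], and [lp_cut] shows why it justifies a halving. *)
Definition percy (n cap : nat) (s : seq nat) (Q : seq (seq int)) : seq int :=
  iter (4 * (n * n * n)) (percstep n cap s Q) (mkseq (fun _ => 0%R) n).

Definition lpQ n cap R s := (proj n (lprows n cap R s)).1.1.

Definition lpstep (n cap : nat) (R : seq (seq int)) (s : seq nat) : seq nat :=
  let Q := lpQ n cap R s in
  let y := percy n cap s Q in
  if badk n cap s (mulv n Q y) == n then s else
  mkseq (fun j => nth 0 s j +
    (if j == find (fun k => (Posz (4 * (n * n)) <= nth 0 y k)%R) (iota 0 n) then 1 else 0)) n.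

(** A productive pass raises a counter that was at most [cap], so counters never exceed [cap + 1]
    and [n * (cap + 1)] passes suffice. *)
Definition lp (n cap : nat) (R : seq (seq int)) : seq nat :=
  iter (n * cap.+1) (lpstep n cap R) (mkseq (fun _ => 0) n).

(** Exponent of the bound [n! 2^(n b) <= 2^(n n + n b)] for numerators in Cramer's rule, where [b]
    is, generously, the total bit length of [R]. *)
Definition capof (n : nat) (R : seq (seq int)) : nat :=
  n * n + n * sumn [seq sumn [seq zbits z | z <- a] | a <- R].

Definition supp (n : nat) (R : seq (seq int)) : seq bool :=
  mkseq (fun k => nth 0 (lp n (capof n R) R) k <= capof n R) n.

(** An unselected row becomes [[::]], which [nth] reads as the zero vector, so indices are
    preserved. *)
Definition sel (n : nat) (H : seq (seq int)) (S : seq bool) : seq (seq int) :=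
  mkseq (fun k => if nth false S k then nth [::] H k else [::]) n.

Definition gvec (n d : nat) (H : seq (seq int)) (S : seq bool) : seq (seq int) :=
  mkseq (fun k => mulv d (proj d (sel n H S)).1.1 (nth [::] H k)) n.

Definition qrows (n0 n d : nat) (g : seq (seq int)) : seq (seq int) :=
  flatten (mkseq (fun i => mkseq (fun j => mkseq (fun k =>
    let x := (nth 0 (nth [::] g k) i * nth 0 (nth [::] g k) j)%R in
    if k < n0 then x else (- x)%R) n) d) d).

Definition round (n0 n d : nat) (H : seq (seq int)) (S : seq bool) : seq bool :=
  supp n (qrows n0 n d (gvec n d H S)).

Definition finalS (n0 n d : nat) (H : seq (seq int)) : seq bool :=
  iter n (round n0 n d H) [::].

Definition cnt (n : nat) (f : nat -> bool) : nat :=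
  sumn (mkseq (fun k => if f k then 1 else 0) n).

Definition verdict (n0 n d : nat) (H : seq (seq int)) (S : seq bool) : bool * bool :=
  ((proj d H).2 == (proj d (sel n H S)).2 + cnt n (fun k => ~~ nth false S k),
   (cnt n (fun k => ~~ nth false S k && (k < n0)) <= 1) &&
   (cnt n (fun k => ~~ nth false S k && (n0 <= k)) <= 1)).

Definition tokens (w : seq nat) : seq (seq nat) :=
  foldr (fun x ts => if x == 3 then [::] :: ts else (x :: head [::] ts) :: behead ts) [:: [::]] w.

Definition tokN (t : seq nat) : N := Nval (rev [seq x == 2 | x <- t]).

Definition tokZ (t : seq nat) : int :=
  mkint (head 0 t == 4) (tokN (if head 0 t == 4 then behead t else t)).

(** Binary to unary, truncated so that the result cannot explode. When coordinates are listed, [n],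
    [m] and [d] are at most the length of the word and the cap has no effect. *)
Definition capnat (c : nat) (x : N) : nat :=
  (iter c (fun st => if N.eqb st.1 0 then st else (N.sub st.1 1, st.2.+1)) (x, 0)).2.

Definition cden (ts : seq (seq nat)) (d k j : nat) : int := tokZ (nth [::] ts (4 + 2 * (k * d + j))).
Definition cnum (ts : seq (seq nat)) (d k j : nat) : int := tokZ (nth [::] ts (3 + 2 * (k * d + j))).

(** [(1, x_k)] times the product of its denominators, a positive integer. *)
Definition hatv (ts : seq (seq nat)) (d k : nat) : seq int :=
  zprod (mkseq (cden ts d k) d) ::
  mkseq (fun j => cnum ts d k j *
    zprod (mkseq (fun l => if l == j then 1 else cden ts d k l) d))%R d.

Definition solve (n0 m0 d : nat) (ts : seq (seq nat)) : bool * bool :=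
  let H := mkseq (hatv ts d) (n0 + m0) in
  verdict n0 (n0 + m0) d.+1 H (finalS n0 (n0 + m0) d.+1 H).

(** Connectedness of the complete bipartite graph, evaluated in binary because [n] and [m] may be
    exponential in the length of an input without coordinates. *)
Definition trivial_case (a b : N) : bool :=
  (~~ N.eqb a 0 && ~~ N.eqb b 0) || ~~ N.ltb 1 (N.add a b).

Definition decide (w : seq nat) : bool * bool :=
  let ts := tokens w in
  let tk i := tokN (nth [::] ts i) in
  (* The tokens are then just [n], [m], [d]: either [d = 0] or there is no vertex. *)
  if size ts <= 3 then (trivial_case (tk 0) (tk 1), trivial_case (tk 0) (tk 1))
  else solve (capnat (size w) (tk 0)) (capnat (size w) (tk 1)) (capnat (size w) (tk 2)) ts.

Lemma perc_shape n cap s Q i : exists f : nat -> int,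
  iter i (percstep n cap s Q) (mkseq (fun _ => 0%R) n) = mkseq f n /\
  forall j, (0 <= f j <= Posz i)%R.
Proof.
elim: i => [|i [f [E Hf]]]; first by exists (fun _ => 0%R).
exists (fun j => nth 0 (mkseq f n) j +
   (if j == badk n cap s (mulv n Q (mkseq f n)) then 1 else 0))%R.
rewrite iterS E; split=> // j; have : (0 <= nth 0 (mkseq f n) j <= Posz i)%R.
  case: (ltnP j n) => lt; first by rewrite nth_mkseq.
  by rewrite nth_default // size_mkseq.
by case: eqP; lia.
Qed.

Lemma lp_shape n cap R i : exists f : nat -> nat,
  iter i (lpstep n cap R) (mkseq (fun _ => 0) n) = mkseq f n /\ forall j, f j <= i.
Proof.
elim: i => [|i [f [E Hf]]]; first by exists (fun _ => 0).
rewrite iterS E /lpstep; case: ifP => _.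
  by exists f; split=> // j; apply: leqW.
eexists; split=> // j /=; have : nth 0 (mkseq f n) j <= i.
  case: (ltnP j n) => lt; first by rewrite nth_mkseq.
  by rewrite nth_default // size_mkseq.
by case: eqP; lia.
Qed.

(** * Running time of the algorithm *)

Section PTalg.
Context {E : Type} {EE : Enc E}.

Lemma PT_lprows (n cap : E -> nat) (R : E -> seq (seq int)) (s : E -> seq nat) :
  PT n -> PT cap -> PT R -> PT s -> PT (fun e => lprows (n e) (cap e) (R e) (s e)).
Proof. by move=> *; rewrite /lprows; pt. Qed.

Lemma PT_badk (n cap : E -> nat) (s : E -> seq nat) (z : E -> seq int) :
  PT n -> PT cap -> PT s -> PT z -> PT (fun e => badk (n e) (cap e) (s e) (z e)).
Proof. by move=> *; rewrite /badk; pt. Qed.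

End PTalg.

Section PTalg2.
Context {E : Type} {EE : Enc E}.

Lemma PT_percstep (n cap : E -> nat) (s : E -> seq nat) (Q : E -> seq (seq int)) (y : E -> seq int) :
  PT n -> PT cap -> PT s -> PT Q -> PT y ->
  PT (fun e => percstep (n e) (cap e) (s e) (Q e) (y e)).
Proof.
move=> Hn Hc Hs HQ Hy; rewrite /percstep.
have Hb : PT (fun e => badk (n e) (cap e) (s e) (mulv (n e) (Q e) (y e))).
  by apply: PT_badk => //; apply: PT_mulv.
pose (b := fun e => badk (n e) (cap e) (s e) (mulv (n e) (Q e) (y e))).
by change (PT b) in Hb; change (PT (fun e => mkseq (fun j => nth 0 (y e) j +
   (if j == b e then 1 else 0))%R (n e))); pt.
Qed.

Lemma PT_lpQ (n cap : E -> nat) (R : E -> seq (seq int)) (s : E -> seq nat) :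
  PT n -> PT cap -> PT R -> PT s -> PT (fun e => lpQ (n e) (cap e) (R e) (s e)).
Proof. by move=> *; rewrite /lpQ; pt; apply: PT_proj => //; apply: PT_lprows. Qed.

End PTalg2.

Section PTalg3.
Context {E : Type} {EE : Enc E}.

Lemma PT_percy (n cap : E -> nat) (s : E -> seq nat) (Q : E -> seq (seq int)) :
  PT n -> PT cap -> PT s -> PT Q -> PT (fun e => percy (n e) (cap e) (s e) (Q e)).
Proof.
move=> Hn Hc Hs HQ.
refine (PT_iter (f := fun e => percstep (n e) (cap e) (s e) (Q e))
  (B := fun e => n e * (4 * (4 * (n e * n e * n e)) + 6) + 1) _ _ _ _ _).
- by apply: PT_percstep; pt.
- by pt.
- by pt.
- by apply: PT_pbd; pt.
move=> e i lei; have [f [-> Hf]] := perc_shape (n e) (cap e) (s e) (Q e) i.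
apply: leq_trans (@esz_mkseq _ _ _ _ (4 * (4 * (n e * n e * n e)) + 5) _) _; last by lia.
move=> j _; apply: esz_int_le; apply: leq_ltn_trans (ltn_expl _ (isT : 1 < 2)).
by have := Hf j; lia.
Qed.

End PTalg3.

Section PTalg4.
Context {E : Type} {EE : Enc E}.

Lemma PT_lpstep (n cap : E -> nat) (R : E -> seq (seq int)) (s : E -> seq nat) :
  PT n -> PT cap -> PT R -> PT s -> PT (fun e => lpstep (n e) (cap e) (R e) (s e)).
Proof.
move=> Hn Hc HR Hs; rewrite /lpstep.
pose (Q := fun e => lpQ (n e) (cap e) (R e) (s e)).
have HQ : PT Q by apply: PT_lpQ.
pose (y := fun e => percy (n e) (cap e) (s e) (Q e)).
have Hy : PT y by apply: PT_percy.
pose (b := fun e => badk (n e) (cap e) (s e) (mulv (n e) (Q e) (y e))).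
have Hb : PT b by apply: PT_badk => //; apply: PT_mulv.
change (PT (fun e => if b e == n e then s e else mkseq (fun j => nth 0 (s e) j +
    (if j == find (fun k => (Posz (4 * (n e * n e)) <= nth 0 (y e) k)%R) (iota 0 (n e))
     then 1 else 0)) (n e))).
by pt.
Qed.

End PTalg4.

Section PTalg5.
Context {E : Type} {EE : Enc E}.

Lemma PT_lp (n cap : E -> nat) (R : E -> seq (seq int)) :
  PT n -> PT cap -> PT R -> PT (fun e => lp (n e) (cap e) (R e)).
Proof.
move=> Hn Hc HR.
refine (PT_iter (f := fun e => lpstep (n e) (cap e) (R e))
  (B := fun e => n e * (2 * (n e * (cap e).+1) + 2) + 1) _ _ _ _ _).
- by apply: PT_lpstep; pt.
- by pt.
- by pt.
- by apply: PT_pbd; pt.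
move=> e i lei; have [f [-> Hf]] := lp_shape (n e) (cap e) (R e) i.
apply: leq_trans (@esz_mkseq _ _ _ _ (2 * (n e * (cap e).+1) + 1) _) _; last by lia.
by move=> j _; rewrite esz_nat; have := Hf j; lia.
Qed.

Lemma PT_capof (n : E -> nat) (R : E -> seq (seq int)) :
  PT n -> PT R -> PT (fun e => capof (n e) (R e)).
Proof. by move=> Hn HR; rewrite /capof; pt. Qed.

Lemma PT_sel (n : E -> nat) (H : E -> seq (seq int)) (S : E -> seq bool) :
  PT n -> PT H -> PT S -> PT (fun e => sel (n e) (H e) (S e)).
Proof. by move=> *; rewrite /sel; pt. Qed.

End PTalg5.

Section PTalg6.
Context {E : Type} {EE : Enc E}.

Lemma PT_supp (n : E -> nat) (R : E -> seq (seq int)) :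
  PT n -> PT R -> PT (fun e => supp (n e) (R e)).
Proof.
move=> Hn HR; rewrite /supp.
pose (c := fun e => capof (n e) (R e)); have Hc : PT c by apply: PT_capof.
pose (l := fun e => lp (n e) (c e) (R e)); have Hl : PT l by apply: PT_lp.
by change (PT (fun e => mkseq (fun k => nth 0 (l e) k <= c e) (n e))); pt.
Qed.

Lemma PT_gvec (n d : E -> nat) (H : E -> seq (seq int)) (S : E -> seq bool) :
  PT n -> PT d -> PT H -> PT S -> PT (fun e => gvec (n e) (d e) (H e) (S e)).
Proof.
move=> Hn Hd HH HS; rewrite /gvec.
pose (Q := fun e => (proj (d e) (sel (n e) (H e) (S e))).1.1).
have HQ : PT Q by rewrite /Q; pt; apply: PT_proj => //; apply: PT_sel.
change (PT (fun e => mkseq (fun k => mulv (d e) (Q e) (nth [::] (H e) k)) (n e))).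
by pt; apply: PT_mulv; pt.
Qed.

Lemma PT_qrows (n0 n d : E -> nat) (g : E -> seq (seq int)) :
  PT n0 -> PT n -> PT d -> PT g -> PT (fun e => qrows (n0 e) (n e) (d e) (g e)).
Proof.
move=> *; rewrite /qrows; apply: (PT_flatten [::]); cbv zeta; pt.
Qed.

End PTalg6.

Section PTalg7.
Context {E : Type} {EE : Enc E}.

Lemma PT_round (n0 n d : E -> nat) (H : E -> seq (seq int)) (S : E -> seq bool) :
  PT n0 -> PT n -> PT d -> PT H -> PT S ->
  PT (fun e => round (n0 e) (n e) (d e) (H e) (S e)).
Proof.
by move=> *; apply: PT_supp => //; apply: PT_qrows => //; apply: PT_gvec.
Qed.

Lemma PT_cnt (n : E -> nat) (f : E -> nat -> bool) :
  PT n -> PT (fun p : E * nat => f p.1 p.2) -> PT (fun e => cnt (n e) (f e)).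
Proof. by move=> Hn Hf; rewrite /cnt; pt. Qed.

End PTalg7.

Section PTalg8.
Context {E : Type} {EE : Enc E}.

Lemma PT_finalS (n0 n d : E -> nat) (H : E -> seq (seq int)) :
  PT n0 -> PT n -> PT d -> PT H -> PT (fun e => finalS (n0 e) (n e) (d e) (H e)).
Proof.
move=> Hn0 Hn Hd HH.
refine (PT_iter (f := fun e => round (n0 e) (n e) (d e) (H e))
  (B := fun e => n e * 4 + 1) _ _ _ _ _).
- by apply: PT_round; pt.
- by pt.
- by pt.
- by apply: PT_pbd; pt.
move=> e [|i] _; first by rewrite /= esz_nil; lia.
by rewrite iterS; apply: esz_mkseq => k _; apply: esz_bool.
Qed.

Lemma PT_verdict (n0 n d : E -> nat) (H : E -> seq (seq int)) (S : E -> seq bool) :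
  PT n0 -> PT n -> PT d -> PT H -> PT S ->
  PT (fun e => verdict (n0 e) (n e) (d e) (H e) (S e)).
Proof.
move=> *; rewrite /verdict; pt.
- exact: PT_proj.
- by apply: PT_proj => //; apply: PT_sel.
- by apply: PT_cnt => //; pt.
- by apply: PT_cnt => //; pt.
- by apply: PT_cnt => //; pt.
Qed.

End PTalg8.

Lemma tokens_cons x w : tokens (x :: w) =
  if x == 3 then [::] :: tokens w else (x :: head [::] (tokens w)) :: behead (tokens w).
Proof. by []. Qed.

Lemma esz_tokens w : esz (tokens w) <= esz w + 2 /\ tokens w != [::].
Proof.
elim: w => [|x w [IH ne]] //; rewrite tokens_cons; split; last by case: (x == 3).
case: (tokens w) ne IH => //= h t _ IH; rewrite esz_cons in IH.
rewrite esz_cons [esz x]esz_nat; case: eqP => _; rewrite !esz_cons ?esz_nil ?esz_nat; lia.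
Qed.

Section PTparse.
Context {E : Type} {EE : Enc E}.

Lemma PT_tokens (w : E -> seq nat) : PT w -> PT (fun e => tokens (w e)).
Proof.
move=> Hw; refine (PT_foldr 0 (step := fun e x ts => if x == 3 then [::] :: ts
    else (x :: head [::] ts) :: behead ts) (B := fun e => esz (w e) + 2) _ _ _ _ _) => //.
- have Hs : PT (fun p : E * seq (seq nat) * nat => p.1.2) by pt.
  have Hh := PT_head [::] Hs; have Hb := PT_behead Hs.
  by pt.
- exact: PT_const.
- by apply: pbd_add; [exact: PT_size_pbd|exact: pbd_const].
move=> e i _; rewrite -/(tokens _); have [h _] := esz_tokens (drop i (w e)).
by apply: leq_trans h _; rewrite leq_add2r esz_drop.
Qed.

Lemma PT_tokN (t : E -> seq nat) : PT t -> PT (fun e => tokN (t e)).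
Proof. by move=> Ht; apply: PT_Nval; apply: (PT_rev false); pt. Qed.

End PTparse.

Section PTparse2.
Context {E : Type} {EE : Enc E}.

Lemma PT_tokZ (t : E -> seq nat) : PT t -> PT (fun e => tokZ (t e)).
Proof.
move=> Ht; have H4 : PT (fun e => head 0 (t e) == 4).
  by apply: PT_eqn; [exact: PT_head|exact: PT_const].
apply: PT_mkint => //; apply: PT_tokN; apply: PT_if => //.
exact: PT_behead.
Qed.

Lemma capnatE c x : capnat c x = minn c (N.to_nat x).
Proof.
rewrite /capnat.
suff -> : iter c (fun st => if N.eqb st.1 0 then st else (N.sub st.1 1, st.2.+1)) (x, 0)
   = (N.sub x (N.of_nat c), minn c (N.to_nat x)) by [].
elim: c => [|c IH] /=; first by rewrite min0n; congr (_, _); lia.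
rewrite IH /=; case: N.eqb_spec => h; congr (_, _); lia.
Qed.

Lemma PT_capnat (c : E -> nat) (x : E -> N) : PT c -> PT x -> PT (fun e => capnat (c e) (x e)).
Proof.
move=> Hc Hx; rewrite /capnat; apply: PT_osnd.
refine (PT_iter (f := fun e st => if N.eqb st.1 0 then st else (N.sub st.1 1, st.2.+1))
  (B := fun e => 4 * esz (x e) + 2 * c e + 5) _ _ _ _ _) => //.
- have H1 : PT (fun p : E * (N * nat) => p.2.1) by pt.
  have Hz := PT_Nis0 H1.
  have Hm : PT (fun p : E * (N * nat) => N.sub p.2.1 1) by apply: PT_Nsub => //; pt.
  by pt.
- by pt.
- have sx := PT_size_pbd Hx; have cc := PT_pbd Hc.
  by repeat (apply: pbd_add || apply: pbd_mul || apply: pbd_const) => //.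
move=> e i lei.
have -> : iter i (fun st => if N.eqb st.1 0 then st else (N.sub st.1 1, st.2.+1)) (x e, 0)
   = (N.sub (x e) (N.of_nat i), minn i (N.to_nat (x e))).
  elim: (i) => [|j IH] /=; first by rewrite min0n; congr (_, _); lia.
  rewrite IH /=; case: N.eqb_spec => h; congr (_, _); lia.
rewrite esz_pair esz_nat.
have hb : esz (N.sub (x e) (N.of_nat i)) <= 4 * esz (x e) + 1.
  apply: leq_trans (esz_bits _) _; rewrite leq_add2r leq_mul2l /=.
  apply: leq_trans (_ : size (nbits (x e)) <= _); last exact/ltnW/size_bits_esz.
  apply: nbits_ge; apply: Z.le_lt_trans (nbits_lt (x e)).
  by rewrite N2Z.inj_sub_max; lia.
by move: hb; lia.
Qed.

End PTparse2.

Section PTparse3.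
Context {E : Type} {EE : Enc E}.

Lemma PT_hatv (ts : E -> seq (seq nat)) (d k : E -> nat) :
  PT ts -> PT d -> PT k -> PT (fun e => hatv (ts e) (d e) (k e)).
Proof.
move=> Ht Hd Hk.
have Hden (A : Type) (EA : Enc A) (f : A -> E) (j : A -> nat) : PT f -> PT j ->
    PT (fun a => cden (ts (f a)) (d (f a)) (k (f a)) (j a)).
  by move=> Hf Hj; apply: PT_tokZ; pt.
have Hnum (A : Type) (EA : Enc A) (f : A -> E) (j : A -> nat) : PT f -> PT j ->
    PT (fun a => cnum (ts (f a)) (d (f a)) (k (f a)) (j a)).
  by move=> Hf Hj; apply: PT_tokZ; pt.
rewrite /hatv; apply: PT_cons.
  by pt; apply: (Hden _ _ fst snd); pt.
apply: PT_mkseq => //; apply: PT_mulz.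
  by apply: (Hnum _ _ fst snd); pt.
by pt; apply: (Hden _ _ (fun a => a.1.1) snd); pt.
Qed.

End PTparse3.

Section PTparse4.
Context {E : Type} {EE : Enc E}.

Lemma PT_solve (n0 m0 d : E -> nat) (ts : E -> seq (seq nat)) :
  PT n0 -> PT m0 -> PT d -> PT ts -> PT (fun e => solve (n0 e) (m0 e) (d e) (ts e)).
Proof.
move=> Hn Hm Hd Ht.
have HH : PT (fun e => mkseq (hatv (ts e) (d e)) (n0 e + m0 e)).
  by apply: PT_mkseq; [apply: PT_hatv; pt|pt].
have Hs : PT (fun e => n0 e + m0 e) by pt.
have Hd1 : PT (fun e => (d e).+1) by pt.
by rewrite /solve; apply: PT_verdict => //; apply: PT_finalS.
Qed.

Lemma PT_trivial (a b : E -> N) : PT a -> PT b -> PT (fun e => trivial_case (a e) (b e)).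
Proof.
move=> Ha Hb; rewrite /trivial_case.
apply: PT_orb; first by apply: PT_andb; apply: PT_negb; apply: PT_Nis0.
by apply: PT_negb; apply: PT_Nltb; [pt|apply: PT_Nadd].
Qed.

End PTparse4.

Theorem PT_decide : PT decide.
Proof.
rewrite /decide; cbv zeta.
have Ht : PT (fun w : seq nat => tokens w) by apply: PT_tokens; exact: PT_id.
have Hk i : PT (fun w => tokN (nth [::] (tokens w) i)) by apply: PT_tokN; pt.
have Hw : PT (fun w : seq nat => size w) by apply: (PT_size 0); exact: PT_id.
have Hc i : PT (fun w => capnat (size w) (tokN (nth [::] (tokens w) i))) by apply: PT_capnat.
have Hst : PT (fun w => size (tokens w)) by apply: (PT_size [::]).
apply: PT_if; first by pt.
  by apply: PT_pair; apply: PT_trivial.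
exact: PT_solve.
Qed.

(** * From polynomial-time functions to Turing machines *)

Definition unraw (a : sym) : nat :=
  match a with (false, false) => 1 | (true, false) => 2 | (false, true) => 3 | _ => 4 end.

Definition floadrest : frag unit :=
  floop (fbind (fpop SC) (fun o => if o is Some a
    then fpushs (nd :: ser (enc (unraw a))) ;; fret (inl tt) else fret (inr tt))).

Lemma reach_floadrest (l : seq sym) (w : seq nat) sb :
  reach floadrest (ser (enc w), sb, l) (20 * size l + 20) tt
    (ser (enc (catrev [seq unraw a | a <- l] w)), sb, [::]).
Proof.
elim: l w => [|a l IH] w.
  by apply: (reach_mono (t := 20)); [apply: reach_loop_exit|].
have -> : 20 * size (a :: l) + 20 = (1 + (14 + 2)) + (3 + (20 * size l + 20)) by rewrite /=; lia.
apply: (reach_loop_cont (st1 := (ser (enc (unraw a :: w)), sb, l))).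
  apply: reach_bind; first exact: reach_pop.
  apply: reach_seq; last exact: reach_ret.
  have fp (s A B C : seq sym) : reach (fpushs s) (A, B, C) (size s + 2) tt (s ++ A, B, C).
    elim: s => [|b s IHs]; first exact: reach_ret.
    have -> : size (b :: s) + 2 = (size s + 2) + 1 by rewrite /=; lia.
    by apply: reach_seq IHs _; apply: reach_push.
  apply: reach_mono (fp _ _ _ _) _.
  by case: a => [[] []].
by apply: reach_mono (IH (unraw a :: w)) _; lia.
Qed.

Definition fgetbool : frag bool := fbind (fpop SA) (fun o =>
    if o is Some (true, false) then fbind (fpop SA) (fun _ => fbind (fpop SA) (fun _ => fret true))
    else fret false).

Definition foutput : frag (bool * bool) :=
  fbind (fpop SA) (fun _ => fbind fgetbool (fun b1 => fbind fgetbool (fun b2 => fret (b1, b2)))).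

Theorem TM_of_PT (f : seq nat -> bool * bool) : PT f ->
  exists (M : TM) (c k : nat), forall w, all (fun x => 0 < x < 5) w ->
  forall T, c * (size w + 1) ^ k <= T ->
  c_state (tm_run M T w) = halt_out M (f w).1 (f w).2.
Proof.
move=> [fr [k H]].
(* The leaf is the empty list. The input lies with its last symbol on top, so consing symbols as
   they are popped restores the word. *)
pose full := fpush SA lf ;; floadrest ;; fr ;; foutput.
(* A symbol is at most 4, in unary at most 9 long, so [esz w + 2 <= 10 * (size w + 1)] and [fr]
   takes at most [10 ^ k * (size w + 1) ^ k] steps. [D] also covers loading and output; the square
   below pays for the tape simulation. *)
pose D := 100 + 10 ^ k.
exists (simTM full), ((2 * D + 10) * (2 * D + 10)), (2 * k.+1).
move=> w Hw T HT.
pose (t := 1 + ((20 * size w + 20) + ((esz w + 2) ^ k + 20))).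
have Hr : reach full ([::], [::], rev [seq rawsym k | k <- w]) t (f w) ([::], [::], [::]).
  apply: reach_seq; first exact: reach_push.
  apply: reach_seq.
    have := reach_floadrest (rev [seq rawsym k | k <- w]) [::] [::].
    rewrite size_rev size_map map_rev catrevE revK cats0 -map_comp map_id_in; first exact.
    by move=> x /(allP Hw); case: x => [|[|[|[|[|x]]]]].
  apply: reach_seq; first by have [_ /(_ [::] [::])] := H w I; rewrite !cats0; apply.
  apply: (reach_mono (t := 20)) => //.
  by case: (f w) => [[] []].
apply: (sim_correct Hw Hr); apply: leq_trans _ HT.
have es : esz w + 2 <= 10 * (size w + 1).
  have : esz w <= size w * 10 + 1.
    apply: leq_trans (@esz_le_size _ _ _ 9 _) _ => // i lti x0.
    rewrite esz_nat; have /= := allP Hw _ (mem_nth x0 lti); lia.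
  lia.
set s := size w in es *.
have ek : (esz w + 2) ^ k <= 10 ^ k * (s + 1) ^ k.
  by rewrite -expnMn; case: (k) => // k'; rewrite leq_exp2r.
have s1 : 0 < (s + 1) ^ k by rewrite expn_gt0 addn1.
have ht : t <= D * (s + 1) ^ k.+1.
  rewrite expnS /t /D; move: ek s1; move: (_ ^ k) ((s + 1) ^ k) (10 ^ k) => x y z; nia.
have hs : s + 1 <= (s + 1) ^ k.+1 by rewrite expnS; nia.
have -> : (s + 1) ^ (2 * k.+1) = (s + 1) ^ k.+1 * (s + 1) ^ k.+1.
  by rewrite -expnD mul2n addnn.
clearbody t D; move: ht hs; move: ((s + 1) ^ k.+1) => y ht hs; clear - ht hs.
have h1 : 1 + t * (2 * (s + t) + 4) <= (2 * D + 10) * y * (2 * D + 10) * y by nia.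
nia.
Qed.

Local Open Scope ring_scope.

(** * Correctness of the linear programming step *)

Section DetBound.

Lemma det_bound m (M : 'M[int]_m) (b : int) : 0 <= b ->
  (forall i j, `|M i j| <= b) -> `|\det M| <= (m`!)%:Z * b ^+ m.
Proof.
move=> b0 H; apply: le_trans (ler_norm_sum _ _ _) _.
apply: le_trans (_ : \sum_(s : 'S_m) b ^+ m <= _).
  apply: ler_sum => s _; rewrite normrM normrX normrN normr1 expr1n mul1r normr_prod.
  apply: le_trans (_ : \prod_(i < m) b <= _); last by rewrite prodr_const card_ord.
  by apply: ler_prod => i _; rewrite normr_ge0 H.
by rewrite sumr_const card_Sn -mulr_natl natz.
Qed.

Lemma fact_le_exp m n : (m <= n)%N -> (m`! <= n ^ m)%N.
Proof.
elim: m => // m IH lt; rewrite factS expnS leq_mul //.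
by apply: leq_trans (IH (ltnW lt)) _.
Qed.

Lemma adj_bound r n (B : 'M[int]_r) (c : 'cV[int]_r) (b : nat) j : (r <= n)%N ->
  (forall i k, `|B i k| <= (2 ^ b)%:Z) -> (forall i, `|c i 0| <= (2 ^ b)%:Z) ->
  `|(\adj B *m c) j 0| <= (2 ^ (n * n + n * b))%:Z.
Proof.
move=> rn HB Hc; have r0 : (0 < r)%N by case: (r) j => // -[].
have n0 : (0 < n)%N by apply: leq_trans rn.
rewrite mxE; apply: le_trans (ler_norm_sum _ _ _) _.
set X := ((r.-1)`!)%:Z * (2 ^ b)%:Z ^+ r.-1.
have X0 : 0 <= X by rewrite mulr_ge0 // exprn_ge0.
apply: le_trans (_ : \sum_(i < r) X * (2 ^ b)%:Z <= _).
  apply: ler_sum => i _; rewrite normrM ler_pM //.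
  rewrite mxE normrM normrX normrN normr1 expr1n mul1r.
  by apply: det_bound => // k l; rewrite !mxE.
rewrite sumr_const card_ord -mulr_natl /X -mulrA -exprSr prednK // mulrA.
have -> : (2 ^ b)%:Z ^+ r = ((2 ^ b) ^ r)%:Z :> int.
  by elim: (r) => // k IH; rewrite exprS expnS PoszM IH.
rewrite natz -!PoszM lez_nat expnD !expnM leq_mul //.
  apply: leq_trans (_ : n ^ r <= _)%N; last first.
    apply: leq_trans (_ : n ^ n <= _)%N; first by rewrite leq_pexp2l.
    by rewrite leq_exp2r // ltnW // ltn_expl.
  rewrite -[X in (_ <= n ^ X)%N](prednK r0) expnS leq_mul // fact_le_exp //.
  exact: leq_trans (leq_pred _) rn.
by rewrite -!expnM mulnC leq_exp2l // leq_mul2r rn orbT.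
Qed.

End DetBound.

Section LP.
Variables (F : realFieldType) (n : nat).
Implicit Types (x y : 'rV[F]_n) (R : seq (seq int)) (k : 'I_n).

Definition sol R x := forall a, a \in R -> rv F n a *m x^T = 0.

Definition Rmx R : 'M[int]_(size R, n) := \matrix_(l, k) (nth [::] R l)`_k.

Lemma solP R x : sol R x <-> map_mx intr (Rmx R) *m x^T = 0.
Proof.
have E (l : 'I_(size R)) : row l (map_mx intr (Rmx R)) = rv F n (nth [::] R l).
  by apply/rowP => k; rewrite !mxE.
split=> [H|H a /(nthP [::])[l lt <-]].
  apply/row_matrixP => l; rewrite row_mul E row0.
  by apply: H; apply: mem_nth.
by rewrite -(E (Ordinal lt)) -row_mul H row0.
Qed.

Lemma solZ R x c : sol R x -> sol R (c *: x).
Proof. by move=> H a /H E; rewrite linearZ /= -scalemxAr E scaler0. Qed.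

Lemma solD R x y : sol R x -> sol R y -> sol R (x + y).
Proof. by move=> Hx Hy a Ha; rewrite linearD /= mulmxDr Hx // Hy // addr0. Qed.

Definition spp x : {set 'I_n} := [set k | x 0 k != 0].

(** Transposed: its rows are the columns of the system indexed by [J], so [row_free] says that these
    columns are independent. *)
Definition Jmx R (J : {set 'I_n}) : 'M[F]_(#|J|, size R) :=
  \matrix_(j, l) ((nth [::] R l)`_(enum_val j : 'I_n))%:~R.

(** The vertex argument of linear programming: while the support columns other than [k0] are
    dependent, move along a dependency until a coordinate vanishes. Since [k0] is left out of the
    dependency, its entry never changes. *)
Lemma min_support R x k0 : sol R x -> (forall k, 0 <= x 0 k) -> 0 < x 0 k0 ->
  exists x', [/\ sol R x', forall k, 0 <= x' 0 k, 0 < x' 0 k0 &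
   row_free (Jmx R (spp x' :\ k0))].
Proof.
move: {2}#|spp x| (leqnn #|spp x|) => N; elim: N x => [|N IH] x le Sx x0 xk.
  exfalso; move: le; rewrite leqn0 cards_eq0 => /eqP E.
  have : k0 \in spp x by rewrite inE gt_eqF.
  by rewrite E inE.
pose J := spp x :\ k0.
pose g (j : 'I_#|J|) : 'I_n := enum_val j.
pose B := Jmx R J.
pose ext (w : 'rV[F]_#|J|) : 'rV[F]_n :=
  \row_k (if insub k : option {k | k \in J} is Some u then w 0 (enum_rank_in (valP u) k) else 0).
have extg w j : ext w 0 (g j) = w 0 j.
  rewrite mxE insubT ?enum_valP // => h /=.
  by congr (w 0 _); apply: enum_valK_in.
have extN w k : k \notin J -> ext w 0 k = 0.
  by move=> h; rewrite mxE; case: insubP => // u uJ; rewrite uJ in h.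
have sumJ (v : 'rV[F]_n) (c : 'I_n -> F) : spp v \subset J ->
    \sum_k c k * v 0 k = \sum_j c (g j) * v 0 (g j).
  move=> sv; rewrite (bigID (mem J)) /= [X in _ + X]big1 ?addr0 => [|k kJ]; last first.
    have : k \notin spp v by apply: contraNN kJ => /(subsetP sv).
    by rewrite inE negbK => /eqP ->; rewrite mulr0.
  by rewrite big_enum_val.
have solJ (v : 'rV[F]_n) : spp v \subset J ->
    (\row_j v 0 (g j)) *m B = 0 <-> sol R v.
  move=> sv.
  have E (l : 'I_(size R)) : ((\row_j v 0 (g j)) *m B) 0 l = (map_mx intr (Rmx R) *m v^T) l 0.
    rewrite !mxE [RHS](eq_bigr (fun k => ((nth [::] R l)`_k)%:~R * v 0 k)); last first.
      by move=> k _; rewrite !mxE.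
    rewrite (sumJ v (fun k => ((nth [::] R l)`_k)%:~R) sv).
    by apply: eq_bigr => j _; rewrite !mxE mulrC.
  rewrite solP; split=> H; [apply/colP => l|apply/rowP => l]; first by rewrite -E H !mxE.
  by rewrite E H !mxE.
have [fB|nfB] := boolP (row_free B).
  by exists x.
have [w wB wn0] : exists2 w : 'rV[F]_#|J|, w *m B = 0 & w != 0.
  have : kermx B != 0 by rewrite kermx_eq0.
  case/rowV0Pn=> w /sub_kermxP wB wn0; by exists w.
pose v0 := ext w.
have sv0 : spp v0 \subset J.
  by apply/subsetP => k; rewrite inE; apply: contraNT => /extN ->.
have Sv0 : sol R v0.
  apply/(solJ _ sv0); rewrite -[RHS]wB; congr (_ *m _).
  by apply/rowP => j; rewrite mxE extg.
have [j0 wj0] : exists j, w 0 j != 0.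
  by apply/existsP; apply: contraNT wn0; rewrite negb_exists => /forallP h;
    apply/eqP/rowP => j; rewrite mxE; apply/eqP; move: (h j); rewrite negbK.
have [v [Sv sv [k1 vk1]]] : exists v, [/\ sol R v, spp v \subset J & exists k1, v 0 k1 < 0].
  have [lt|gt|E] := ltgtP (w 0 j0) 0; last by rewrite E eqxx in wj0.
    by exists v0; split=> //; exists (g j0); rewrite extg.
  exists (- v0); split.
  - by rewrite -scaleN1r; apply: solZ.
  - by apply: subset_trans sv0; apply/subsetP => k; rewrite !inE mxE oppr_eq0.
  - by exists (g j0); rewrite mxE extg oppr_lt0.
(* Ratio test: [k2] is a coordinate that reaches zero first when moving along [v]. *)
have [k2 vk2 k2min] := arg_minP (P := fun k => v 0 k < 0) (fun k => x 0 k / - v 0 k) vk1.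
set t := x 0 k2 / - v 0 k2 in k2min.
have t0 : 0 <= t by rewrite divr_ge0 // oppr_ge0 ltW.
have xge k : 0 <= (x + t *: v) 0 k.
  rewrite !mxE; have [lt|ge] := ltP (v 0 k) 0; last by rewrite addr_ge0 // mulr_ge0.
  have := k2min k lt; rewrite ler_pdivlMr ?oppr_gt0 // mulrN.
  by rewrite -subr_ge0 opprK.
have vk0 : v 0 k0 = 0.
  have : k0 \notin spp v by apply/negP => /(subsetP sv); rewrite !inE eqxx.
  by rewrite inE negbK => /eqP.
apply: (IH (x + t *: v)) => //.
- rewrite -ltnS; apply: leq_trans le; apply: proper_card; apply/properP; split.
    apply/subsetP => k; rewrite !inE !mxE; apply: contraNN => /eqP xk0.
    have : k \notin spp v.
      by apply/negP => /(subsetP sv); rewrite !inE xk0 eqxx andbF.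
    by rewrite inE negbK => /eqP ->; rewrite xk0 mulr0 addr0.
  have vn0 : - v 0 k2 != 0 by rewrite oppr_eq0 lt_eqF.
  exists k2.
    have : k2 \in J by apply: (subsetP sv); rewrite inE lt_eqF.
    by rewrite inE => /andP[].
  by rewrite inE negbK !mxE /t -[X in _ + _ * X]opprK mulrN divfK // subrr.
- by apply: solD => //; apply: solZ.
- by rewrite !mxE vk0 mulr0 addr0.
Qed.

End LP.

Lemma sumn_ge (s : seq nat) x : x \in s -> (x <= sumn s)%N.
Proof. by elim: s => //= y s IH; rewrite inE => /predU1P[->|/IH]; lia. Qed.

Section LP2.
Variables (F : realFieldType) (n : nat).
Implicit Types (x y : 'rV[F]_n) (R : seq (seq int)) (k : 'I_n).

Lemma entry_bound R l k :
  `|(nth [::] R l)`_k| <= (2 ^ sumn [seq sumn [seq zbits z | z <- a] | a <- R])%:Z.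
Proof.
set z := _`_k; have [->|z0] := eqVneq z 0; first by rewrite normr0.
have lk : (k < size (nth [::] R l))%N.
  by rewrite ltnNge; apply: contraNN z0 => h; rewrite /z nth_default.
have ll : (l < size R)%N.
  by rewrite ltnNge; apply: contraTN lk => h; rewrite (nth_default [::] h).
rewrite -abszE lez_nat; apply: leq_trans (ltnW (zbits_lt z)) _; rewrite leq_exp2l //.
apply: leq_trans (sumn_ge _) (sumn_ge _); last first.
  by apply/mapP; exists (nth [::] R l) => //; apply: mem_nth.
by apply: map_f; apply: mem_nth.
Qed.

(** Normalise a minimal-support solution to 1 at [k0]. Its other nonzero entries solve an invertible
    square integer system, so Cramer's rule bounds them by [2 ^ capof n R]; dividing by this bound
    gives [u]. *)
Lemma sol_bound R x k0 : sol R x -> (forall k, 0 <= x 0 k) -> 0 < x 0 k0 ->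
  exists u : 'rV[F]_n, [/\ sol R u, forall k, 0 <= u 0 k <= 1 & 1 <= u 0 k0 * 2 ^+ capof n R].
Proof.
move=> Sx x0 xk; have [x1 [S1 x10 x1k fJ]] := min_support Sx x0 xk.
pose u := (x1 0 k0)^-1 *: x1.
have uk0 : u 0 k0 = 1 by rewrite mxE mulVf // gt_eqF.
have u0 k : 0 <= u 0 k by rewrite mxE mulr_ge0 // invr_ge0 ltW.
have Su : sol R u by apply: solZ.
set J := spp x1 :\ k0 in fJ.
pose g (j : 'I_#|J|) : 'I_n := enum_val j.
have uN k : k != k0 -> k \notin J -> u 0 k = 0.
  by rewrite !inE => -> /=; rewrite negbK => /eqP E; rewrite mxE E mulr0.
clearbody u.
have rn : (#|J| <= n)%N by rewrite -[n in (_ <= n)%N]card_ord max_card.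
have fB : row_full (Jmx F R J)^T by rewrite /row_full mxrank_tr.
pose f := fullrankfun fB.
pose Bz : 'M[int]_#|J| := \matrix_(i, j) (nth [::] R (f i))`_(g j).
pose cz : 'cV[int]_#|J| := \col_i (nth [::] R (f i))`_k0.
have EB : rowsub f (Jmx F R J)^T = map_mx intr Bz by apply/matrixP => i j; rewrite !mxE.
have uB : map_mx (intr : int -> F) Bz \in unitmx by rewrite -EB fullrowsub_unit.
pose uJ : 'cV[F]_#|J| := \col_j u 0 (g j).
have eqJ : map_mx intr Bz *m uJ = - map_mx intr cz.
  apply/colP => i; have /solP/colP/(_ (f i)) := Su; rewrite !mxE (bigD1 k0) //= !mxE uk0 mulr1.
  rewrite (bigID (mem J)) /= [X in _ + (_ + X)]big1 ?addr0 => [|k /andP[h1 h2]]; last first.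
    by rewrite !mxE uN // mulr0.
  rewrite addrC => /eqP; rewrite addr_eq0 => /eqP <-.
  rewrite (eq_bigl (mem J)) => [|k]; last by rewrite !inE; case: eqP.
  by rewrite [RHS]big_enum_val; apply: eq_bigr => j _; rewrite !mxE.
have dn0 : \det Bz != 0.
  by move: uB; rewrite unitmxE unitfE det_map_mx intr_eq0.
have eqD : (\det Bz)%:~R *: uJ = - map_mx intr (\adj Bz *m cz).
  rewrite map_mxM map_mx_adj -mulmxN -eqJ mulmxA mul_adj_mx det_map_mx.
  by rewrite mul_scalar_mx.
have bJ j : u 0 (g j) <= 2 ^+ capof n R.
  have /colP/(_ j) := eqD; rewrite 4!mxE => E.
  have hB i l : `|Bz i l| <= (2 ^ sumn [seq sumn [seq zbits z | z <- a] | a <- R])%:Z.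
    by rewrite mxE entry_bound.
  have hc i : `|cz i 0| <= (2 ^ sumn [seq sumn [seq zbits z | z <- a] | a <- R])%:Z.
    by rewrite mxE entry_bound.
  have := adj_bound j rn hB hc; rewrite -/(capof n R) => h.
  have d1 : 1 <= `|(\det Bz)%:~R| :> F.
    by rewrite -intr_norm ler1z; move: dn0; case: (\det Bz) => [[]|].
  apply: le_trans (_ : `|(\det Bz)%:~R * u 0 (g j)| <= _).
    by rewrite normrM (ger0_norm (u0 _)) ler_peMl.
  rewrite E normrN -intr_norm; move: h; rewrite -(ler_int F) => /le_trans -> //.
  by rewrite -pmulrn natrX.
pose H : F := 2 ^+ capof n R.
have H0 : 0 < H by rewrite exprn_gt0.
have H1 : 1 <= H by rewrite exprn_ege1 // ler1n.
exists (H^-1 *: u); split.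
- exact: solZ.
- move=> k; rewrite mxE mulr_ge0 ?invr_ge0 ?(ltW H0) //= mulrC ler_pdivrMr // mul1r.
  have [->|kk0] := eqVneq k k0; first by rewrite uk0.
  have [kJ|/(uN k kk0) ->] := boolP (k \in J); last exact: ltW.
  by rewrite -[k](enum_rankK_in kJ kJ) -/(g _) bJ.
- by rewrite mxE uk0 mulr1 mulVf // gt_eqF.
Qed.

Lemma rowsmx_orth l x : (forall a, a \in l -> rv F n a *m x^T = 0) -> rowsmx F n l *m x^T = 0.
Proof.
move=> H; apply/sub_kermxP; rewrite /rowsmx big_seq.
elim/big_ind: _ => [|A B hA hB|a /H h]; first exact: sub0mx.
  by rewrite addsmx_sub hA.
by rewrite genmxE; apply/sub_kermxP.
Qed.

Lemma mem_rowsmx l a : a \in l -> (rv F n a <= rowsmx F n l)%MS.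
Proof.
elim: l => // b l IH; rewrite inE /rowsmx big_cons => /predU1P[->|/IH h].
  by apply: submx_trans (addsmxSl _ _); rewrite genmxE.
exact: submx_trans h (addsmxSr _ _).
Qed.

Lemma pmx_fix l x : (forall a, a \in l -> rv F n a *m x^T = 0) -> x *m pmx F n l = x.
Proof.
move=> H; have [_ _ Ps _ [_ /submxP[X EX] _]] := proj_spec F n l.
have : (1%:M - pmx F n l) *m x^T = 0 by rewrite EX -mulmxA rowsmx_orth // mulmx0.
rewrite mulmxBl mul1mx => /eqP; rewrite subr_eq0 => /eqP E.
by rewrite -[RHS]trmxK E trmx_mul trmxK Ps.
Qed.

Lemma pmx_row0 l a x : a \in l -> rv F n a *m (x *m pmx F n l)^T = 0.
Proof.
move=> /mem_rowsmx /submxP[X ->]; have [_ _ Ps _ [E0 _ _]] := proj_spec F n l.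
by rewrite trmx_mul Ps mulmxA -(mulmxA X) E0 mulmx0 mul0mx.
Qed.

Lemma cauchy_schwarz (u v : 'rV[F]_n) :
  ((u *m v^T) 0 0) ^+ 2 <= (u *m u^T) 0 0 * (v *m v^T) 0 0.
Proof.
have := normsq_ge0 ((v *m v^T) 0 0 *: u - (u *m v^T) 0 0 *: v).
have vu : (v *m u^T) 0 0 = (u *m v^T) 0 0 by rewrite -[v *m u^T]trmxK trmx_mul trmxK mxE.
set a := (u *m u^T) 0 0; set b := (v *m v^T) 0 0; set c := (u *m v^T) 0 0.
have -> : ((b *: u - c *: v) *m (b *: u - c *: v)^T) 0 0 = b * (a * b - c ^+ 2).
  have -> : (b *: u - c *: v)^T = b *: u^T - c *: v^T by rewrite linearB /= !linearZ.
  have E1 (A B : 'M[F]_1) : (A - B) 0 0 = A 0 0 - B 0 0 by rewrite !mxE.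
  have E2 (t : F) (A : 'M[F]_1) : (t *: A) 0 0 = t * A 0 0 by rewrite mxE.
  rewrite mulmxBl !mulmxBr -!scalemxAl -!scalemxAr !(E1, E2) vu -/a -/b -/c.
  by ring.
have [b0|b0] := eqVneq b 0.
  by move=> _; rewrite /c (normsq_eq0 b0) trmx0 mulmx0 mxE expr0n /= mulr_ge0 ?normsq_ge0.
by rewrite pmulr_rge0 ?subr_ge0 // lt_neqAle eq_sym b0 normsq_ge0.
Qed.

End LP2.

Lemma mem_mkseqP (T : eqType) (f : nat -> T) m a :
  a \in mkseq f m -> exists2 i, (i < m)%N & a = f i.
Proof. by case/mapP=> i; rewrite mem_iota add0n => lt ->; exists i. Qed.

Lemma mkseq_mem (T : eqType) (f : nat -> T) m i : (i < m)%N -> f i \in mkseq f m.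
Proof. by move=> lt; apply: map_f; rewrite mem_iota. Qed.

Lemma proj_contract (F : realFieldType) n (P : 'M[F]_n) (x : 'rV[F]_n) :
  P^T = P -> P *m P = P -> (x *m P *m x^T) 0 0 <= (x *m x^T) 0 0.
Proof.
move=> Ps PP; rewrite -subr_ge0.
have h1 : x *m (x *m P)^T = x *m P *m x^T by rewrite trmx_mul Ps mulmxA.
have h2 : x *m P *m (x *m P)^T = x *m P *m x^T.
  by rewrite trmx_mul Ps mulmxA -(mulmxA x) PP.
have E1 (A B : 'M[F]_1) : (A - B) 0 0 = A 0 0 - B 0 0 by rewrite !mxE.
have := normsq_ge0 (x - x *m P).
have -> : (x - x *m P)^T = x^T - (x *m P)^T by rewrite linearB.
by rewrite mulmxBl !mulmxBr h1 h2 subrr subr0 E1.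
Qed.

Lemma sumn_nth (s : seq nat) n : size s = n -> sumn s = (\sum_(k < n) nth 0 s k)%N.
Proof. by move=> <-; rewrite sumnE (big_nth 0%N) big_mkord. Qed.

(** * The rescaled perceptron *)

Section LP3.
Variables (F : realFieldType) (n cap : nat) (R : seq (seq int)).

Definition kept (s : seq nat) (k : nat) := (nth 0%N s k <= cap)%N.

Section State.
Variable s : seq nat.
Let l := lprows n cap R s.
Let Q := lpQ n cap R s.
Let P := pmx F n l.
Let dd := (proj n l).1.2.

Lemma rv_mulv y : rv F n (mulv n Q y) = dd%:~R *: (rv F n y *m P).
Proof.
have [d0 E Ps _ _] := proj_spec F n l.
have := congr1 (map_mx intr) (mulvE n Q y) => /(_ F).
rewrite map_mxM -!map_trmx -/(rv F n _) -/(rv F n _) E -/P -/dd => h.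
by rewrite -[LHS]trmxK h trmx_mul trmxK linearZ /= Ps scalemxAr.
Qed.

Lemma dd_gt0 : 0 < dd%:~R :> F.
Proof. by have [d0 _ _ _ _] := proj_spec F n l; rewrite ltr0z. Qed.

Lemma badk_lt z : (badk n cap s z < n)%N ->
  kept s (badk n cap s z) /\ z`_(badk n cap s z) <= 0.
Proof.
move=> lt; have h : has (fun k => kept s k && (z`_k <= 0)) (iota 0 n).
  by rewrite has_find size_iota.
have := nth_find 0 h; rewrite nth_iota ?add0n; first by case/andP.
exact: lt.
Qed.

Lemma badk_le z : (badk n cap s z <= n)%N.
Proof. by have := find_size (fun k => kept s k && (z`_k <= 0)) (iota 0 n); rewrite size_iota. Qed.

Lemma badk_eq z k : badk n cap s z = n -> (k < n)%N -> kept s k -> 0 < z`_k.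
Proof.
move=> E lt Kk; have : (k < badk n cap s z)%N by rewrite E.
move/(before_find 0); rewrite nth_iota ?add0n // -/(kept s k) Kk /= => /negbT.
by rewrite -ltNge.
Qed.

(** The chosen coordinate of [P y] is nonpositive, so the cross term in [|P (y + e)|^2] does not
    increase it, and a step adds at most [|P e|^2 <= 1]. *)
Lemma perc_inv i : let y := iter i (percstep n cap s Q) (mkseq (fun _ => 0) n) in
  badk n cap s (mulv n Q y) = n \/
  [/\ \sum_(k < n) y`_k = i%:Z, forall k, 0 <= y`_k,
      forall k, ~~ kept s k -> y`_k = 0 &
      ((rv F n y *m P) *m (rv F n y *m P)^T) 0 0 <= i%:R].
Proof.
have [_ _ Ps PP _] := proj_spec F n l.
elim: i => [|i IH].
  right; rewrite /=; have E : rv F n (mkseq (fun _ => 0) n) = 0.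
    by apply/rowP => k; rewrite !mxE nth_mkseq.
  have E0 k : (mkseq (fun _ => 0 : int) n)`_k = 0.
    by case: (ltnP k n) => h; [rewrite nth_mkseq|rewrite nth_default ?size_mkseq].
  split=> [|k|k _|]; rewrite ?E0 //; first by rewrite big1.
  by rewrite E mul0mx mul0mx mxE.
have [f [Ey _]] := perc_shape n cap s Q i; move: IH; cbv zeta; rewrite iterS.
set y := iter i _ _ in Ey * => IH; set k0 := badk n cap s (mulv n Q y).
have [lt|ge] := ltnP k0 n; last first.
  have E0 : k0 = n by apply/eqP; rewrite eqn_leq badk_le.
  (* Index [n] touches no entry, so the iteration is stationary from here on. *)
  left; have -> : percstep n cap s Q y = y; last exact: E0.
  apply: (@eq_from_nth _ 0); rewrite ?Ey ?size_mkseq // => j ltj.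
  by rewrite -Ey /percstep -/k0 E0 nth_mkseq // ltn_eqF // addr0.
have [Kk0 zk0] := badk_lt lt; rewrite -/k0 in Kk0 zk0.
right; case: IH => [E0|[Es y0 yK yn]]; first by rewrite -/k0 in E0; rewrite E0 ltnn in lt.
have yE j : (percstep n cap s Q y)`_j = y`_j + (if j == k0 then 1 else 0).
  case: (ltnP j n) => ltj; first by rewrite /percstep nth_mkseq.
  rewrite !nth_default ?add0r; do ?by rewrite /percstep ?Ey size_mkseq.
  by rewrite gtn_eqF // (leq_trans lt ltj).
have rE : rv F n (percstep n cap s Q y) = rv F n y + delta_mx 0 (Ordinal lt).
  apply/rowP => j; rewrite !mxE yE rmorphD eqxx /= -val_eqE /=.
  by case: eqP.
split.
- under eq_bigr do rewrite yE.
  rewrite big_split /= Es (bigD1 (Ordinal lt)) //= eqxx big1 ?addr0 => [|j]; first by rewrite intS addrC.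
  by rewrite -val_eqE /= => /negPf ->.
- by move=> j; rewrite yE addr_ge0 //; case: eqP.
- by move=> j hj; rewrite yE yK // add0r; case: eqP hj => // ->; rewrite Kk0.
rewrite rE; set e := delta_mx 0 (Ordinal lt); set yy := rv F n y in yn *.
have T1 : (yy *m P) *m (e *m P)^T = yy *m P *m e^T by rewrite trmx_mul Ps mulmxA -(mulmxA yy) PP.
have T2 : (e *m P) *m (yy *m P)^T = (yy *m P *m e^T)^T.
  by rewrite -T1 [RHS]trmx_mul trmxK.
have T3 : (e *m P) *m (e *m P)^T = e *m P *m e^T by rewrite trmx_mul Ps mulmxA -(mulmxA e) PP.
have zz : (yy *m P *m e^T) 0 0 <= 0.
  have -> : (yy *m P *m e^T) 0 0 = (yy *m P) 0 (Ordinal lt).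
    rewrite mxE (bigD1 (Ordinal lt)) //= big1 ?addr0 => [|j hj].
      by rewrite !mxE !eqxx mulr1.
    by rewrite !mxE (negPf hj) andbF mulr0.
  have := congr1 (fun M : 'rV[F]_n => M 0 (Ordinal lt)) (rv_mulv y).
  rewrite [LHS]mxE [RHS]mxE -/yy [X in X%:~R]mxE /= => h.
  by rewrite -(pmulr_rle0 _ dd_gt0) -h lerz0.
have pk : (e *m P *m e^T) 0 0 <= 1.
  apply: le_trans (proj_contract e Ps PP) _.
  by rewrite trmx_delta mul_delta_mx mxE !eqxx.
have -> : ((yy + e) *m P *m ((yy + e) *m P)^T) 0 0 =
   (yy *m P *m (yy *m P)^T) 0 0 + 2 * (yy *m P *m e^T) 0 0 + (e *m P *m e^T) 0 0.
  have -> : ((yy + e) *m P)^T = (yy *m P)^T + (e *m P)^T by rewrite mulmxDl linearD.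
  have E1 (A B : 'M[F]_1) : (A + B) 0 0 = A 0 0 + B 0 0 by rewrite !mxE.
  rewrite mulmxDl mulmxDl !mulmxDr T1 T2 T3 !E1 [(_^T) 0 0]mxE; ring.
rewrite -natr1; move: yn zz pk; lra.
Qed.

(** Halving column [k] repeatedly amounts to doubling unknown [k] as often; the common factor
    [2 ^ cap] only keeps the rows integral. *)
Lemma kernel_scaled (u : 'rV[F]_n) : sol R u ->
  (forall k : 'I_n, ~~ kept s k -> u 0 k = 0) ->
  forall a, a \in l -> rv F n a *m
    (\row_k (if kept s k then u 0 k * 2 ^+ nth 0%N s k else 0))^T = 0.
Proof.
move=> Su u0 a; rewrite /l /lprows mem_cat => /orP[/mapP[b bR ->]|/mem_mkseqP[i lti ->]];
  apply/rowP => z; rewrite ord1 !mxE.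
  have := Su b bR => /rowP/(_ 0); rewrite !mxE => E.
  rewrite (eq_bigr (fun k : 'I_n => 2 ^+ cap * (rv F n b 0 k * u^T k 0))) => [|k _].
    by rewrite -mulr_sumr E mulr0.
  rewrite !mxE nth_mkseq // -/(kept s k); case: ifP => hk; last by rewrite u0 ?hk // !mulr0.
  rewrite /shl rmorphM rmorphXn /= -(subnK hk) exprD addnK; ring.
rewrite big1 // => k _; rewrite !mxE nth_mkseq //.
case: eqP => [->|_]; last by rewrite mul0r.
by rewrite /kept ltnNge; case: (_ <= cap)%N; rewrite /= ?mulr0 ?mul0r.
Qed.

(** The rescaled solution [x'] lies in the unit box and satisfies [x' P = x']. Hence
    [4 n^2 x'_k0 <= <y, x'> = <y P, x'>], and by Cauchy-Schwarz this is at most the root of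
    [4 n^3 * n], that is [2 n^2]. So [x'_k0 <= 1/2], which is room for one more doubling. *)
Lemma lp_cut k0 : let y := percy n cap s Q in
  badk n cap s (mulv n Q y) != n ->
  k0 = find (fun k => (Posz (4 * (n * n)) <= y`_k)) (iota 0 n) ->
  exists2 lt : (k0 < n)%N, kept s k0 &
  forall u : 'rV[F]_n, sol R u -> (forall k, 0 <= u 0 k) ->
   (forall k : 'I_n, if kept s k then u 0 k * 2 ^+ nth 0%N s k <= 1 else u 0 k == 0) ->
   u 0 (Ordinal lt) * 2 ^+ (nth 0%N s k0).+1 <= 1.
Proof.
cbv zeta; set y := percy n cap s Q => nd Ek.
have n0 : (0 < n)%N by move: nd; have := badk_le (mulv n Q y); case: (n) => //; case: badk.
have := perc_inv (4 * (n * n * n)); cbv zeta; rewrite -/(percy n cap s Q) -/y => -[E|[Es y0 yK yn]]; first by rewrite E eqxx in nd.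
have lt : (k0 < n)%N.
  have : has (fun k => (Posz (4 * (n * n)) <= y`_k)) (iota 0 n).
    apply/negPn/negP => /hasPn h.
    have : \sum_(k < n) y`_k <= \sum_(k < n) ((4 * (n * n))%:Z - 1).
      apply: ler_sum => k _; have := h k; rewrite mem_iota ltn_ord => /(_ isT); lia.
    rewrite Es sumr_const card_ord -mulr_natl; nia.
  by rewrite has_find size_iota -Ek.
have yk : Posz (4 * (n * n)) <= y`_k0.
  have h : has (fun k => (Posz (4 * (n * n)) <= y`_k)) (iota 0 n).
    by rewrite has_find size_iota -Ek.
  by have := nth_find 0 h; rewrite -Ek nth_iota.
have Kk : kept s k0.
  by apply/negPn/negP => /yK E; move: yk; rewrite E; nia.
exists lt => // u Su u0 uK.
pose x' : 'rV[F]_n := \row_k (if kept s k then u 0 k * 2 ^+ nth 0%N s k else 0).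
have x'P : x' *m P = x'.
  apply: pmx_fix => a Ha; apply: kernel_scaled => // k /negPf hk.
  by have := uK k; rewrite hk => /eqP.
have [_ _ Ps _ _] := proj_spec F n l.
have x'b k : 0 <= x' 0 k <= 1.
  rewrite mxE; have := uK k; case: ifP => // _ h; last by rewrite lexx ler01.
  by rewrite h mulr_ge0 // exprn_ge0.
set yy := rv F n y in yn.
have yx : (yy *m x'^T) 0 0 = ((yy *m P) *m x'^T) 0 0.
  by rewrite -{1}x'P trmx_mul Ps mulmxA.
have x'n : (x' *m x'^T) 0 0 <= n%:R.
  rewrite mxE; apply: le_trans (_ : \sum_(k < n) 1 <= _); last first.
    by rewrite sumr_const card_ord.
  apply: ler_sum => k _; rewrite [x'^T _ _]mxE; have /andP[h0 h1] := x'b k.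
  by rewrite -expr2 expr_le1.
have cs := cauchy_schwarz (yy *m P) x'.
rewrite -yx in cs.
have yxge : (y`_k0)%:~R * x' 0 (Ordinal lt) <= (yy *m x'^T) 0 0.
  have yyE k : yy 0 k = (y`_k)%:~R by rewrite !mxE.
  have xT k : x'^T k 0 = x' 0 k by rewrite mxE.
  rewrite [X in _ <= X]mxE (bigD1 (Ordinal lt)) //= yyE xT lerDl sumr_ge0 // => k _.
  by rewrite yyE xT mulr_ge0 ?ler0z //; case/andP: (x'b k).
have /andP[g0 _] := x'b (Ordinal lt).
have ykF : 4 * (n%:R * n%:R) <= (y`_k0)%:~R :> F.
  by move: yk; rewrite -(ler_int F) => /(le_trans _) -> //; rewrite -pmulrn !natrM.
have nF : 1 <= n%:R :> F by rewrite ler1n.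
have T4 : ((4 * (n * n * n))%:R : F) = 4 * (n%:R * n%:R * n%:R) by rewrite !natrM.
rewrite T4 in yn.
have gg : u 0 (Ordinal lt) * 2 ^+ (nth 0%N s k0).+1 = 2 * x' 0 (Ordinal lt).
  by rewrite mxE Kk exprS; ring.
rewrite gg; move: cs x'n yxge g0 ykF nF yn (normsq_ge0 x') (normsq_ge0 (yy *m P)).
move: (x' 0 _) ((yy *m x'^T) 0 0) ((x' *m x'^T) 0 0) ((y`_k0)%:~R) (n%:R)
   ((yy *m P *m (yy *m P)^T) 0 0) => g c x2 Y N p2 cs x2N yg g0 YN N1 pN x20 p20.
have c1 : c ^+ 2 <= 4 * N ^+ 4.
  apply: le_trans cs _; apply: le_trans (ler_pM p20 x20 pN x2N) _.
  by rewrite le_eqVlt; apply/orP; left; apply/eqP; ring.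
have N0 : 0 <= N by lra.
have c2 : 4 * (N * N) * g <= c by apply: le_trans yg; apply: ler_wpM2r.
have c3 : (4 * (N * N) * g) ^+ 2 <= 4 * N ^+ 4.
  apply: le_trans c1; rewrite ler_pXn2r ?nnegrE //; last by apply: le_trans c2; rewrite !mulr_ge0.
  by rewrite !mulr_ge0.
rewrite leNgt; apply/negP => gt.
have g1 : 1 < (2 * g) ^+ 2 by rewrite expr_gt1 //; lra.
have : 4 * N ^+ 4 * 1 < 4 * N ^+ 4 * (2 * g) ^+ 2.
  by rewrite ltr_pM2l // mulr_gt0 // exprn_gt0 //; lra.
have -> : 4 * N ^+ 4 * (2 * g) ^+ 2 = (4 * (N * N) * g) ^+ 2 by ring.
by rewrite mulr1 ltNge c3.
Qed.

(** The projected vector is orthogonal to every scaled row of [R], so undoing the scaling on the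
    kept columns solves the system; positivity there is what [badk = n] expresses. *)
Lemma lp_done : let y := percy n cap s Q in badk n cap s (mulv n Q y) = n ->
  exists2 lam : 'rV[F]_n, sol R lam &
  forall k : 'I_n, if kept s k then 0 < lam 0 k else lam 0 k == 0.
Proof.
cbv zeta; set y := percy n cap s Q => E.
pose z := mulv n Q y.
exists (\row_k (if kept s k then 2 ^+ (cap - nth 0%N s k) * (z`_k)%:~R else 0)); last first.
  move=> k; rewrite mxE; case hk: (kept s k); last by rewrite eqxx.
  by rewrite mulr_gt0 ?exprn_gt0 // ltr0z (badk_eq E).
move=> a aR.
pose a' := mkseq (fun k => if (nth 0%N s k <= cap)%N then shl a`_k (cap - nth 0%N s k) else 0) n.
have Ha' : a' \in l.
  by rewrite /l /lprows mem_cat; apply/orP; left; apply/mapP; exists a.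
have := pmx_row0 (rv F n y) Ha' => /(congr1 (fun M => dd%:~R *: M)).
rewrite scaler0 scalemxAr -linearZ /= -rv_mulv -/z => H.
rewrite -[RHS]H; apply/rowP => i; rewrite !mxE; apply: eq_bigr => k _.
have Ea : a'`_k = if kept s k then shl a`_k (cap - nth 0%N s k) else 0 by rewrite nth_mkseq.
rewrite !mxE Ea; case: (kept s k); last by rewrite mulr0 mul0r.
by rewrite /shl rmorphM rmorphXn /=; ring.
Qed.

End State.

Definition lpinv (s : seq nat) := forall u : 'rV[F]_n, sol R u ->
  (forall k, 0 <= u 0 k <= 1) ->
  forall k : 'I_n, if kept s k then u 0 k * 2 ^+ nth 0%N s k <= 1 else u 0 k == 0.

(** Progress is measured by [sumn s], which grows at each pass until the perceptron succeeds. *)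
Lemma lp_iter i : cap = capof n R ->
  let s := iter i (lpstep n cap R) (mkseq (fun _ => 0%N) n) in
  [/\ lpinv s, forall k, (nth 0%N s k <= cap.+1)%N, size s = n &
   badk n cap s (mulv n (lpQ n cap R s) (percy n cap s (lpQ n cap R s))) = n \/
   (i <= sumn s)%N].
Proof.
move=> Ecap; elim: i => [|i]; first split.
- move=> u _ ub k; rewrite /kept nth_mkseq //= expr0 mulr1; by case/andP: (ub k).
- by move=> k; case: (ltnP k n) => h; [rewrite nth_mkseq|rewrite nth_default ?size_mkseq].
- by rewrite size_mkseq.
- by right.
cbv zeta; rewrite iterS; set s := iter i _ _; case=> inv sc sz D.
rewrite /lpstep; set Q := lpQ n cap R s; set y := percy n cap s Q; rewrite -/Q -/y in D.
case: eqP => [E|/eqP nd]; first by split=> //; left.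
case: D => [E|D]; first by rewrite E eqxx in nd.
set k0 := find _ _; have [lt Kk cut] := lp_cut nd (erefl k0).
set s' := mkseq _ n.
have s'E j : nth 0%N s' j = (nth 0 s j + (if j == k0 then 1 else 0))%N.
  case: (ltnP j n) => h; first by rewrite nth_mkseq.
  by rewrite !nth_default ?size_mkseq ?sz // gtn_eqF // (leq_trans lt h).
split.
- move=> u Su ub k; have := inv u Su ub k; rewrite /kept s'E.
  case: (eqVneq (k : nat) k0) => [ek|_]; last by rewrite addn0.
  have -> : k = Ordinal lt by apply: val_inj.
  rewrite /= -/(kept s k0) Kk addn1 => _.
  have := cut u Su (fun k => proj1 (andP (ub k))) (inv u Su ub) => h.
  case: ifP => // hc; apply/negPn/negP => un0.
  have u0 : 0 < u 0 (Ordinal lt) by rewrite lt_neqAle eq_sym un0; case/andP: (ub (Ordinal lt)).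
  have [v [Sv vb vk]] := sol_bound Su (fun k => proj1 (andP (ub k))) u0.
  have h2 := cut v Sv (fun k => proj1 (andP (vb k))) (inv v Sv vb).
  (* The column is discarded at this very pass, so its counter stood exactly at [cap]. The cut would
     bound the entry of [v] by [2 ^- cap.+1], against the lower bound from [sol_bound]. *)
  have sk : nth 0%N s k0 = cap by move: Kk hc; rewrite /kept; lia.
  move: h2; rewrite sk exprS mulrCA Ecap leNgt => /negP; apply.
  apply: lt_le_trans (_ : 2 * 1 <= _); first by rewrite mulr1 ltr1n.
  by rewrite ler_pM2l.
- move=> k; rewrite s'E; case: eqP => [->|_]; last by rewrite addn0.
  by rewrite addn1 ltnS.
- by rewrite size_mkseq.
right; apply: leq_ltn_trans D _.
rewrite (sumn_nth sz) (sumn_nth (size_mkseq _ _)).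
rewrite [X in (X < _)%N](bigD1 (Ordinal lt)) //= [X in (_ < X)%N](bigD1 (Ordinal lt)) //=.
rewrite s'E eqxx addn1 addSn ltnS.
by rewrite leq_add2l; apply: leq_sum => j _; rewrite s'E leq_addr.
Qed.

End LP3.

Theorem supp_spec (F : realFieldType) n R : let K := fun k => nth false (supp n R) k in
  (exists2 lam : 'rV[F]_n, sol R lam & forall k : 'I_n, if K k then 0 < lam 0 k else lam 0 k == 0) /\
  (forall x : 'rV[F]_n, sol R x -> (forall k, 0 <= x 0 k) -> forall k : 'I_n, ~~ K k -> x 0 k = 0).
Proof.
move=> K; set cap := capof n R.
have [inv sc sz D] := lp_iter F (n * cap.+1) (erefl (capof n R)); rewrite -/cap -/(lp n cap R) in inv sc sz D.
set s := lp n cap R in inv sc sz D.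
have KE (k : 'I_n) : K k = kept cap s k by rewrite /K /supp nth_mkseq.
have done : badk n cap s (mulv n (lpQ n cap R s) (percy n cap s (lpQ n cap R s))) = n.
  (* A kept bad column has counter at most [cap] and all others at most [cap + 1], so their sum
     would fall short of the number of passes. *)
  case: D => // le; apply/eqP; rewrite eqn_leq badk_le leqNgt; apply/negP => ltk.
  have [hk _] := badk_lt ltk; move: (badk _ _ _ _) ltk hk => k ltk; rewrite /kept leqNgt => /negP; apply.
  rewrite ltnNge; apply/negP => lek.
  move: le; rewrite (sumn_nth sz) leqNgt => /negP; apply.
  rewrite (bigD1 (Ordinal ltk)) //= -addSn.
  have -> : (n * cap.+1 = cap.+1 + \sum_(i < n | i != Ordinal ltk) cap.+1)%N.
    by have := sum_nat_const_nat 0 n cap.+1; rewrite subn0 big_mkord (bigD1 (Ordinal ltk)) //= => <-.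
  by apply: leq_add => //; apply: leq_sum.
split.
  have [lam S1 S2] := lp_done F done; exists lam => // k.
  by rewrite KE.
move=> x Sx x0 k; rewrite KE => nk.
pose c : F := 1 + \sum_j x 0 j.
have c0 : 0 < c by rewrite ltr_pwDl // sumr_ge0.
have := inv (c^-1 *: x) (solZ _ Sx) _ k; rewrite (negPf nk) mxE => H.
have : c^-1 * x 0 k == 0.
  apply: H => j; rewrite mxE mulr_ge0 ?invr_ge0 ?(ltW c0) //= mulrC ler_pdivrMr // mul1r.
  by rewrite /c (bigD1 j) //= addrCA lerDl addr_ge0 // sumr_ge0.
by rewrite mulf_eq0 invr_eq0 gt_eqF //= => /eqP.
Qed.

(** * Rigidity of the supported vertices *)

Section Dot.
Variable F : realFieldType.

(** A trace, so that bilinearity is inherited from matrix products and the form [T] in [energy] has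
    the same shape. *)
Definition dp d (u v : 'rV[F]_d) : F := \tr (v^T *m u).

Lemma dpE d (u v : 'rV[F]_d) : dp u v = \sum_k u 0 k * v 0 k.
Proof.
rewrite /dp /mxtrace; apply: eq_bigr => k _.
by rewrite mxE big_ord1 !mxE mulrC.
Qed.

Lemma dpC d (u v : 'rV[F]_d) : dp u v = dp v u.
Proof. by rewrite !dpE; apply: eq_bigr => k _; rewrite mulrC. Qed.

Lemma dpDl d (u v w : 'rV[F]_d) : dp (u + v) w = dp u w + dp v w.
Proof. by rewrite /dp mulmxDr raddfD. Qed.

Lemma dpBl d (u v w : 'rV[F]_d) : dp (u - v) w = dp u w - dp v w.
Proof. by rewrite /dp mulmxBr raddfB. Qed.

Lemma dpDr d (u v w : 'rV[F]_d) : dp w (u + v) = dp w u + dp w v.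
Proof. by rewrite dpC dpDl !(dpC w). Qed.

Lemma dpBr d (u v w : 'rV[F]_d) : dp w (u - v) = dp w u - dp w v.
Proof. by rewrite dpC dpBl !(dpC w). Qed.

Lemma dpZl d c (u v : 'rV[F]_d) : dp (c *: u) v = c * dp u v.
Proof. by rewrite /dp -scalemxAr mxtraceZ. Qed.

Lemma dpZr d c (u v : 'rV[F]_d) : dp u (c *: v) = c * dp u v.
Proof. by rewrite dpC dpZl dpC. Qed.

Lemma dp0l d (v : 'rV[F]_d) : dp 0 v = 0.
Proof. by rewrite /dp mulmx0 mxtrace0. Qed.

Lemma dp_suml d (I : finType) (P : pred I) (u : I -> 'rV[F]_d) v :
  dp (\sum_(i | P i) u i) v = \sum_(i | P i) dp (u i) v.
Proof. by rewrite /dp mulmx_sumr raddf_sum. Qed.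

Lemma dp_sumr d (I : finType) (P : pred I) (u : I -> 'rV[F]_d) v :
  dp v (\sum_(i | P i) u i) = \sum_(i | P i) dp v (u i).
Proof. by rewrite dpC dp_suml; apply: eq_bigr => i _; rewrite dpC. Qed.

Lemma dp_mx d (u v : 'rV[F]_d) : (u *m v^T) 0 0 = dp u v.
Proof. by rewrite mxE dpE; apply: eq_bigr => k _; rewrite mxE. Qed.

Lemma dp_ge0 d (u : 'rV[F]_d) : 0 <= dp u u.
Proof. by rewrite -dp_mx normsq_ge0. Qed.

Lemma dp_eq0 d (u : 'rV[F]_d) : dp u u = 0 -> u = 0.
Proof. by rewrite -dp_mx => /normsq_eq0. Qed.

Lemma dp_row d1 d2 (a b : 'rV[F]_d1) (a' b' : 'rV[F]_d2) :
  dp (row_mx a a') (row_mx b b') = dp a b + dp a' b'.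
Proof.
rewrite !dpE big_split_ord /=; congr (_ + _); apply: eq_bigr => k _.
  by rewrite !row_mxEl.
by rewrite !row_mxEr.
Qed.

Lemma sqdistE d (u v : 'rV[F]_d) : sqdist u v = dp (u - v) (u - v).
Proof. by rewrite /sqdist dpE; apply: eq_bigr => k _; rewrite !mxE expr2. Qed.

Lemma sqdistD d (u v : 'rV[F]_d) : sqdist u v = dp u u - 2 * dp u v + dp v v.
Proof. by rewrite sqdistE dpBl !dpBr (dpC v u); ring. Qed.

Lemma exists_proj m d (A : 'M[F]_(m, d)) : exists P : 'M[F]_d,
  [/\ P^T = P, P *m P = P, (P <= A)%MS & A *m P = A].
Proof.
have [r [B [fB EB]]] : exists r (B : 'M[F]_(r, d)), row_free B /\ (B :=: A)%MS.
  by exists (\rank A), (row_base A); split; [exact: row_base_free|exact: eq_row_base].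
have dB : \det (gram B) != 0.
  rewrite -unitfE -unitmxE -row_free_unit -kermx_eq0; apply/rowV0P => u /sub_kermxP E.
  have : dp (u *m B) (u *m B) = 0.
    by rewrite -dp_mx trmx_mul mulmxA -(mulmxA u B) -/(gram B) E mul0mx mxE.
  by move/dp_eq0; rewrite -(mul0mx _ B) => /(row_free_inj fB).
pose P := B^T *m invmx (gram B) *m B.
have Ps : P^T = P by rewrite /P !trmx_mul trmxK trmx_inv gram_sym mulmxA.
have uB := uG dB.
have BP : B *m P = B by rewrite /P !mulmxA -/(gram B) mulmxV // mul1mx.
exists P; split=> //.
- by rewrite {1}/P -mulmxA BP.
- by rewrite -EB submxMl.
- have /submxP[X EX] : (A <= B)%MS by rewrite EB.
  by rewrite EX -mulmxA BP.
Qed.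

End Dot.

Section Rigid.
Variables (F : realFieldType) (N d : nat) (x : 'I_N -> 'rV[F]_d) (cl : pred 'I_N).

Definition hat (k : 'I_N) : 'rV[F]_(1 + d) := row_mx 1%:M (x k).
Notation h := hat.

Definition equivcfg D (p : 'I_N -> 'rV[F]_D) :=
  forall k l, cl k -> ~~ cl l -> sqdist (p k) (p l) = sqdist (x k) (x l).

Definition Hm (S : pred 'I_N) : 'M[F]_(N, 1 + d) := \matrix_k (if S k then h k else 0).

Lemma mem_Hm (S : pred 'I_N) k : S k -> (h k <= Hm S)%MS.
Proof.
by move=> Sk; have := row_sub k (Hm S); rewrite rowK Sk.
Qed.

Lemma Hm_sub m (S : pred 'I_N) (A : 'M[F]_(m, 1 + d)) :
  (forall k, S k -> (h k <= A)%MS) -> (Hm S <= A)%MS.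
Proof.
move=> H; apply/row_subP => k; rewrite rowK; case: ifP => [/H //|_]; exact: sub0mx.
Qed.

Lemma Hm_coef (S : pred 'I_N) v : (v <= Hm S)%MS ->
  exists a : 'I_N -> F, v = \sum_(k | S k) a k *: h k.
Proof.
case/submxP=> u ->; exists (u 0); rewrite mulmx_sum_row [RHS]big_mkcond /=.
by apply: eq_bigr => k _; rewrite rowK; case: ifP => // _; rewrite scaler0.
Qed.

Definition pos (S : pred 'I_N) : pred 'I_N := fun k => S k && cl k.
Definition neg (S : pred 'I_N) : pred 'I_N := fun k => S k && ~~ cl k.

Definition balanced (S : pred 'I_N) := (Hm (pos S) == Hm (neg S))%MS.

Lemma balanced_all m S (A : 'M[F]_(m, 1 + d)) : balanced S -> (A <= Hm S)%MS ->
  (A <= Hm (pos S))%MS && (A <= Hm (neg S))%MS.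
Proof.
case/andP=> h1 h2 hA.
have hp : (Hm S <= Hm (pos S))%MS.
  apply: Hm_sub => k Sk; case ck: (cl k); first by apply: mem_Hm; rewrite /pos Sk ck.
  by apply: submx_trans h2; apply: mem_Hm; rewrite /neg Sk ck.
by rewrite (submx_trans hA hp) (submx_trans (submx_trans hA hp) h1).
Qed.

(** Let [C] be the pulled-back inner product minus the original one. Expand the direction [w] once
    over positive and once over negative vertices, with coefficients summing to zero on each side.
    Bar lengths give [2 C(h k, h l) = C(h k, h k) + C(h l, h l)], and each term is killed by a zero
    sum. *)
Lemma isometry S D (L : 'M[F]_(1 + d, D)) :
  balanced S ->
  (forall k l, S k -> S l -> cl k -> ~~ cl l ->
     sqdist (h k *m L) (h l *m L) = sqdist (x k) (x l)) ->
  forall w : 'rV[F]_d, (row_mx 0 w <= Hm S)%MS ->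
  dp (w *m dsubmx L) (w *m dsubmx L) = dp w w.
Proof.
move=> bS HL w hw; have /andP[/Hm_coef[a Ea] /Hm_coef[b Eb]] := balanced_all bS hw.
pose C (u v : 'rV[F]_(1 + d)) := dp (u *m L) (v *m L) - dp (rsubmx u) (rsubmx v).
have Cw : C (row_mx 0 w) (row_mx 0 w) = dp (w *m dsubmx L) (w *m dsubmx L) - dp w w.
  by rewrite /C row_mxKr -{1 2}[L]vsubmxK mul_row_col mul0mx add0r.
apply/eqP; rewrite -subr_eq0 -Cw; apply/eqP.
have Chh k l : C (h k) (h l) = dp (h k *m L) (h l *m L) - dp (x k) (x l).
  by rewrite /C /h !row_mxKr.
have C2 k l : pos S k -> neg S l -> 2 * C (h k) (h l) = C (h k) (h k) + C (h l) (h l).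
  case/andP=> Sk ck /andP[Sl cl'].
  have := HL k l Sk Sl ck cl'; rewrite !sqdistD !Chh => E; lra.
have lsub (u : 'I_N -> F) (T : pred 'I_N) : lsubmx (\sum_(k | T k) u k *: h k) = (\sum_(k | T k) u k)%:M.
  rewrite raddf_sum /= raddf_sum /=; apply: eq_bigr => k _.
  by rewrite linearZ /= row_mxKl scalemx1.
have a0 : \sum_(k | pos S k) a k = 0.
  have := congr1 lsubmx Ea; rewrite row_mxKl lsub => /(congr1 (fun M : 'M_1 => M 0 0)).
  by rewrite !mxE eqxx mulr1n => <-.
have b0 : \sum_(k | neg S k) b k = 0.
  have := congr1 lsubmx Eb; rewrite row_mxKl lsub => /(congr1 (fun M : 'M_1 => M 0 0)).
  by rewrite !mxE eqxx mulr1n => <-.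
have -> : C (row_mx 0 w) (row_mx 0 w) =
   \sum_(k | pos S k) \sum_(l | neg S l) a k * b l * C (h k) (h l).
  have rs (u : 'I_N -> F) (T : pred 'I_N) :
      rsubmx (\sum_(k | T k) u k *: h k) = \sum_(k | T k) u k *: x k.
    by rewrite raddf_sum /=; apply: eq_bigr => k _; rewrite linearZ /= row_mxKr.
  rewrite {1}Ea Eb {1}/C !mulmx_suml !rs !dp_suml -sumrB; apply: eq_bigr => k _.
  rewrite !dp_sumr -sumrB; apply: eq_bigr => l _.
  by rewrite -!scalemxAl !dpZl !dpZr Chh; ring.
have : 2 * (\sum_(k | pos S k) \sum_(l | neg S l) a k * b l * C (h k) (h l)) = 0.
  rewrite mulr_sumr (eq_bigr (fun k => a k * C (h k) (h k) * (\sum_(l | neg S l) b l) +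
      a k * (\sum_(l | neg S l) b l * C (h l) (h l)))) => [|k pk].
    by rewrite big_split /= b0; under eq_bigr do rewrite mulr0; rewrite sumr_const mul0rn add0r -mulr_suml a0 mul0r.
  rewrite !mulr_sumr -big_split /=; apply: eq_bigr => l nl.
  rewrite mulrCA C2 //; ring.
by move/eqP; rewrite mulf_eq0 pnatr_eq0 /= => /eqP.
Qed.

(* [h k *m L] is a congruent copy of the original configuration that agrees
   with [p] on [S]; the extra [d] coordinates give it room. *)
Lemma congruent_copy S D (p : 'I_N -> 'rV[F]_D) (Lam : 'M[F]_(1 + d, D)) :
  balanced S -> equivcfg p -> (forall k, S k -> p k = h k *m Lam) ->
  exists L : 'M[F]_(1 + d, D + d),
   (forall k l, sqdist (h k *m L) (h l *m L) = sqdist (x k) (x l)) /\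
   (forall k, S k -> h k *m L = row_mx (p k) 0).
Proof.
move=> bS Ep HS; have [s0 Ss|nS] := pickP S; last first.
  exists (col_mx 0 (row_mx 0 1%:M)); split=> [k l|k]; last by rewrite nS.
  by rewrite /h !mul_row_col !mulmx0 !add0r !mul_mx_row !mulmx0 !mulmx1 !sqdistE opp_row_mx add_row_mx dp_row subrr dp0l add0r.
pose W : 'M[F]_(N, d) := \matrix_k (if S k then x k - x s0 else 0).
have [P [Ps PP PW WP]] := exists_proj W.
have hs k : h k - h s0 = row_mx 0 (x k - x s0).
  by rewrite /h opp_row_mx add_row_mx subrr.
have inW k : S k -> (x k - x s0) *m P = x k - x s0.
  by move=> Sk; have := congr1 (row k) WP; rewrite row_mul rowK Sk.
have iso w : (w <= W)%MS -> dp (w *m dsubmx Lam) (w *m dsubmx Lam) = dp w w.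
  move=> wW; apply: (isometry bS) => [k l Sk Sl ck cll|].
    by rewrite -!HS //; apply: Ep.
  case/submxP: wW => u ->; rewrite mulmx_sum_row.
  have -> : row_mx 0 (\sum_i u 0 i *: row i W) = \sum_i u 0 i *: row_mx 0 (row i W) :> 'rV[F]_(1 + d).
    elim/big_rec2: _ => [|i y1 y2 _ <-]; first by rewrite row_mx0.
    by rewrite scale_row_mx add_row_mx scaler0 add0r.
  apply: summx_sub => i _; apply: scalemx_sub; rewrite rowK; case: ifP => Si.
    by rewrite -hs addmx_sub ?eqmx_opp ?mem_Hm.
  by rewrite row_mx0 sub0mx.
(* An isometric embedding of directions: the part spanned by [S] follows [Lam], the orthogonal part
   goes to the extra coordinates. *)
pose M : 'M[F]_(d, D + d) := row_mx (P *m dsubmx Lam) (1%:M - P).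
pose L := col_mx (row_mx (p s0) 0 - x s0 *m M) M.
have hL k : h k *m L = row_mx (p s0) 0 + (x k - x s0) *m M.
  by rewrite /h /L mul_row_col mul1mx mulmxBl addrA [in RHS]addrAC.
have MM v : dp (v *m M) (v *m M) = dp v v.
  rewrite /M mul_mx_row dp_row !mulmxA iso; last exact: submx_trans (submxMl _ _) PW.
  have o : dp (v *m P) v = dp (v *m P) (v *m P).
    by rewrite -!dp_mx trmx_mul Ps mulmxA -(mulmxA v P P) PP.
  by rewrite mulmxBr mulmx1 dpBl !dpBr (dpC v) o; ring.
exists L; split=> [k l|k Sk].
  rewrite !sqdistE !hL opprD addrACA subrr add0r.
  have -> : (x k - x s0) *m M - (x l - x s0) *m M = (x k - x l) *m M.
    by rewrite -mulmxBl opprB addrA subrK.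
  exact: MM.
rewrite hL mul_mx_row mulmxA inW // mulmxBr mulmx1 inW // subrr add_row_mx addr0.
congr (row_mx _ _); have -> : (x k - x s0) *m dsubmx Lam = p k - p s0.
  by rewrite !HS // -mulmxBl hs -{2}[Lam]vsubmxK mul_row_col mul0mx add0r.
by rewrite addrC subrK.
Qed.

End Rigid.

(** A vector in the kernel of the weighted sum makes a sum of squares vanish, hence is orthogonal to
    each [g k] of positive weight; this is applied to the columns of the cokernel. *)
Lemma outer_row (F : realFieldType) N m (T : pred 'I_N) (lam : 'I_N -> F) (g : 'I_N -> 'rV[F]_m) k :
  (forall k, 0 <= lam k) -> T k -> 0 < lam k ->
  (g k <= (\sum_(k | T k) lam k *: ((g k)^T *m g k))%R)%MS.
Proof.
move=> l0 Tk lk; set M := \sum_(k | T k) _; rewrite submxE; apply/eqP/rowP => j.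
set U := cokermx M; rewrite [RHS]mxE.
have E : (U^T *m M *m U) j j = 0 by rewrite -mulmxA mulmx_coker mulmx0 mxE.
move: E; rewrite /M mulmx_sumr mulmx_suml summxE.
rewrite (eq_bigr (fun k => lam k * ((g k *m U) 0 j) ^+ 2)) => [/eqP|i _].
  rewrite psumr_eq0 => [/allP/(_ k)|i _]; last by rewrite mulr_ge0 ?sqr_ge0.
  rewrite mem_index_enum => /(_ isT) /implyP/(_ Tk).
  by rewrite mulf_eq0 gt_eqF //= sqrf_eq0 => /eqP.
rewrite -scalemxAr -scalemxAl mxE; congr (_ * _).
have -> : U^T *m ((g i)^T *m g i) *m U = (g i *m U)^T *m (g i *m U).
  by rewrite (trmx_mul (g i) U) !mulmxA.
by rewrite mxE big_ord1 [X in X * _]mxE expr2.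
Qed.

(** [M] is the common moment matrix of the two sides; [zeta] and [theta] are the weighted
    least-squares fits of [y] by [g] on each side. The two residual energies plus the squared
    [M]-distance of [zeta] and [theta] equal the total energy of [y] minus [2 T(zeta, theta)]. The
    relations with [f] make this zero, so all residuals of positive weight vanish. *)
Lemma energy (F : realFieldType) N m D (cl : pred 'I_N) (lam : 'I_N -> F)
    (g : 'I_N -> 'rV[F]_m) (y : 'I_N -> 'rV[F]_D) (f : 'I_N -> 'cV[F]_m) :
  (forall k, 0 <= lam k) ->
  \sum_(k | cl k) lam k *: ((g k)^T *m g k) = \sum_(k | ~~ cl k) lam k *: ((g k)^T *m g k) ->
  (forall k l, cl k -> ~~ cl l -> dp (y k) (y l) = (g l *m f k) 0 0 + (g k *m f l) 0 0) ->
  (forall k, (g k *m f k) 0 0 = dp (y k) (y k) / 2) ->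
  exists zeta : 'M[F]_(m, D), forall k, 0 < lam k -> y k = g k *m zeta.
Proof.
move=> l0 bal yy yf; pose M := \sum_(k | cl k) lam k *: ((g k)^T *m g k).
pose c k := g k *m pinvmx M.
have lam0 k : ~~ (0 < lam k) -> lam k = 0 by move=> nl; apply/eqP; rewrite eq_le l0 andbT leNgt.
have cM k : 0 < lam k -> c k *m M = g k.
  move=> lk; apply: mulmxKpV; case ck: (cl k).
    exact: (@outer_row _ _ _ cl lam g k).
  by rewrite /M bal; apply: (@outer_row _ _ _ (predC cl) lam g k); rewrite //= ck.
have Ms : M^T = M.
  rewrite /M raddf_sum /=; apply: eq_bigr => k _.
  by rewrite linearZ /= trmx_mul trmxK.
have Mc k : 0 < lam k -> M *m (c k)^T = (g k)^T.
  by move=> lk; rewrite -{1}Ms -trmx_mul cM.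
have MZ (T : pred 'I_N) q (z : 'I_N -> 'rV[F]_q) :
    M *m (\sum_(k | T k) lam k *: ((c k)^T *m z k)) = \sum_(k | T k) lam k *: ((g k)^T *m z k).
  rewrite mulmx_sumr; apply: eq_bigr => k _; rewrite -scalemxAr mulmxA.
  have [lk|/lam0 ->] := boolP (0 < lam k); last by rewrite !scale0r.
  by rewrite Mc.
pose zeta := \sum_(k | cl k) lam k *: ((c k)^T *m y k).
pose theta := \sum_(k | ~~ cl k) lam k *: ((c k)^T *m y k).
pose T (A B : 'M[F]_(m, D)) := \tr (B^T *m M *m A).
have MT (T0 : pred 'I_N) : T0 =1 cl \/ T0 =1 predC cl -> M = \sum_(k | T0 k) lam k *: ((g k)^T *m g k).
  case=> E; first by rewrite /M; apply: eq_bigl => k; rewrite E.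
  by rewrite /M bal; apply: eq_bigl => k; rewrite E.
have F1 (T0 : pred 'I_N) A B : T0 =1 cl \/ T0 =1 predC cl ->
    \sum_(k | T0 k) lam k * dp (g k *m A) (g k *m B) = T A B.
  move=> HT; rewrite /T (MT T0 HT) mulmx_sumr mulmx_suml raddf_sum /=; apply: eq_bigr => k _.
  by rewrite -scalemxAr -scalemxAl mxtraceZ /dp (trmx_mul (g k) B) !mulmxA.
have F2 (T0 : pred 'I_N) B : \sum_(k | T0 k) lam k * dp (y k) (g k *m B) =
    T (\sum_(k | T0 k) lam k *: ((c k)^T *m y k)) B.
  rewrite /T -mulmxA MZ mulmx_sumr raddf_sum /=; apply: eq_bigr => k _.
  by rewrite -scalemxAr mxtraceZ /dp (trmx_mul (g k) B) !mulmxA.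
have Esq (T0 : pred 'I_N) B : T0 =1 cl \/ T0 =1 predC cl ->
    B = \sum_(k | T0 k) lam k *: ((c k)^T *m y k) ->
    \sum_(k | T0 k) lam k * dp (y k - g k *m B) (y k - g k *m B) =
    \sum_(k | T0 k) lam k * dp (y k) (y k) - T B B.
  move=> HT EB; rewrite (eq_bigr (fun k => lam k * dp (y k) (y k) - 2 * (lam k * dp (y k) (g k *m B))
      + lam k * dp (g k *m B) (g k *m B))) => [|k _].
    by rewrite big_split sumrB -mulr_sumr F1 // F2 -EB /=; ring.
  by rewrite dpBl !dpBr (dpC (g k *m B) (y k)); ring.
have E1 := Esq cl zeta (or_introl (fun _ => erefl)) erefl.
have E2 := Esq (predC cl) theta (or_intror (fun _ => erefl)) erefl.
have E3 : \sum_(k | cl k) lam k * dp (g k *m zeta - g k *m theta) (g k *m zeta - g k *m theta) =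
   T zeta zeta - 2 * T zeta theta + T theta theta.
  have Fc A B := F1 cl A B (or_introl (fun _ => erefl)).
  rewrite (eq_bigr (fun k => lam k * dp (g k *m zeta) (g k *m zeta) -
     2 * (lam k * dp (g k *m zeta) (g k *m theta)) + lam k * dp (g k *m theta) (g k *m theta))) => [|k _].
    by rewrite big_split sumrB -mulr_sumr !Fc.
  by rewrite dpBl !dpBr (dpC (g k *m theta) (g k *m zeta)); ring.
have sc (A B : 'M[F]_1) : (A *m B) 0 0 = A 0 0 * B 0 0 by rewrite mxE big_ord1.
(* Expanding [theta] through the kernel [mm] leaves only products [<y k, y l>] across bars, which
   [f] expresses. The kernel reproduces, [sum_l lam l mm k l g l = g k] over the opposite side, and
   what remains is [g k f k], half of [|y k|^2]. *)
have E4 : 2 * T zeta theta = \sum_(k | cl k) lam k * dp (y k) (y k) + \sum_(k | ~~ cl k) lam k * dp (y k) (y k).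
  pose mm k l := (g k *m (c l)^T) 0 0.
  have gth k : g k *m theta = \sum_(l | ~~ cl l) (lam l * mm k l) *: y l.
    rewrite mulmx_sumr; apply: eq_bigr => l _; rewrite -scalemxAr mulmxA -scalerA; congr (_ *: _).
    by rewrite [g k *m (c l)^T]mx11_scalar mul_scalar_mx.
  have -> : T zeta theta = \sum_(k | cl k) lam k * \sum_(l | ~~ cl l) lam l * mm k l *
       ((g l *m f k) 0 0 + (g k *m f l) 0 0).
    rewrite -F2; apply: eq_bigr => k ck; congr (_ * _); rewrite gth dp_sumr.
    by apply: eq_bigr => l cll; rewrite dpZr yy.
  have H1 k : cl k -> lam k * \sum_(l | ~~ cl l) lam l * mm k l * (g l *m f k) 0 0 = lam k * (dp (y k) (y k) / 2).
    move=> ck; have [lk|/lam0 ->] := boolP (0 < lam k); last by rewrite !mul0r.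
    congr (_ * _); rewrite -yf -[in RHS](cM k lk) /M bal -(MZ (predC cl) _ g) mulmxA cM //.
    rewrite mulmx_sumr mulmx_suml summxE; apply: eq_bigr => l _.
    have E : g k *m ((c l)^T *m g l) *m f k = (g k *m (c l)^T) *m (g l *m f k) by rewrite !mulmxA.
    by rewrite -scalemxAr -scalemxAl E [RHS]mxE sc mulrA.
  have H2 l : ~~ cl l -> lam l * \sum_(k | cl k) lam k * mm k l * (g k *m f l) 0 0 = lam l * (dp (y l) (y l) / 2).
    move=> cll; have [ll|/lam0 ->] := boolP (0 < lam l); last by rewrite !mul0r.
    congr (_ * _); rewrite -yf -[in RHS](cM l ll) /M.
    rewrite mulmx_sumr mulmx_suml summxE; apply: eq_bigr => k _.
    have E : c l *m ((g k)^T *m g k) *m f l = (c l *m (g k)^T) *m (g k *m f l) by rewrite !mulmxA.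
    rewrite -scalemxAr -scalemxAl E [RHS]mxE sc mulrA; congr (_ * _ * _).
    by rewrite /mm -[g k *m (c l)^T]trmxK trmx_mul trmxK mxE.
  rewrite (eq_bigr (fun k => lam k * (dp (y k) (y k) / 2) +
     \sum_(l | ~~ cl l) lam l * (lam k * mm k l * (g k *m f l) 0 0))) => [|k ck].
    rewrite big_split /= exchange_big /= [X in _ + X](eq_bigr (fun l => lam l * (dp (y l) (y l) / 2))); last first.
      by move=> l cll; rewrite -mulr_sumr H2.
    rewrite mulrDr !mulr_sumr; congr (_ + _); apply: eq_bigr => k _; by field.
  rewrite -H1 // !mulr_sumr -big_split /=; apply: eq_bigr => l _; ring.
have nn (T0 : pred 'I_N) (z : 'I_N -> 'rV[F]_D) : 0 <= \sum_(k | T0 k) lam k * dp (z k) (z k).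
  by apply: sumr_ge0 => k _; rewrite mulr_ge0 ?dp_ge0.
have zero (T0 : pred 'I_N) (z : 'I_N -> 'rV[F]_D) k :
    \sum_(k | T0 k) lam k * dp (z k) (z k) <= 0 -> T0 k -> 0 < lam k -> z k = 0.
  move=> le Tk lk; have /eqP : \sum_(k | T0 k) lam k * dp (z k) (z k) = 0.
    by apply/eqP; rewrite eq_le le nn.
  rewrite psumr_eq0 => [/allP/(_ k)|i _]; last by rewrite mulr_ge0 ?dp_ge0.
  rewrite mem_index_enum => /(_ isT) /implyP/(_ Tk).
  by rewrite mulf_eq0 gt_eqF //= => /eqP/dp_eq0.
have n1 := nn cl (fun k => y k - g k *m zeta).
have n2 := nn (predC cl) (fun k => y k - g k *m theta).
have n3 := nn cl (fun k => g k *m zeta - g k *m theta).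
have Z1 : \sum_(k | cl k) lam k * dp (y k - g k *m zeta) (y k - g k *m zeta) <= 0.
  move: n1 n2 n3 E4; rewrite E1 E2 E3 /=; lra.
have Z2 : \sum_(k | predC cl k) lam k * dp (y k - g k *m theta) (y k - g k *m theta) <= 0.
  move: n1 n2 n3 E4; rewrite E1 E2 E3 /=; lra.
have Z3 : \sum_(k | cl k) lam k * dp (g k *m zeta - g k *m theta) (g k *m zeta - g k *m theta) <= 0.
  move: n1 n2 n3 E4; rewrite E1 E2 E3 /=; lra.
have M0 : M *m (zeta - theta) = 0.
  rewrite /M mulmx_suml big1 // => k ck; rewrite -scalemxAl.
  have [lk|/lam0 ->] := boolP (0 < lam k); last by rewrite scale0r.
  rewrite -mulmxA mulmxBr.
  by rewrite (zero cl (fun k => g k *m zeta - g k *m theta) k Z3 ck lk) mulmx0 scaler0.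
have yk k : 0 < lam k -> y k = g k *m zeta.
  move=> lk; case ck: (cl k).
    by apply/eqP; rewrite -subr_eq0; apply/eqP; apply: (zero cl (fun k => y k - g k *m zeta)).
  have : g k *m (zeta - theta) = 0 by rewrite -cM // -mulmxA M0 mulmx0.
  rewrite mulmxBr => /eqP; rewrite subr_eq0 => /eqP ->.
  apply/eqP; rewrite -subr_eq0; apply/eqP.
  by apply: (zero (predC cl) (fun k => y k - g k *m theta)); rewrite //= ck.
by exists zeta.
Qed.

Section Step.
Variables (F : realFieldType) (N d : nat) (x : 'I_N -> 'rV[F]_d) (cl : pred 'I_N).
Variables (S : pred 'I_N) (P : 'M[F]_(1 + d)) (lam : 'I_N -> F).
Notation h := (hat x).
Notation g := (fun k => h k *m P).
Notation K := (fun k => 0 < lam k).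
Hypothesis (Ps : P^T = P) (PP : P *m P = P).
Hypothesis (HS0 : forall k, S k -> h k *m P = 0).
Hypothesis (HP : (1%:M - P <= Hm x S)%MS).
Hypothesis (bS : balanced x cl S).
Hypothesis (l0 : forall k, 0 <= lam k).
Hypothesis (SK : forall k, S k -> 0 < lam k).
Hypothesis (bal : \sum_(k | cl k) lam k *: ((g k)^T *m g k) =
                  \sum_(k | ~~ cl k) lam k *: ((g k)^T *m g k)).

Lemma resid k : (h k - g k <= Hm x S)%MS.
Proof.
have -> : h k - g k = h k *m (1%:M - P) by rewrite mulmxBr mulmx1.
exact: submx_trans (submxMl _ _) HP.
Qed.

Lemma Hm_mono (T T' : pred 'I_N) : (forall k, T k -> T' k) -> (Hm x T <= Hm x T')%MS.
Proof. by move=> H; apply: Hm_sub => k /H; apply: mem_Hm. Qed.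

(** [h k] and [g k] differ by a vector in the span of [S], which either side of [S] already fills;
    and by [outer_row] the supported [g k] of both sides lie in the row space of the same moment
    matrix. *)
Lemma step_balanced : balanced x cl K.
Proof.
have half (c : pred 'I_N) : (c =1 cl) \/ (c =1 predC cl) ->
    (Hm x (fun k => K k && c k) <= Hm x (fun k => K k && ~~ c k))%MS.
  move=> Hc; set A := Hm x (fun k => K k && ~~ c k).
  have SA : (Hm x S <= A)%MS.
    have /andP[s1 s2] := balanced_all bS (submx_refl (Hm x S)).
    case: Hc => Ec.
      by apply: submx_trans s2 _; apply: Hm_mono => k /andP[/SK -> ck]; rewrite Ec.
    by apply: submx_trans s1 _; apply: Hm_mono => k /andP[/SK -> ck]; rewrite Ec /= ck.
  have MA : ((\sum_(k | ~~ c k) lam k *: ((g k)^T *m g k))%R <= A)%MS.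
    apply: summx_sub => k ck; have [lk|nlk] := boolP (0 < lam k); last first.
      have -> : lam k = 0 by apply/eqP; rewrite eq_le l0 andbT leNgt.
      by rewrite scale0r sub0mx.
    apply: scalemx_sub; apply: submx_trans (submxMl _ _) _.
    have -> : h k *m P = h k - (h k - h k *m P) by rewrite opprB addrC subrK.
    rewrite addmx_sub ?eqmx_opp //; first by apply: mem_Hm; rewrite lk ck.
    exact: submx_trans (resid k) SA.
  have EM : \sum_(k | c k) lam k *: ((g k)^T *m g k) = \sum_(k | ~~ c k) lam k *: ((g k)^T *m g k).
    case: Hc => Ec; first by rewrite (eq_bigl cl) // bal; apply: eq_bigl => k; rewrite Ec.
    by rewrite (eq_bigl (predC cl)) // -bal; apply: eq_bigl => k; rewrite Ec /= negbK.
  apply: Hm_sub => k /andP[lk ck].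
  rewrite -(subrK (h k *m P) (h k)) addmx_sub //; first exact: submx_trans (resid k) SA.
  by apply: submx_trans MA; rewrite -EM; apply: outer_row.
rewrite /balanced; have h1 := half cl (or_introl (fun _ => erefl)).
have h2 := half (predC cl) (or_intror (fun _ => erefl)).
rewrite h1 /=; apply: submx_trans h2 _; apply: Hm_mono => k /=.
by rewrite negbK.
Qed.

Section Affine.
Variables (D : nat) (p : 'I_N -> 'rV[F]_D) (Lam : 'M[F]_(1 + d, D)).
Hypothesis (Ep : equivcfg x cl p) (HLam : forall k, S k -> p k = h k *m Lam).

Let pp k : 'rV[F]_(D + d) := row_mx (p k) 0.

(** Comparing bar lengths of [p] and of the congruent copy gives [<y k, y l> = h l f k + h k f l],
    with [f k] the affine functional [h -> u k - <h L, y k>]. It vanishes on the vertices of [S]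
    opposite to [k], where [y] and [u] are zero; by balance these span all of [S], so [h] may be
    replaced by its projection [g]. *)
Lemma displacement : exists (L : 'M[F]_(1 + d, D + d)) (f : 'I_N -> 'cV[F]_(1 + d)),
  let y := fun k => pp k - h k *m L in
  [/\ forall k l, sqdist (h k *m L) (h l *m L) = sqdist (x k) (x l),
      forall k, S k -> y k = 0,
      forall k l, cl k -> ~~ cl l -> dp (y k) (y l) = (g l *m f k) 0 0 + (g k *m f l) 0 0 &
      forall k, (g k *m f k) 0 0 = dp (y k) (y k) / 2] /\
  (forall k l, S l -> dp (y k) (h l *m L) = (dp (pp k) (pp k)
       - dp (h k *m L) (h k *m L)) / 2).
Proof.
have [L [iso HL]] := congruent_copy bS Ep HLam.
pose y k := pp k - h k *m L.
pose u k := (dp (pp k) (pp k) - dp (h k *m L) (h k *m L)) / 2.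
pose f k : 'cV[F]_(1 + d) := u k *: col_mx 1%:M 0 - L *m (y k)^T.
have hf k l : (h l *m f k) 0 0 = u k - dp (h l *m L) (y k).
  rewrite /f mulmxBr -scalemxAr mulmxA /hat mul_row_col mulmx1 mulmx0 addr0 -/(h l).
  have E1 (A B : 'M[F]_1) : (A - B) 0 0 = A 0 0 - B 0 0 by rewrite !mxE.
  by rewrite E1 dp_mx; congr (_ - _); rewrite !mxE eqxx mulr1.
have yS k : S k -> y k = 0 by move=> Sk; rewrite /y HL // /pp subrr.
have uS k : S k -> u k = 0 by move=> Sk; rewrite /u HL // /pp subrr mul0r.
have yy k l : cl k -> ~~ cl l -> dp (y k) (y l) = (h l *m f k) 0 0 + (h k *m f l) 0 0.
  move=> ck cl'; rewrite !hf.
  have E : sqdist (pp k) (pp l) = sqdist (h k *m L) (h l *m L).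
    by rewrite iso -(Ep ck cl') !sqdistE /pp opp_row_mx add_row_mx dp_row subrr dp0l addr0.
  move: E; rewrite !sqdistD /y /u !dpBl !dpBr.
  rewrite (dpC (h l *m L) (pp k)) (dpC (h l *m L) (h k *m L)) => E; lra.
have f0 k l : S l -> (h l *m f k) 0 0 = 0.
  have f0c l' : S l' -> cl k != cl l' -> (h l' *m f k) 0 0 = 0.
    move=> Sl ckl; have E : (h k *m f l') 0 0 = 0 by rewrite hf (uS _ Sl) (yS _ Sl) dpC dp0l subrr.
    case ck: (cl k) ckl; case cl': (cl l') => // _.
      by have := yy k l'; rewrite ck cl' (yS _ Sl) dpC dp0l E addr0 => /(_ isT isT) <-.
    by have := yy l' k; rewrite ck cl' (yS _ Sl) dp0l E add0r => /(_ isT isT) <-.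
  have fH m (A : 'M[F]_(m, 1 + d)) : (A <= Hm x S)%MS -> A *m f k = 0.
    move=> hA; have /andP[h1 h2] := balanced_all bS hA.
    suff [B hB E] : exists2 B : 'M[F]_(N, 1 + d), (A <= B)%MS & B *m f k = 0.
      by case/submxP: hB => X ->; rewrite -mulmxA E mulmx0.
    have Z (T : pred 'I_N) : (forall l, T l -> S l /\ cl k != cl l) -> Hm x T *m f k = 0.
      move=> HT; apply/row_matrixP => i; rewrite row_mul rowK row0.
      case: ifP => [/HT[Si ci]|_]; last by rewrite mul0mx.
      by rewrite [LHS]mx11_scalar f0c // raddf0.
    case ck: (cl k); [exists (Hm x (neg cl S))|exists (Hm x (pos cl S))] => //.
      by apply: Z => i /andP[-> /negPf ci]; rewrite ck ci.
    by apply: Z => i /andP[-> ci]; rewrite ck ci.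
  by move=> Sl; rewrite (fH _ (h l) (mem_Hm x Sl)) mxE.
have fR k l : (h l *m f k) 0 0 = (g l *m f k) 0 0.
  have : (h l - g l) *m f k = 0.
    have /Hm_coef[a ->] := resid l; rewrite mulmx_suml big1 // => i Si.
    by rewrite -scalemxAl [X in _ *: X]mx11_scalar f0 // raddf0 scaler0.
  rewrite mulmxBl => /eqP; rewrite subr_eq0 => /eqP -> //.
exists L, f; split; first split=> //.
- by move=> k l ck cl'; rewrite yy // !fR.
- move=> k; rewrite -fR hf -/(y k) /u /y !dpBl !dpBr (dpC (pp k) (h k *m L)).
  by field.
- by move=> k l Sl; have := f0 k l Sl; rewrite hf dpC => /eqP; rewrite subr_eq0 => /eqP <-.
Qed.

Lemma step_affine : exists Lam' : 'M[F]_(1 + d, D), forall k, K k -> p k = h k *m Lam'.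
Proof.
have [L [f [[iso yS yy yf] _]]] := displacement.
have [zeta yk] := energy l0 bal yy yf.
exists (lsubmx (L + P *m zeta)) => k lk.
by rewrite mulmx_lsub mulmxDr mulmxA -yk // addrC subrK /pp row_mxKl.
Qed.

End Affine.
End Step.

(** * Flexible configurations *)

Lemma small_scale (F : realFieldType) (I : eqType) (s : seq I) (a b : I -> F) :
  (forall k, k \in s -> 0 < a k) -> exists2 e, 0 < e & forall k, k \in s -> e * b k < a k.
Proof.
elim: s => [|k s IH] Ha; first by exists 1.
have [|e e0 He] := IH; first by move=> j js; apply: Ha; rewrite inE js orbT.
have ak : 0 < a k by apply: Ha; rewrite inE eqxx.
pose c := a k / (2 * (`|b k| + 1)).
have nb : 0 < `|b k| + 1 by rewrite ltr_wpDl.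
have c0 : 0 < c by rewrite divr_gt0 // mulr_gt0.
have ck : c * (`|b k| + 1) = a k / 2 by rewrite /c; field; rewrite gt_eqF.
have le j r u : 0 < r -> r <= u -> u * b j < a j -> 0 < a j -> r * b j < a j.
  move=> r0 ru h aj; case: (lerP 0 (b j)) => bj.
    by apply: le_lt_trans h; rewrite ler_wpM2r.
  by apply: lt_trans aj; rewrite pmulr_rlt0.
exists (Num.min e c) => [|j]; first by rewrite lt_min e0 c0.
have m0 : 0 < Num.min e c by rewrite lt_min e0 c0.
rewrite inE => /orP[/eqP -> |js].
  apply: (le _ _ c) => //; first by rewrite ge_min lexx orbT.
  have h1 : b k <= `|b k| + 1 by have := ler_norm (b k); lra.
  have h2 := ler_wpM2l (ltW c0) h1; move: h2; rewrite ck; lra.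
apply: (le _ _ e) => //; first by rewrite ge_min lexx.
  exact: He.
by apply: Ha; rewrite inE js orbT.
Qed.

(** Induction on the family, in the style of Fourier-Motzkin: given [z] positive on the tail, the
    sign of [<c i, z>] decides whether [z] works, must be perturbed, or [c i] is eliminated from the
    other vectors. *)
Lemma Gordan (F : realFieldType) (I : eqType) M (s : seq I) (c : I -> 'rV[F]_M) : uniq s ->
  (exists z, forall k, k \in s -> 0 < dp (c k) z) \/
  (exists2 lam : I -> F, (forall k, k \in s -> 0 <= lam k) /\ (exists2 k, k \in s & 0 < lam k) &
     \sum_(k <- s) lam k *: c k = 0).
Proof.
elim: s c => [|i s IH] c; first by left; exists 0.
case/andP=> nis us; have ni k : k \in s -> k != i by move=> ks; apply: contraNneq nis => <-.
have fix_sum (lam : I -> F) r (u : I -> 'rV[F]_M) :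
   \sum_(k <- s) (if k == i then r else lam k) *: u k = \sum_(k <- s) lam k *: u k.
  by apply: eq_big_seq => k /ni/negPf ->.
have [ci0|ci0] := eqVneq (c i) 0.
  right; exists (fun k => if k == i then 1 else 0); first split.
  - by move=> k _; case: ifP.
  - by exists i; rewrite ?inE eqxx.
  by rewrite big_cons (fix_sum (fun _ => 0)) ci0 scaler0 add0r big1 // => k _; rewrite scale0r.
have extend (mu : I -> F) : (forall k, k \in s -> 0 <= mu k) ->
    (exists2 lam : I -> F, (forall k, k \in s -> 0 <= lam k) /\ (exists2 k, k \in s & 0 < lam k) &
       \sum_(k <- s) lam k *: (c k + mu k *: c i) = 0) ->
    exists2 lam : I -> F, (forall k, k \in i :: s -> 0 <= lam k) /\ (exists2 k, k \in i :: s & 0 < lam k) &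
     \sum_(k <- i :: s) lam k *: c k = 0.
  move=> mu0 [lam [l0 [k0 k0s lk0]] E].
  exists (fun k => if k == i then \sum_(k <- s) lam k * mu k else lam k); first split.
  - move=> k; rewrite inE; case: eqP => [_ _|_ /= /l0 //].
    by rewrite big_seq; apply: sumr_ge0 => j js; rewrite mulr_ge0 ?l0 ?mu0.
  - by exists k0; rewrite ?inE ?k0s ?orbT // (negPf (ni _ k0s)).
  rewrite big_cons eqxx fix_sum -[RHS]E scaler_suml -big_split /=; apply: eq_bigr => k _.
  by rewrite scalerDr scalerA addrC.
case: (IH c us) => [[z Hz]|[lam Hl E]]; last first.
  right; apply: (extend (fun _ => 0)) => //; exists lam => //.
  by rewrite -[RHS]E; apply: eq_bigr => k _; rewrite scale0r addr0.
case: (ltrgtP 0 (dp (c i) z)) => [ip|im|i0].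
- by left; exists z => k; rewrite inE => /orP[/eqP -> //|/Hz].
(* The multiples that make [c k + mu k c i] orthogonal to [z]; nonnegative because [z] is positive
   on [s] and negative on [i]. *)
- pose mu k := - (dp (c k) z / dp (c i) z).
  have mu0 k : k \in s -> 0 <= mu k.
    move=> ks; rewrite /mu -mulrN mulr_ge0 //; first exact/ltW/Hz.
    by rewrite oppr_ge0 invr_le0 ltW.
  case: (IH (fun k => c k + mu k *: c i) us) => [[z' Hz']|]; last by right; apply: (extend mu).
  have [e e0 He] := @small_scale _ _ s (fun k => dp (c k + mu k *: c i) z') mu Hz'.
  pose t := (e - dp (c i) z') / dp (c i) z.
  have iw : dp (c i) (z' + t *: z) = e.
    by rewrite dpDr dpZr /t divfK ?lt_eqF // addrC subrK.
  left; exists (z' + t *: z) => k; rewrite inE => /orP[/eqP ->|ks]; first by rewrite iw.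
  have : dp (c k + mu k *: c i) (z' + t *: z) = dp (c k + mu k *: c i) z'.
    rewrite dpDr dpZr [X in _ + _ * X]dpDl dpZl /mu mulNr divfK ?lt_eqF //.
    by rewrite subrr mulr0 addr0.
  rewrite dpDl dpZl iw => E; have := He k ks; rewrite -E mulrC; lra.
(* Here [z] is orthogonal to [c i]; a slight tilt towards [c i] repairs this without spoiling the
   other signs. *)
have [e e0 He] := @small_scale _ _ s (fun k => dp (c k) z) (fun k => - dp (c k) (c i)) Hz.
left; exists (z + e *: c i) => k; rewrite inE dpDr dpZr => /orP[/eqP ->|ks].
  rewrite -i0 add0r mulr_gt0 // lt_neqAle dp_ge0 andbT.
  by apply: contra ci0 => /eqP E; apply/eqP/dp_eq0.
have := He k ks; rewrite mulrN; lra.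
Qed.

(** * Affine dimension in homogeneous coordinates *)

Section AffineRank.
Variables (F : realFieldType) (N d : nat) (x : 'I_N -> 'rV[F]_d).

(** The first coordinate maps the span of the [hat x k] onto a line, with kernel the span of the
    differences. *)
Lemma affdim_hat : (0 < N)%N -> (affdim x).+1 = \rank (Hm x predT).
Proof.
move=> N0; pose k0 := Ordinal N0.
set H := Hm x predT; pose B : 'M[F]_(1 + d, 1) := col_mx 1%:M 0.
rewrite -(mxrank_mul_ker H B).
have hB k : hat x k *m B = 1%:M by rewrite /hat /B mul_row_col mul1mx mulmx0 addr0.
have -> : \rank (H *m B) = 1%N.
  apply/eqP; rewrite eqn_leq rank_leq_col lt0n mxrank_eq0; apply/eqP => /(congr1 (row k0)).
  rewrite row_mul rowK hB row0 => /(congr1 (fun A : 'M_1 => A 0 0)).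
  by rewrite !mxE => /eqP; rewrite oner_eq0.
rewrite add1n; congr _.+1; rewrite /affdim.
set W := (\sum_(k < N) _)%MS; set C := (H :&: kermx B)%MS.
have WC : (W <= rsubmx C)%MS.
  apply/sumsmx_subP => k _; apply/sumsmx_subP => l _; rewrite genmxE.
  have /submxP[u E] : (hat x k - hat x l <= C)%MS.
    rewrite sub_capmx addmx_sub ?eqmx_opp ?mem_Hm //=.
    by apply/sub_kermxP; rewrite mulmxBl !hB subrr.
  have -> : x k - x l = rsubmx (hat x k - hat x l) by rewrite raddfB /= /hat !row_mxKr.
  by rewrite E -mulmx_rsub submxMl.
have CW : (C <= row_mx 0 W)%MS.
  apply/rV_subP => v; rewrite sub_capmx => /andP[vH /sub_kermxP vB]; have [a Ea] := @Hm_coef _ _ _ x predT v vH.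
  have a0 : \sum_k a k = 0.
    move: vB; rewrite Ea mulmx_suml (eq_bigr (fun k => (a k)%:M)).
      by rewrite -raddf_sum => /(congr1 (fun A : 'M_1 => A 0 0)); rewrite !mxE eqxx mulr1n.
    by move=> k _; rewrite -scalemxAl hB scalemx1.
  have -> : v = \sum_k a k *: (hat x k - hat x k0).
    rewrite (eq_bigr (fun k => a k *: hat x k - a k *: hat x k0)) => [|k _]; last by rewrite scalerBr.
    by rewrite sumrB -scaler_suml a0 scale0r subr0.
  apply: summx_sub => k _; apply: scalemx_sub.
  have /submxP[u E] : (x k - x k0 <= W)%MS.
    have : (<<x k - x k0>> <= W)%MS by apply: (sumsmx_sup k) => //; apply: (sumsmx_sup k0).
    by rewrite genmxE.
  have -> : hat x k - hat x k0 = row_mx 0 (x k - x k0) by rewrite /hat opp_row_mx add_row_mx subrr.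
  by rewrite E -[X in row_mx X _](mulmx0 _ u) -mul_mx_row submxMl.
apply/eqP; rewrite eqn_leq; apply/andP; split.
  apply: leq_trans (mxrankS WC) _.
  have -> : rsubmx C = C *m col_mx 0 1%:M by rewrite -{2}[C]hsubmxK mul_row_col mulmx0 add0r mulmx1.
  exact: mxrankM_maxl.
by apply: leq_trans (mxrankS CW) _; rewrite rank_row_0mx.
Qed.

End AffineRank.

Lemma rank_Hm_card (F : realFieldType) N d (x : 'I_N -> 'rV[F]_d) (T : pred 'I_N) :
  (\rank (Hm x T) <= #|T|)%N.
Proof.
pose f (i : 'I_#|T|) := enum_val i.
suff h : (Hm x T <= \matrix_i hat x (f i))%MS.
  exact: leq_trans (mxrankS h) (rank_leq_row _).
apply: Hm_sub => k Tk; have := row_sub (enum_rank_in Tk k) (\matrix_i hat x (f i)).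
by rewrite rowK /f enum_rankK_in.
Qed.

Lemma rank_Hm_split (F : realFieldType) N d (x : 'I_N -> 'rV[F]_d) (S : pred 'I_N) :
  (\rank (Hm x predT) <= \rank (Hm x S) + #|[pred k | ~~ S k]|)%N.
Proof.
apply: leq_trans (leq_add (leqnn _) (rank_Hm_card x [pred k | ~~ S k])).
apply: leq_trans (mxrank_adds_leqif _ _).
apply: mxrankS; apply: Hm_sub => k _; case Sk: (S k).
  exact: submx_trans (mem_Hm x Sk) (addsmxSl _ _).
apply: submx_trans (addsmxSr _ _); apply: mem_Hm; by rewrite /= Sk.
Qed.

(** * Criteria from a maximal supported set *)

Section Classify.
Variables (F : rcfType) (N d : nat) (x : 'I_N -> 'rV[F]_d) (cl S : pred 'I_N).
Variable P : 'M[F]_(1 + d).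
Notation h := (hat x).
Notation g := (fun k => h k *m P).
Hypothesis (Ps : P^T = P).
Hypothesis (HS0 : forall k, S k -> h k *m P = 0).
Hypothesis (HP : (1%:M - P <= Hm x S)%MS).
Hypothesis (bS : balanced x cl S).
Hypothesis (affS : forall D (p : 'I_N -> 'rV[F]_D), equivcfg x cl p ->
   exists Lam : 'M[F]_(1 + d, D), forall k, S k -> p k = h k *m Lam).
Hypothesis (maxS : forall lam : 'I_N -> F, (forall k, 0 <= lam k) ->
   \sum_(k | cl k) lam k *: ((g k)^T *m g k) = \sum_(k | ~~ cl k) lam k *: ((g k)^T *m g k) ->
   forall k, ~~ S k -> lam k = 0).

Let sg k : F := if cl k then 1 else -1.
Let T : pred 'I_N := [pred k | ~~ S k].

(** Gordan's alternative for the signed outer products of the [g k] outside [S]: a dependency would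
    be a weight excluded by [maxS], and a separating functional, symmetrised and compressed by [P],
    is the required form. *)
Lemma separating_form : exists A : 'M[F]_(1 + d),
  [/\ A^T = A, forall k, S k -> h k *m A = 0 &
      forall k, T k -> 0 < sg k * dp (h k *m A) (h k)].
Proof.
case: (@Gordan F 'I_N _ (enum T) (fun k => sg k *: mxvec ((g k)^T *m g k)) (enum_uniq _)).
  case=> z Hz; pose Z : 'M[F]_(1 + d) := vec_mx z.
  exists (P *m (Z + Z^T) *m P); split.
  - by rewrite !trmx_mul Ps raddfD /= trmxK addrC mulmxA.
  - by move=> k Sk; rewrite !mulmxA HS0 // !mul0mx.
  move=> k Tk; have := Hz k; rewrite mem_enum => /(_ Tk).
  rewrite -dp_mx -[z]vec_mxK -/Z -scalemxAl mxvec_dotmul.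
  have -> : dp (h k *m (P *m (Z + Z^T) *m P)) (h k) = 2 * (g k *m Z *m (g k)^T) 0 0.
    rewrite -dp_mx !mulmxA -(mulmxA _ P (h k)^T) mulmxDr mulmxDl mxE.
    have -> : P *m (h k)^T = (g k)^T by rewrite trmx_mul Ps.
    have tr u : u *m Z^T *m u^T = (u *m Z *m u^T)^T by rewrite !trmx_mul trmxK mulmxA.
    by rewrite tr [X in _ + X]mxE; ring.
  by rewrite mxE => H; rewrite mulrCA mulr_gt0.
case=> lam [l0 [k0 k0T lk0]] E; exfalso.
pose mu k := if T k then lam k else 0.
have mu0 k : 0 <= mu k by rewrite /mu; case: ifP => // Tk; apply: l0; rewrite mem_enum.
have Tk0 : T k0 by rewrite mem_enum in k0T.
suff : \sum_(k | cl k) mu k *: ((g k)^T *m g k) = \sum_(k | ~~ cl k) mu k *: ((g k)^T *m g k).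
  by move=> H; have := maxS mu0 H Tk0; rewrite /mu Tk0 => E0; move: lk0; rewrite E0 ltxx.
have E1 : \sum_k (sg k * mu k) *: ((g k)^T *m g k) = 0.
  apply: (can_inj mxvecK); rewrite linear0 linear_sum /= -[RHS]E big_enum_cond /= [RHS]big_mkcond /=.
  apply: eq_bigr => k _; rewrite linearZ /= /mu andbT (_ : (k \in T) = T k) //; case: (T k).
    by rewrite scalerA mulrC.
  by rewrite mulr0 scale0r.
apply/eqP; rewrite -subr_eq0; apply/eqP; rewrite -[RHS]E1 [RHS](bigID cl) /= -sumrN; congr (_ + _).
  by apply: eq_bigr => k ck; rewrite /sg ck mul1r.
by apply: eq_bigr => k /negPf ck; rewrite /sg ck mulN1r scaleNr.
Qed.


Section Flex.
Variables (A : 'M[F]_(1 + d)) (t : F).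
Hypothesis (As : A^T = A) (AS : forall k, S k -> h k *m A = 0) (t0 : 0 < t).
Hypothesis At : forall k, T k -> t * (dp (h k *m A) (h k *m A) / 2) < sg k * dp (h k *m A) (h k).

Let B := (t / 2) *: A.
(** For opposite signs [U k (U l)^T = I] exactly, while the squared norm of [h k] drops by [rho k]
    under [U k]. *)
Let U k : 'M[F]_(1 + d, (1 + d) + (1 + d)) := row_mx (1%:M - sg k *: B) B.
Let rho k := t * (sg k * dp (h k *m A) (h k)) - t ^+ 2 * (dp (h k *m A) (h k *m A) / 2).

Lemma rho_gt0 k : T k -> 0 < rho k.
Proof.
by move/At => H; rewrite /rho expr2 -mulrA -mulrBr mulr_gt0 // subr_gt0.
Qed.

Lemma rho_S k : S k -> rho k = 0.
Proof. by move=> Sk; rewrite /rho AS // !dp0l mul0r !mulr0 subrr. Qed.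

(** The last block restores the lost length. The map [pi] distributes the new coordinates: the
    identity separates all vertices, and vertices of one side may also share a coordinate. *)
Definition flex (pi : 'I_N -> 'I_N) k : 'rV[F]_((1 + d) + (1 + d) + N) :=
  row_mx (h k *m U k) (Num.sqrt (rho k) *: delta_mx 0 (pi k)).

Lemma dp_delta (i j : 'I_N) : @dp F N (delta_mx 0 i) (delta_mx 0 j) = (i == j)%:R.
Proof.
rewrite dpE (bigD1 i) //= big1 ?addr0 => [|k /negPf ki]; last by rewrite !mxE ki mul0r.
by rewrite !mxE !eqxx mul1r.
Qed.

Lemma dp_flex pi k l : dp (flex pi k) (flex pi l) = dp (h k *m U k) (h l *m U l) +
  Num.sqrt (rho k) * Num.sqrt (rho l) * (pi k == pi l)%:R.
Proof. by rewrite dp_row dpZl dpZr dp_delta mulrA. Qed.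

Lemma dp_B u v : dp (u *m B) v = dp u (v *m B).
Proof.
have Bs : B^T = B by rewrite /B linearZ /= As.
by rewrite -!dp_mx trmx_mul Bs mulmxA.
Qed.

Lemma dp_U k l : dp (h k *m U k) (h l *m U l) =
  dp (h k) (h l) - (sg k + sg l) * dp (h k *m B) (h l) +
  (1 + sg k * sg l) * dp (h k *m B) (h l *m B).
Proof.
rewrite /U !mul_mx_row dp_row !mulmxBr !mulmx1 -!(scalemxAr _ _ B).
rewrite dpBl !dpBr !dpZl !dpZr -(dp_B (h k)).
by ring.
Qed.

Lemma flex_norm pi k : dp (flex pi k) (flex pi k) = dp (h k) (h k).
Proof.
have r0 : 0 <= rho k.
  by case Sk: (S k); [rewrite rho_S|apply/ltW/rho_gt0; rewrite /T /= Sk].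
rewrite dp_flex eqxx mulr1 -expr2 sqr_sqrtr // dp_U /rho /B -!scalemxAr !dpZl !dpZr.
have s2 : sg k * sg k = 1 by rewrite /sg; case: ifP => _; ring.
by rewrite s2; field.
Qed.

Lemma flex_equiv pi : (forall k l, cl k -> ~~ cl l -> pi k != pi l) -> equivcfg x cl (flex pi).
Proof.
move=> Hpi k l ck nl; rewrite sqdistD !flex_norm dp_flex (negPf (Hpi k l ck nl)) mulr0 addr0 dp_U.
have -> : sg k = 1 by rewrite /sg ck.
have -> : sg l = -1 by rewrite /sg (negPf nl).
by rewrite /hat !dp_row sqdistD; ring.
Qed.

(** In the last block the vertices of [T] form a diagonal with nonzero entries, whereas those of [S]
    are zero there and keep [h k] in the first block, so the ranks add. *)
Lemma flex_rank : (\rank (Hm x S) + #|T| <= \rank (Hm (flex id) predT))%N.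
Proof.
pose q := fun k => row_mx (h k *m (1%:M - sg k *: B)) (Num.sqrt (rho k) *: delta_mx 0 k) : 'rV[F]_(1 + d + N).
pose M : 'M[F]_(N, 1 + d + N) := \matrix_k q k.
have le : (\rank M <= \rank (Hm (flex id) predT))%N.
  pose X : 'M[F]_(1 + ((1 + d) + (1 + d) + N), 1 + d + N) :=
    col_mx 0 (col_mx (col_mx (row_mx 1%:M 0) 0) (row_mx 0 1%:M)).
  have -> : M = Hm (flex id) predT *m X.
    apply/row_matrixP => k; rewrite row_mul !rowK /= /hat /flex /X mul_row_col mulmx0 add0r.
    rewrite mul_row_col {1}/U mul_mx_row mul_row_col !mul_mx_row !mulmx0 !mulmx1 addr0 add_row_mx.
    by rewrite addr0 add0r.
  exact: mxrankM_maxl.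
apply: leq_trans le; pose Y : 'M[F]_(1 + d + N, N) := col_mx 0 1%:M.
rewrite -(mxrank_mul_ker M Y) addnC; apply: leq_add.
  pose E : 'M[F]_(#|T|, N) := \matrix_i delta_mx 0 (enum_val i).
  pose E' : 'M[F]_(N, #|T|) := \matrix_(k, i) (if k == enum_val i then (Num.sqrt (rho k))^-1 else 0).
  have EE : E *m (M *m Y) *m E' = 1%:M.
    apply/row_matrixP => i; rewrite !row_mul rowK -rowE row_mul rowK /q /Y mul_row_col mulmx0 add0r mulmx1.
    apply/rowP => j; rewrite -scalemxAl mxE -rowE !mxE.
    have Ti : T (enum_val i) by have := enum_valP i.
    have := rho_gt0 Ti; rewrite -sqrtr_gt0 => /lt0r_neq0 r0.
    rewrite (inj_eq enum_val_inj); case: eqP => _; last by rewrite mulr0.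
    by rewrite mulfV.
  rewrite -[X in (X <= _)%N](mxrank1 F) -EE.
  exact: leq_trans (mxrankM_maxl _ _) (mxrankM_maxr _ _).
rewrite -(rank_row_mx0 N); apply: mxrankS; rewrite sub_capmx.
have E : row_mx (Hm x S) 0 = diag_mx (\row_k (S k)%:R) *m M.
  apply/row_matrixP => k; rewrite [RHS]row_mul row_diag_mx mxE -scalemxAl -rowE rowK; case Sk: (S k).
    rewrite scale1r /q rho_S // sqrtr0 scale0r mulmxBr mulmx1 /B -!scalemxAr AS // !scaler0 subr0.
    by rewrite row_row_mx rowK Sk row0.
  by rewrite scale0r row_row_mx rowK Sk row0 row_mx0.
rewrite {1}E submxMl /=; apply/sub_kermxP.
by rewrite mul_row_col mulmx0 mul0mx addr0.
Qed.

(** Letting [k] and [l] share a coordinate adds a positive term to their inner product and keeps all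
    norms; no bar joins them, so bar lengths survive. *)
Lemma flex_dist k l : k != l -> T k -> T l -> cl k = cl l ->
  exists p : 'I_N -> 'rV[F]_((1 + d) + (1 + d) + N),
    equivcfg x cl p /\ sqdist (p k) (p l) != sqdist (flex id k) (flex id l).
Proof.
move=> kl Tk Tl ckl; pose pi i := if i == l then k else i.
have cpi i : cl (pi i) = cl i by rewrite /pi; case: eqP => [->|].
exists (flex pi); split.
  by apply: flex_equiv => i j ci cj; apply: contraNneq cj => E; rewrite -cpi -E cpi.
rewrite !sqdistD !flex_norm !dp_flex /pi (negPf kl) !eqxx mulr0 mulr1 addr0.
have r0 := mulr_gt0 (_ : 0 < Num.sqrt (rho k)) (_ : 0 < Num.sqrt (rho l)).
have {}r0 : 0 < Num.sqrt (rho k) * Num.sqrt (rho l) by rewrite r0 // sqrtr_gt0 rho_gt0.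
apply/eqP => E; move: r0 E; set r := _ * _; lra.
Qed.

End Flex.

Lemma exists_flex : exists (A : 'M[F]_(1 + d)) (t : F),
  [/\ A^T = A, forall k, S k -> h k *m A = 0, 0 < t &
   forall k, T k -> t * (dp (h k *m A) (h k *m A) / 2) < sg k * dp (h k *m A) (h k)].
Proof.
have [A [As AS AT]] := separating_form.
have [|t t0 Ht] := @small_scale F 'I_N (enum T) (fun k => sg k * dp (h k *m A) (h k))
  (fun k => dp (h k *m A) (h k *m A) / 2).
  by move=> k; rewrite mem_enum; apply: AT.
by exists A, t; split=> // k Tk; apply: Ht; rewrite mem_enum.
Qed.

(** In any equivalent configuration [S] is an affine image of the original and each other vertex
    adds at most one dimension; the flex attains this maximum. *)
Lemma dimension_criterion :
  (forall D (p : 'I_N -> 'rV[F]_D), equivcfg x cl p -> (\rank (Hm p predT) <= \rank (Hm x predT))%N) <->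
  \rank (Hm x predT) = (\rank (Hm x S) + #|T|)%N.
Proof.
split=> [DR|E D p Ep].
  have [A [t [As AS t0 At]]] := exists_flex.
  apply/eqP; rewrite eqn_leq rank_Hm_split /=.
  apply: leq_trans (flex_rank AS t0 At) _; apply: DR.
  apply: flex_equiv => // k l ck; apply: contraNneq => <-; exact: ck.
rewrite E; apply: leq_trans (rank_Hm_split p S) _; rewrite leq_add2r.
have [Lam HL] := affS Ep.
have -> : Hm p S = Hm x S *m row_mx (col_mx 1%:M 0) Lam.
  apply/row_matrixP => k; rewrite row_mul !rowK; case Sk: (S k); last by rewrite mul0mx.
  by rewrite mul_mx_row {2}/hat mul_row_col mul1mx mulmx0 addr0 -HL.
exact: mxrankM_maxl.
Qed.

Lemma distance_criterion :
  (forall D (p : 'I_N -> 'rV[F]_D), equivcfg x cl p ->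
     forall k l, sqdist (p k) (p l) = sqdist (x k) (x l)) <->
  (forall k l, ~~ S k -> ~~ S l -> cl k = cl l -> k = l).
Proof.
split=> [UR k l Tk Tl ckl|H D p Ep k l].
  apply/eqP/negPn/negP => kl.
  have [A [t [As AS t0 At]]] := exists_flex.
  have [p [Ep /eqP[]]] := flex_dist As AS t0 At kl Tk Tl ckl.
  rewrite !UR //; apply: flex_equiv => // i j ci; apply: contraNneq => <-; exact: ci.
have [Lam HL] := affS Ep.
have [L [f [[iso yS _ _] yL]]] := displacement HP bS Ep HL.
have E a b : sqdist (row_mx (p a) 0 : 'rV[F]_(D + d)) (row_mx (p b) 0) = sqdist (p a) (p b).
  by rewrite !sqdistE opp_row_mx add_row_mx dp_row subrr dp0l addr0.
have sC n (u v : 'rV[F]_n) : sqdist u v = sqdist v u.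
  by apply: eq_bigr => i _; rewrite -sqrrN opprB.
(* The last clause of [displacement] applies to every vertex [a], also to those on the side of [b],
   where no bar fixes the distance. *)
have onS a b : S b -> sqdist (p a) (p b) = sqdist (x a) (x b).
  move=> Sb; rewrite -E -iso; have := yL a b Sb; have /eqP := yS _ Sb.
  by rewrite subr_eq0 => /eqP ->; rewrite !sqdistD dpBl => H1; lra.
case Sk: (S k); first by rewrite sC onS // sC.
case Sl: (S l); first exact: onS.
case ck: (cl k); case cl': (cl l).
- by rewrite (H k l) ?Sk ?Sl ?ck ?cl' // !sqdistE !subrr !dp0l.
- by apply: Ep; rewrite ?ck ?cl'.
- by rewrite sC Ep ?ck ?cl' // sC.
- by rewrite (H k l) ?Sk ?Sl ?ck ?cl' // !sqdistE !subrr !dp0l.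
Qed.

End Classify.

(** * Correctness of the rounds *)

Lemma rowsmx_sub (F : realFieldType) n m (l : seq (seq int)) (A : 'M[F]_(m, n)) :
  (forall a, a \in l -> (rv F n a <= A)%MS) -> (rowsmx F n l <= A)%MS.
Proof.
move=> HA; rewrite /rowsmx big_seq; apply: (big_ind (fun M : 'M_n => M <= A)%MS).
- exact: sub0mx.
- by move=> B C hB hC; rewrite addsmx_sub hB hC.
- by move=> a al; rewrite genmxE HA.
Qed.

Lemma rv_mulv_im (F : realFieldType) n (Q : seq (seq int)) a :
  rv F n (mulv n Q a) = rv F n a *m (map_mx intr (im n Q))^T.
Proof.
have E := congr1 trmx (mulvE n Q a); rewrite trmxK trmx_mul trmxK in E.
by rewrite /rv E map_mxM map_trmx.
Qed.

Lemma rv_mkseq (F : realFieldType) n (f : nat -> int) (k : 'I_n) :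
  rv F n (mkseq f n) 0 k = (f k)%:~R.
Proof. by rewrite !mxE nth_mkseq. Qed.

Lemma cnt_card n (f : nat -> bool) : cnt n f = #|[pred k : 'I_n | f k]|.
Proof.
rewrite /cnt (sumn_nth (size_mkseq _ n)) -sum1_card [RHS]big_mkcond /=.
by apply: eq_bigr => k _; rewrite nth_mkseq // inE.
Qed.

Section Rounds.
Variables (F : rcfType) (N d n0 : nat) (x : 'I_N -> 'rV[F]_d) (H : seq (seq int)) (Dn : 'I_N -> F).
Hypothesis (sH : size H = N) (D0 : forall k, 0 < Dn k).
Hypothesis HH : forall k : 'I_N, rv F (1 + d) (nth [::] H k) = Dn k *: hat x k.
Notation h := (hat x).

Let cl : pred 'I_N := fun k => (k < n0)%N.
Definition mem_of (S : seq bool) : pred 'I_N := fun k => nth false S k.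
Notation PS S := (pmx F (1 + d) (sel N H S)).
Let dd S : F := ((proj (1 + d) (sel N H S)).1.2)%:~R.
Notation g S := (fun k => h k *m PS S).

Lemma rowsmx_sel S : (rowsmx F (1 + d) (sel N H S) :=: Hm x (mem_of S))%MS.
Proof.
apply/eqmxP/andP; split.
  apply: rowsmx_sub => a /mem_mkseqP[i iN ->]; case Si: (nth false S i); last first.
    have -> : rv F (1 + d) [::] = 0 by apply/rowP => j; rewrite !mxE nth_nil.
    exact: sub0mx.
  by rewrite (HH (Ordinal iN)); apply: scalemx_sub; apply: mem_Hm.
apply: Hm_sub => k Sk.
have : (rv F (1 + d) (nth [::] H k) <= rowsmx F (1 + d) (sel N H S))%MS.
  apply: mem_rowsmx; have := mkseq_mem (fun k => if nth false S k then nth [::] H k else [::]) (ltn_ord k).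
  by rewrite (Sk : nth false S k).
by rewrite HH eqmx_scale // gt_eqF.
Qed.

Lemma sel_spec S : [/\ (PS S)^T = PS S, forall k, mem_of S k -> h k *m PS S = 0,
   (1%:M - PS S <= Hm x (mem_of S))%MS, 0 < dd S &
   \rank (Hm x (mem_of S)) = (proj d.+1 (sel N H S)).2].
Proof.
have [dd0 _ Ps _ [RP sub rk]] := proj_spec F (1 + d) (sel N H S).
split=> //; last 3 first.
- by rewrite -(rowsmx_sel S).
- by rewrite /dd ltr0z.
- by rewrite -(rowsmx_sel S) rk.
move=> k Sk; have : (h k <= rowsmx F (1 + d) (sel N H S))%MS by rewrite rowsmx_sel mem_Hm.
by case/submxP=> u ->; rewrite -mulmxA RP mulmx0.
Qed.

Let cc S k := dd S * Dn k.

Lemma cc_gt0 S k : 0 < cc S k.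
Proof. by rewrite mulr_gt0 //; case: (sel_spec S). Qed.

Lemma gvecE S (k : 'I_N) i : (i < 1 + d)%N ->
  (nth 0 (nth [::] (gvec N d.+1 H S) k) i)%:~R = cc S k * (g S k) 0 (inord i).
Proof.
move=> lt; have E : rv F (1 + d) (nth [::] (gvec N d.+1 H S) k) = cc S k *: g S k.
  rewrite /gvec nth_mkseq // rv_mulv_im HH.
  have [_ -> Ps _ _] := proj_spec F (1 + d) (sel N H S).
  by rewrite linearZ /= Ps -scalemxAr -scalemxAl scalerA.
have := congr1 (fun A : 'rV_(1 + d) => A 0 (Ordinal lt)) E; rewrite !mxE => ->.
by congr (_ * _); apply: eq_bigr => j _; congr (_ * PS S _ _); apply: val_inj; rewrite /= inordK.
Qed.

Definition balanced_at S (mu : 'I_N -> F) :=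
  \sum_(k | cl k) mu k *: ((g S k)^T *m g S k) = \sum_(k | ~~ cl k) mu k *: ((g S k)^T *m g S k).

(** The computed integer vectors are positive multiples of the true projections, so weights change
    by squares of these factors and supports do not change. *)
Lemma sol_qrows S (lam : 'rV[F]_N) : sol (qrows n0 N d.+1 (gvec N d.+1 H S)) lam <->
  balanced_at S (fun k => lam 0 k * cc S k ^+ 2).
Proof.
pose e i j := \sum_(k | cl k) lam 0 k * cc S k ^+ 2 * ((g S k) 0 i * (g S k) 0 j) -
   \sum_(k | ~~ cl k) lam 0 k * cc S k ^+ 2 * ((g S k) 0 i * (g S k) 0 j).
have row_e (i j : nat) : (i < 1 + d)%N -> (j < 1 + d)%N ->
   rv F N (mkseq (fun k => let y := (nth 0 (nth [::] (gvec N d.+1 H S) k) i *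
      nth 0 (nth [::] (gvec N d.+1 H S) k) j)%R in if (k < n0)%N then y else (- y)%R) N) *m lam^T = (e (inord i) (inord j))%:M.
  move=> li lj; rewrite [LHS]mx11_scalar; congr _%:M.
  rewrite mxE /e (bigID cl) /= -sumrN; congr (_ + _); apply: eq_bigr => k ck; rewrite rv_mkseq [lam^T k 0]mxE.
    by rewrite (ck : (k < n0)%N) rmorphM /= !gvecE //; ring.
  by rewrite (negPf (ck : ~~ (k < n0)%N)) rmorphN rmorphM /= !gvecE //; ring.
have bal_e : balanced_at S (fun k => lam 0 k * cc S k ^+ 2) <-> forall i j, e i j = 0.
  have ent (Q : pred 'I_N) i j :
     (\sum_(k | Q k) (lam 0 k * cc S k ^+ 2) *: ((g S k)^T *m g S k)) i j =
     \sum_(k | Q k) lam 0 k * cc S k ^+ 2 * ((g S k) 0 i * (g S k) 0 j).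
    rewrite summxE; apply: eq_bigr => k _; rewrite mxE; congr (_ * _).
    by rewrite mxE big_ord1 [X in X * _]mxE.
  split=> [E i j|E]; first by rewrite /e -!ent E subrr.
  by apply/matrixP => i j; rewrite !ent; apply/eqP; rewrite -subr_eq0; apply/eqP/E.
rewrite bal_e; split=> [Hs i j|He a].
  have := row_e i j (ltn_ord i) (ltn_ord j); rewrite Hs.
    by rewrite !inord_val => /esym/(congr1 (fun A : 'M_1 => A 0 0)); rewrite !mxE eqxx mulr1n.
  apply/flattenP; eexists; first by apply: mkseq_mem (ltn_ord i).
  exact: (mkseq_mem _ (ltn_ord j)).
case/flattenP=> r /mem_mkseqP[i li ->] /mem_mkseqP[j lj ->].
by rewrite row_e // He raddf0.
Qed.

Lemma round_spec S :
  (exists2 mu : 'I_N -> F, balanced_at S mu & (forall k, 0 <= mu k) /\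
      (forall k, mem_of (round n0 N d.+1 H S) k = (0 < mu k))) /\
  (forall mu : 'I_N -> F, balanced_at S mu -> (forall k, 0 <= mu k) ->
     forall k, ~~ mem_of (round n0 N d.+1 H S) k -> mu k = 0).
Proof.
have c0 k : 0 < cc S k ^+ 2 by rewrite exprn_gt0 ?cc_gt0.
have [[lam sl Hl] mx] := supp_spec F N (qrows n0 N d.+1 (gvec N d.+1 H S)); split.
  exists (fun k => lam 0 k * cc S k ^+ 2); first exact/sol_qrows.
  have K k : mem_of (round n0 N d.+1 H S) k = (0 < lam 0 k * cc S k ^+ 2) /\ 0 <= lam 0 k.
    rewrite pmulr_lgt0 //; have := Hl k; rewrite /mem_of /round; case: nth => [lk|/eqP ->].
      by rewrite lk ltW.
    by rewrite ltxx.
  by split=> k; have [e l0] := K k => //; rewrite mulr_ge0 // ltW.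
move=> mu bm m0 k nk; have E : balanced_at S (fun k => (\row_k (mu k / cc S k ^+ 2)) 0 k * cc S k ^+ 2).
  have E k' : (\row_k (mu k / cc S k ^+ 2)) 0 k' * cc S k' ^+ 2 = mu k'.
    by rewrite mxE divfK // gt_eqF.
  by rewrite /balanced_at; under eq_bigr do rewrite E; under [RHS]eq_bigr do rewrite E.
have := mx (\row_k (mu k / cc S k ^+ 2)) ((sol_qrows S _).2 E) _ k nk.
rewrite mxE => /(_ _)/eqP; rewrite mulf_eq0 invr_eq0 (gt_eqF (c0 k)) orbF => /(_ _)/eqP; apply.
by move=> j; rewrite mxE divr_ge0 // ltW.
Qed.

Definition settled S := balanced x cl (mem_of S) /\
  forall D (p : 'I_N -> 'rV[F]_D), equivcfg x cl p ->
    exists Lam : 'M[F]_(1 + d, D), forall k, mem_of S k -> p k = h k *m Lam.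

(** Vertices of [S] project to zero, so a unit weight at [k] alone is balanced, and the largest
    support contains [k]. *)
Lemma sub_round S k : mem_of S k -> mem_of (round n0 N d.+1 H S) k.
Proof.
move=> Sk; have [_ HS0 _ _ _] := sel_spec S; apply: contraTT isT => nk.
have [_ mx] := round_spec S.
have b1 : balanced_at S (fun j => (j == k)%:R).
  have z (Q : pred 'I_N) : \sum_(j | Q j) (j == k)%:R *: ((g S j)^T *m g S j) = 0.
    apply: big1 => j _; case: eqP => [->|_]; last by rewrite scale0r.
    by rewrite HS0 // mulmx0 scaler0.
  by rewrite /balanced_at !z.
have /eqP := mx _ b1 (fun j => ler0n _ _) k nk.
by rewrite eqxx oner_eq0.
Qed.

Lemma settled_round S : settled S -> settled (round n0 N d.+1 H S).
Proof.
case=> b a; have [_ HS0 HP _ _] := sel_spec S.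
have [[mu bm [m0 Km]] _] := round_spec S.
have SK k : mem_of S k -> 0 < mu k by move/sub_round; rewrite Km.
have bK := step_balanced HP b m0 SK bm.
have E : mem_of (round n0 N d.+1 H S) =1 (fun k => 0 < mu k) by [].
have HE (Q Q' : pred 'I_N) : Q =1 Q' -> Hm x Q = Hm x Q'.
  by move=> e; apply/row_matrixP => k; rewrite !rowK e.
split.
  rewrite /balanced (HE (pos cl _) (pos cl (fun k => 0 < mu k))) => [|k]; last by rewrite /pos E.
  by rewrite (HE (neg cl _) (neg cl (fun k => 0 < mu k))) => [|k]; last by rewrite /neg E.
move=> D p Ep; have [Lam HL] := a D p Ep.
have [Lam' HL'] := step_affine HP b m0 bm Ep HL.
by exists Lam' => k; rewrite E; apply: HL'.
Qed.

Lemma settled_nil : settled [::].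
Proof.
have Z (Q : pred 'I_N) : Q =1 pred0 -> Hm x Q = 0.
  by move=> e; apply/row_matrixP => k; rewrite rowK e row0.
split; last by move=> D p _; exists 0 => k; rewrite /mem_of nth_nil.
by rewrite /balanced !Z ?submx_refl // => k; rewrite /neg /pos /mem_of nth_nil.
Qed.

Lemma round_ext S S' : mem_of S =1 mem_of S' -> round n0 N d.+1 H S = round n0 N d.+1 H S'.
Proof.
move=> E; suff ES : sel N H S = sel N H S' by rewrite /round /gvec ES.
apply/eq_in_map => k; rewrite mem_iota add0n => /andP[_ kN].
by have := E (Ordinal kN); rewrite /mem_of /= => ->.
Qed.

Lemma finalS_settled : settled (finalS n0 N d.+1 H).
Proof.
suff G i : settled (iter i (round n0 N d.+1 H) [::]) by exact: G.
by elim: i => [|i IH]; [exact: settled_nil|rewrite iterS; apply: settled_round].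
Qed.

(** A round that changes the set adds a vertex, and a set that is stable once remains so; [N] rounds
    therefore reach stability. *)
Lemma finalS_fix : mem_of (round n0 N d.+1 H (finalS n0 N d.+1 H)) =1 mem_of (finalS n0 N d.+1 H).
Proof.
pose Si i := iter i (round n0 N d.+1 H) [::].
suff G i : mem_of (Si i.+1) =1 mem_of (Si i) \/ (i < #|mem_of (Si i.+1)|)%N.
  case: (G N) => // lt; have := max_card (mem_of (Si N.+1)); by rewrite card_ord leqNgt lt.
have grow S : mem_of (round n0 N d.+1 H S) =1 mem_of S \/
    (#|mem_of S| < #|mem_of (round n0 N d.+1 H S)|)%N.
  case: (boolP [exists k, mem_of (round n0 N d.+1 H S) k && ~~ mem_of S k]) => [|/existsPn nx].
    case/existsP=> k /andP[k1 k2]; right; apply: proper_card; apply/properP; split.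
      by apply/subsetP => j; apply: sub_round.
    by exists k.
  left=> k; apply/idP/idP; last exact: sub_round.
  by move=> k1; have := nx k; rewrite k1 /= negbK.
elim: i => [|i [IH|IH]].
- by case: (grow [::]) => [|lt]; [left|right; apply: leq_ltn_trans lt].
- by left=> k; rewrite /Si !(iterS i.+1) -/(Si i.+1) (round_ext IH) -iterS.
- case: (grow (Si i.+1)) => [e|lt]; [by left|right].
  exact: leq_ltn_trans IH lt.
Qed.

Lemma verdict_spec : let v := verdict n0 N d.+1 H (finalS n0 N d.+1 H) in
  (v.1 <-> forall D (p : 'I_N -> 'rV[F]_D), equivcfg x cl p ->
     (\rank (Hm p predT) <= \rank (Hm x predT))%N) /\
  (v.2 <-> forall D (p : 'I_N -> 'rV[F]_D), equivcfg x cl p ->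
     forall k l, sqdist (p k) (p l) = sqdist (x k) (x l)).
Proof.
set S := finalS n0 N d.+1 H; move=> v.
have [b a] := finalS_settled; have fx := finalS_fix; rewrite -/S in b a fx.
have [Ps HS0 HP _ rS] := sel_spec S.
have mx (lam : 'I_N -> F) : (forall k, 0 <= lam k) -> balanced_at S lam ->
    forall k, ~~ mem_of S k -> lam k = 0.
  by move=> l0 bl k nk; apply: (round_spec S).2 => //; rewrite fx.
have C1 := dimension_criterion Ps HS0 a mx.
have C2 := distance_criterion Ps HS0 HP b a mx.
split.
  apply: iff_trans (iff_sym C1); rewrite rS /v /verdict /= cnt_card.
  (* The rank computed from all rows is an instance of [sel_spec], with the mask that selects
     everything. *)
  have EH : sel N H (nseq N true) = H.
    rewrite -[RHS](mkseq_nth [::]) sH; apply/eq_in_map => k; rewrite mem_iota add0n => /andP[_ kN].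
    by rewrite nth_nseq kN.
  have [_ _ _ _ rT] := sel_spec (nseq N true); rewrite EH in rT.
  have -> : Hm x predT = Hm x (mem_of (nseq N true)).
    by apply/row_matrixP => k; rewrite !rowK /mem_of nth_nseq ltn_ord.
  by rewrite rT; split=> /eqP.
apply: iff_trans (iff_sym C2); rewrite /v /verdict /= !cnt_card; split.
  case/andP=> /card_le1_eqP c1 /card_le1_eqP c2 k l nk nl ckl; case ck: (cl k).
    by apply: c1; rewrite inE ?nk ?nl /= -/(cl _) -?ckl ck.
  by apply: c2; rewrite inE ?nk ?nl /= leqNgt -/(cl _) -?ckl ck.
move=> E; apply/andP; split; apply/card_le1_eqP => k l; rewrite !inE => /andP[nk ck] /andP[nl cl'].
  by apply: E => //; rewrite /cl ck cl'.
by apply: E => //; rewrite /cl !ltnNge ck cl'.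
Qed.

End Rounds.

(** * Reading the input *)

Definition bitsym (x : nat) : bool := (0 < x < 5)%N && (x != 3%N).

Definition sepcat (ts : seq (seq nat)) : seq nat := flatten [seq 3%N :: t | t <- ts].

Lemma sepcat_cat s t : sepcat (s ++ t) = sepcat s ++ sepcat t.
Proof. by rewrite /sepcat map_cat flatten_cat. Qed.

Lemma sepcat_flatten ss : sepcat (flatten ss) = flatten [seq sepcat s | s <- ss].
Proof. by elim: ss => //= s ss IH; rewrite sepcat_cat IH. Qed.

Lemma tokens_sepcat t ts : all bitsym t -> all (all bitsym) ts -> tokens (t ++ sepcat ts) = t :: ts.
Proof.
elim: ts t => [|u ts IH] t.
  rewrite cats0 => + _; elim: t => // x t IH /andP[/andP[_ /negPf x3] bt].
  by rewrite tokens_cons x3 IH.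
move=> + /andP[bu bts]; elim: t => [_|x t IHt /andP[/andP[_ /negPf x3] bt]].
  by rewrite cat0s [sepcat _]/= tokens_cons /= IH.
by rewrite cat_cons tokens_cons x3 IHt.
Qed.

Lemma sepcat_sym ts : all (all bitsym) ts -> all (fun x => 0 < x < 5)%N (sepcat ts).
Proof.
elim: ts => //= t ts IH /andP[bt /IH h]; rewrite all_cat h andbT.
by apply: sub_all bt => x /andP[].
Qed.

Lemma size_sepcat ts : (size ts <= size (sepcat ts))%N.
Proof. by elim: ts => //= t ts IH; rewrite size_cat -/(sepcat ts); lia. Qed.

Lemma pos_bits_sym x : all bitsym (pos_bits x).
Proof. by elim: x. Qed.

Lemma enc_nat_sym k : all bitsym (enc_nat k).
Proof. by rewrite /enc_nat; case: (N.of_nat k) => // x; apply: pos_bits_sym. Qed.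

Lemma enc_int_sym z : all bitsym (enc_int z).
Proof. by case: z => k; rewrite /enc_int ?enc_nat_sym //= enc_nat_sym. Qed.

Lemma tokN_enc k : tokN (enc_nat k) = N.of_nat k.
Proof.
rewrite /tokN /Nval foldl_rev /enc_nat; case: (N.of_nat k) => // x.
by elim: x => //= x ->.
Qed.

Lemma enc_nat_head k : (head 0%N (enc_nat k) == 4%N) = false.
Proof. by rewrite /enc_nat; case: (N.of_nat k) => // -[]. Qed.

Lemma tokZ_nat k : tokZ (enc_nat k) = k%:Z.
Proof. by rewrite /tokZ enc_nat_head tokN_enc /mkint; congr Posz; lia. Qed.

Lemma tokZ_int z : tokZ (enc_int z) = z.
Proof.
case: z => k; first exact: tokZ_nat.
by rewrite /tokZ /enc_int /= tokN_enc NegzE; congr (- Posz _); lia.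
Qed.

Lemma nth_flatten_const (T : eqType) (x0 : T) b (ss : seq (seq T)) k j :
  (forall s, s \in ss -> size s = b) -> (k < size ss)%N -> (j < b)%N ->
  nth x0 (flatten ss) (k * b + j) = nth x0 (nth [::] ss k) j.
Proof.
elim: ss k => // s ss IH [|k] Hs /= lk lj; rewrite nth_cat Hs ?mem_head //.
  by rewrite mul0n add0n lj.
rewrite mulSn -addnA ltnNge leq_addr /= addKn IH // => t ts.
by apply: Hs; rewrite inE ts orbT.
Qed.

Lemma size_flatten_const (T : eqType) b (ss : seq (seq T)) :
  (forall s, s \in ss -> size s = b) -> size (flatten ss) = (size ss * b)%N.
Proof.
elim: ss => // s ss IH Hs /=; rewrite size_cat Hs ?mem_head // mulSn IH // => t ts.
by apply: Hs; rewrite inE ts orbT.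
Qed.

Lemma all_flat (T : Type) (a : pred T) ss : all a (flatten ss) = all (all a) ss.
Proof. by elim: ss => //= s ss IH; rewrite all_cat IH. Qed.

Lemma zprod_mkseq f n : zprod (mkseq f n) = \prod_(j < n) f j.
Proof. by rewrite /zprod foldrE big_map -[n]/(0 + n)%N /index_iota -{1}[n]subn0 big_mkord. Qed.

Section Parse.
Variables (n m d : nat) (p : 'I_n -> 'rV[rat]_d) (q : 'I_m -> 'rV[rat]_d).
Let X := allpts p q.

Let blk (v : 'rV[rat]_d) : seq (seq nat) :=
  flatten [seq [:: enc_int (numq (v 0 j)); enc_nat (absz (denq (v 0 j)))] | j <- enum 'I_d].
Let blks := [seq blk (p i) | i <- enum 'I_n] ++ [seq blk (q j) | j <- enum 'I_m].
Let toks := [:: enc_nat n, enc_nat m, enc_nat d & flatten blks].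

Lemma sepcat_blk v : sepcat (blk v) = flatten [seq 3%N :: enc_rat (v 0 k) | k <- enum 'I_d].
Proof.
rewrite /blk sepcat_flatten -map_comp; congr flatten; apply: eq_map => j /=.
by rewrite /sepcat /= cats0.
Qed.

Lemma enc_frameworkE : enc_framework p q = enc_nat n ++ sepcat (behead toks).
Proof.
have E (s : seq (seq nat)) t : sepcat (t :: s) = 3%N :: t ++ sepcat s by [].
rewrite /enc_framework /toks /= !E sepcat_flatten /blks map_cat -!map_comp flatten_cat.
by congr (_ ++ _ :: _ ++ _ :: _ ++ flatten _ ++ flatten _); apply: eq_map => i /=; rewrite sepcat_blk.
Qed.

Lemma blk_sym v : all (all bitsym) (blk v).
Proof.
rewrite /blk all_flat all_map; apply/allP => j _ /=.
by rewrite enc_int_sym enc_nat_sym.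
Qed.

Lemma toks_sym : all (all bitsym) toks.
Proof.
rewrite /toks /= !enc_nat_sym /= all_flat /blks all_cat !all_map.
by apply/andP; split; apply/allP => i _ /=; apply: blk_sym.
Qed.

Lemma enc_framework_sym : all (fun x => 0 < x < 5)%N (enc_framework p q).
Proof.
rewrite enc_frameworkE all_cat sepcat_sym ?andbT; last by have /andP[] := toks_sym.
by apply: sub_all (enc_nat_sym n) => x /andP[].
Qed.

Lemma tokens_framework : tokens (enc_framework p q) = toks.
Proof. by rewrite enc_frameworkE; have /andP[h1 h2] := toks_sym; rewrite tokens_sepcat. Qed.

Lemma size_blk v : size (blk v) = (d * 2)%N.
Proof.
rewrite /blk (@size_flatten_const _ 2) => [|s /mapP[j _ ->] //].
by rewrite size_map size_enum_ord.
Qed.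

Lemma size_blks s : s \in blks -> size s = (d * 2)%N.
Proof. by rewrite mem_cat => /orP[] /mapP[j _ ->]; apply: size_blk. Qed.

Lemma nth_blks (k : 'I_(n + m)) : nth [::] blks k = blk (X k).
Proof.
rewrite /blks nth_cat size_map size_enum_ord /X /allpts; case: splitP => i ->.
  by rewrite (nth_map i) ?size_enum_ord // nth_ord_enum.
by rewrite addKn (nth_map i) ?size_enum_ord // nth_ord_enum.
Qed.

Lemma size_blks_nm : size blks = (n + m)%N.
Proof.
by rewrite /blks size_cat (size_map _ (enum 'I_n)) (size_map _ (enum 'I_m)) 2!size_enum_ord.
Qed.

Lemma size_toks : size toks = (3 + (n + m) * (d * 2))%N.
Proof.
by rewrite /toks /= (size_flatten_const size_blks) size_blks_nm.
Qed.

(** The offset 3 skips the header; [e] chooses between numerator and denominator. *)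
Lemma nth_toks (k : 'I_(n + m)) (j : 'I_d) (e : nat) : (e < 2)%N ->
  nth [::] toks (3 + e + 2 * (k * d + j)) =
  if e == 0%N then enc_int (numq (X k 0 j)) else enc_nat (absz (denq (X k 0 j))).
Proof.
move=> le; have -> : (3 + e + 2 * (k * d + j) = (k * (d * 2) + (j * 2 + e)).+3)%N by lia.
rewrite /toks [LHS]/= (nth_flatten_const _ size_blks); last 2 first.
- by rewrite size_blks_nm.
- by have := ltn_ord j; lia.
rewrite nth_blks /blk nth_flatten_const //; last 2 first.
- by move=> s /mapP[i _ ->].
- by rewrite size_map size_enum_ord.
rewrite (nth_map j) ?size_enum_ord // nth_ord_enum.
by case: e le => [|[|]].
Qed.

Lemma cnumE (k : 'I_(n + m)) (j : 'I_d) : cnum toks d k j = numq (X k 0 j).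
Proof. by rewrite /cnum -[3%N]/(3 + 0)%N nth_toks // tokZ_int. Qed.

Lemma cdenE (k : 'I_(n + m)) (j : 'I_d) : cden toks d k j = denq (X k 0 j).
Proof.
rewrite /cden -[4%N]/(3 + 1)%N nth_toks // tokZ_nat.
by have := denq_gt0 (X k 0 j); lia.
Qed.

Lemma allpts_realize k : allpts (realize p) (realize q) k = map_mx ratr (X k) :> 'rV[Rdefinitions.R]_d.
Proof. by rewrite /X /allpts; case: split. Qed.

Lemma hatvE (k : 'I_(n + m)) :
  rv Rdefinitions.R (1 + d) (hatv toks d k) =
  (\prod_(j < d) (denq (X k 0 j))%:~R) *: hat (allpts (realize p) (realize q)) k.
Proof.
apply/rowP => i; rewrite [LHS]mxE [X in X%:~R]mxE [RHS]mxE /hat.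
have [j ->|j ->] := split_ordP i.
  rewrite row_mxEl ord1 mxE eqxx mulr1 /= zprod_mkseq rmorph_prod /=.
  by apply: eq_bigr => l _; rewrite cdenE.
rewrite row_mxEr allpts_realize mxE /= nth_mkseq; last exact: ltn_ord.
rewrite zprod_mkseq rmorphM rmorph_prod /= cnumE (bigD1 j) //= eqxx mul1r [in RHS](bigD1 j) //=.
rewrite (eq_bigr (fun l => (denq (X k 0 l))%:~R)) => [|l lj].
  rewrite /ratr; set a := (numq _)%:~R; set b := (denq _)%:~R; set c := \prod_(_ | _) _.
  have b0 : b != 0 by rewrite /b intr_eq0 denq_neq0.
  by rewrite [RHS]mulrC mulrA divfK.
by rewrite (_ : (l == j :> nat) = false) ?cdenE //; apply: negbTE.
Qed.

End Parse.

(** * Correctness of the decision procedure *)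

Local Notation RR := Rdefinitions.R.

Definition dim_rigid N d (x : 'I_N -> 'rV[RR]_d) (cl : pred 'I_N) :=
  forall D (p : 'I_N -> 'rV[RR]_D), equivcfg x cl p -> (affdim p <= affdim x)%N.

Definition univ_rigid N d (x : 'I_N -> 'rV[RR]_d) (cl : pred 'I_N) :=
  forall D (p : 'I_N -> 'rV[RR]_D), equivcfg x cl p ->
    forall k l, sqdist (p k) (p l) = sqdist (x k) (x l).

Section Bipartite.
Variables (n m : nat).
Let cl : pred 'I_(n + m) := fun k => (k < n)%N.

Lemma allpts_split D (P : 'I_(n + m) -> 'rV[RR]_D) :
  allpts (fun i => P (lshift m i)) (fun j => P (rshift n j)) = P.
Proof.
apply: functional_extensionality => k; rewrite /allpts; case: splitP => i E; congr P; exact: val_inj.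
Qed.

Lemma same_bars_equivcfg d D (p : 'I_n -> 'rV[RR]_d) (q : 'I_m -> 'rV[RR]_d)
    (p' : 'I_n -> 'rV[RR]_D) (q' : 'I_m -> 'rV[RR]_D) :
  same_bars p q p' q' <-> equivcfg (allpts p q) cl (allpts p' q').
Proof.
split=> [H k l|H i j].
  by rewrite /cl /allpts; case: splitP => i _; case: splitP => j _ //= _ _; apply: H.
have := H (lshift m i) (rshift n j); rewrite /cl /= ltn_ord ltnNge leq_addr => /(_ isT isT).
by rewrite /allpts (unsplitK (inl i)) (unsplitK (inr j)).
Qed.

Lemma dimensionally_rigidE d (p : 'I_n -> 'rV[RR]_d) (q : 'I_m -> 'rV[RR]_d) :
  dimensionally_rigid p q <-> dim_rigid (allpts p q) cl.
Proof.
split=> H D => [P EP|p' q' /same_bars_equivcfg]; last exact: H.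
by rewrite -(allpts_split P); apply: H; apply/same_bars_equivcfg; rewrite allpts_split.
Qed.

Lemma universally_rigidE d (p : 'I_n -> 'rV[RR]_d) (q : 'I_m -> 'rV[RR]_d) :
  universally_rigid p q <-> univ_rigid (allpts p q) cl.
Proof.
split=> H D => [P EP|p' q' /same_bars_equivcfg]; last exact: H.
by rewrite -(allpts_split P); apply: H; apply/same_bars_equivcfg; rewrite allpts_split.
Qed.

End Bipartite.

Lemma affdim_eq0 (F : realFieldType) N d (x : 'I_N -> 'rV[F]_d) :
  affdim x = 0%N <-> forall k l, x k = x l.
Proof.
split=> [E k l|E]; last first.
  by rewrite /affdim big1 ?mxrank0 // => k _; rewrite big1 // => l _; rewrite (E k l) subrr genmx0.
have : (<<x k - x l>> <= (\sum_(k < N) \sum_(l < N) <<x k - x l>>))%MS.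
  by apply: (sumsmx_sup k) => //; apply: (sumsmx_sup l).
move/eqP: E; rewrite /affdim mxrank_eq0 => /eqP ->.
by rewrite genmxE submx0 subr_eq0 => /eqP.
Qed.

Lemma sqdist_eq0 (F : realFieldType) d (u v : 'rV[F]_d) : sqdist u v = 0 -> u = v.
Proof. by rewrite sqdistE => /dp_eq0/eqP; rewrite subr_eq0 => /eqP. Qed.

Lemma sqdist_xx (F : realFieldType) d (u : 'rV[F]_d) : sqdist u u = 0.
Proof. by rewrite sqdistE subrr dp0l. Qed.

(* All points coincide, so the framework is rigid in either sense exactly when
   the bars connect it. *)
Lemma trivial_rigid N d (x : 'I_N -> 'rV[RR]_d) (cl : pred 'I_N) (b : bool) :
  (forall k l, x k = x l) ->
  (b <-> ((exists k, cl k) /\ (exists l, ~~ cl l)) \/ (N <= 1)%N) ->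
  (b <-> dim_rigid x cl) /\ (b <-> univ_rigid x cl).
Proof.
move=> Ex Hb; have x0 := (affdim_eq0 x).2 Ex.
have xx k l : sqdist (x k) (x l) = 0 by rewrite (Ex k l) sqdist_xx.
case: b Hb => -[b1 b2].
  have E D (p : 'I_N -> 'rV[RR]_D) : equivcfg x cl p -> forall k l, p k = p l.
    move=> Ep k l; case: (b1 isT) => [[[k0 ck0] [l0 cl0]]|N1]; last first.
      by congr p; apply: val_inj => /=; have := ltn_ord k; have := ltn_ord l; lia.
    have E i j : cl i -> ~~ cl j -> p i = p j.
      by move=> ci cj; apply: sqdist_eq0; rewrite Ep.
    have E0 i : p i = p l0.
      by case ci: (cl i); [apply: E|rewrite -(E k0 l0) // (E k0 i) // ci].
    by rewrite E0 [RHS]E0.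
  split; split=> // _ D p Ep.
    by rewrite (affdim_eq0 p).2 //; apply: E.
  by move=> k l; rewrite (E D p Ep k l) sqdist_xx xx.
have [p Ep [k [l pkl]]] : exists2 p : 'I_N -> 'rV[RR]_1, equivcfg x cl p & exists k l, p k <> p l.
  have N1 : (1 < N)%N by rewrite ltnNge; apply/negP => N1; have := b2 (or_intror N1).
  pose k0 := Ordinal (ltnW N1); pose k1 := Ordinal N1.
  (* One side is empty, so there are no bars and any configuration qualifies: one point at 1, the
     others at 0. *)
  exists (fun k => const_mx (k == k0)%:R); last first.
    exists k0, k1 => /(congr1 (fun A : 'rV_1 => A 0 0)); rewrite !mxE eqxx /= => /eqP.
    by rewrite oner_eq0.
  move=> k l ck cl'; have // := b2 (or_introl _).
  by have := b2 (or_introl (conj (ex_intro _ k ck) (ex_intro _ l cl'))).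
split; split=> // H; exfalso; apply: pkl.
  by apply: (affdim_eq0 p).1; have := H _ p Ep; rewrite x0 leqn0 => /eqP.
by apply: sqdist_eq0; rewrite H.
Qed.

Section Decide.
Variables (n m d : nat) (p : 'I_n -> 'rV[rat]_d) (q : 'I_m -> 'rV[rat]_d).
Let w := enc_framework p q.
Let x := allpts (realize p) (realize q).
Let cl : pred 'I_(n + m) := fun k => (k < n)%N.

Lemma decide_spec : ((decide w).1 <-> dim_rigid x cl) /\ ((decide w).2 <-> univ_rigid x cl).
Proof.
rewrite /decide tokens_framework size_toks.
case: ifP => [triv|ntriv].
  rewrite [nth _ _ 0]/= [nth _ _ 1]/= !tokN_enc; apply: trivial_rigid.
    move=> k l; apply/rowP => j; have := ltn_ord k; have := ltn_ord j; move: triv; nia.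
  split.
    move=> H; case: (posnP n) => n0; first by right; move: H; rewrite /trivial_case n0; case: N.ltb_spec => //=; lia.
    case: (posnP m) => m0; first by right; move: H; rewrite /trivial_case m0 andbF; case: N.ltb_spec => //=; lia.
    left; split.
      by exists (lshift m (Ordinal n0)); rewrite /cl.
    by exists (rshift n (Ordinal m0)); rewrite /cl /= addn0 ltnn.
  rewrite /trivial_case => -[[[k ck] [l nl]]|N1].
    have ln := ltn_ord l; move: ck nl; rewrite /cl => ck nl.
    by apply/orP; left; apply/andP; split; apply/negP => /N.eqb_spec; lia.
  by apply/orP; right; apply/negP => /N.ltb_spec0; lia.
(* Every coordinate contributes two separators to the word; as [n + m] and [d] are positive here,
   this bounds [n], [m] and [d], and the truncation in [capnat] is harmless. *)
have sw : (2 + (n + m) * (d * 2) <= size w)%N.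
  rewrite /w enc_frameworkE size_cat; apply: leq_trans (leq_addl _ _).
  apply: leq_trans (size_sepcat _); rewrite size_behead size_toks; lia.
have dn : (0 < n + m)%N /\ (0 < d)%N by split; rewrite lt0n; apply/eqP; nia.
have natK i : N.to_nat (N.of_nat i) = i by lia.
rewrite [nth _ _ 0]/= [nth _ _ 1]/= [nth _ _ 2]/= !tokN_enc !capnatE !natK.
have -> : minn (size w) n = n by move: sw dn; nia.
have -> : minn (size w) m = m by move: sw dn; nia.
have -> : minn (size w) d = d by move: sw dn; nia.
rewrite /solve; set H := mkseq _ _.
have sH : size H = (n + m)%N by rewrite size_mkseq.
pose Dn (k : 'I_(n + m)) : RR := \prod_(j < d) (denq (allpts p q k 0 j))%:~R.
have D0 k : 0 < Dn k by apply: prodr_gt0 => j _; rewrite ltr0z denq_gt0.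
have HH (k : 'I_(n + m)) : rv RR (1 + d) (nth [::] H k) = Dn k *: hat x k.
  by rewrite /H nth_mkseq // hatvE.
have [V1 V2] := verdict_spec n sH D0 HH.
split=> //; apply: iff_trans V1 _; split=> V D P EP.
  by have := V D P EP; rewrite -!affdim_hat //; case: dn.
by have := V D P EP; rewrite -!affdim_hat //; case: dn.
Qed.

End Decide.

Theorem mainTheorem12 :
  exists (M : TM) (c k : nat),
    forall (n m d : nat) (p : 'I_n -> 'rV[rat]_d) (q : 'I_m -> 'rV[rat]_d),
      let w := enc_framework p q in
      exists b1 b2 : bool,
        c_state (tm_run M (c * (n + m + size w + 1) ^ k)%N w) = halt_out M b1 b2 /\
        (b1 <-> dimensionally_rigid (realize p) (realize q)) /\
        (b2 <-> universally_rigid (realize p) (realize q)).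
Proof.
have [M [c [k HM]]] := TM_of_PT PT_decide.
exists M, c, k => n m d p q w; exists (decide w).1, (decide w).2; split.
  apply: HM; first exact: enc_framework_sym.
  (* The machine's bound depends on the word length alone; adding [n + m] only weakens it. *)
  rewrite leq_mul2l; apply/orP; right; case: (k) => // k'.
  by rewrite leq_exp2r //; lia.
by rewrite dimensionally_rigidE universally_rigidE; apply: decide_spec.
Qed.
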